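(* Let $A\in\mathrm{Mat}_{m,n}$ and $\tau>0$. If $\tau\notin\mathcal E_{m,n}$, then $$\dim_H\{\mathbf b\in\mathbb T^m:\widehat\omega(A,\mathbf b)\ge\tau\}=\dim_H\{\mathbf b\in\mathbb T^m:\widehat\omega(A,\mathbf b)>\tau\}=\dim_H D_A(\psi_\tau).$$ The same equality holds for the exact level: $\dim_H\{\mathbf b\in\mathbb T^m:\widehat\omega(A,\mathbf b)=\tau\}=\dim_H D_A(\psi_\tau)$ whenever $\{\mathbf b\in\mathbb T^m:\widehat\omega(A,\mathbf b)=\tau\}$ is nonempty. Thus these dimensions are all equal to $$\liminf_{T\to\infty}\frac{\displaystyle\int_1^T r_{A,\tau}(S)\,\frac{dS}{S}-\log\mathcal N_A(T^{-\tau},T)}{(1+\tau)\log T}.$$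
   Context: Let $m,n\in\mathbb N$, $d=m+n$, $\mathbb R_+=(0,\infty)$, and let $\mathrm{Mat}_{m,n}$ be the set of real $m\times n$ matrices. $|\cdot|$ is the supremum norm. $\mathbb T^m=\mathbb R^m/\mathbb Z^m$ carries the quotient supremum metric, and $\dim_H$ is Hausdorff dimension. For a function $\psi:\mathbb R_+\to\mathbb R_+$, $D_A(\psi)$ is the set of $\mathbf b\in\mathbb T^m$ such that for every sufficiently large real $T$ there is $(\mathbf p,\mathbf q)\in\mathbb Z^m\times\mathbb Z^n$ with $|A\mathbf q-\mathbf p-\mathbf b|\le\psi(T)$ and $|\mathbf q|\le T$. $\psi_s(T):=T^{-s}$ for $s>0$. The uniform Diophantine exponent is $\widehat\omega(A,\mathbf b):=\sup\{s>0:\mathbf b\in D_A(\psi_s)\}$, with the supremum of the empty set being $0$. $\mathcal E_{m,n}:=\{b/a: a,b\in\mathbb N,\ 1\le a\le m,\ 1\le b\le n\}$. $u_A=\begin{pmatrix}I_m&A\\0&I_n\end{pmatrix}$, $a_t=\mathrm{diag}(e^{t/m}I_m,e^{-t/n}I_n)$. For a lattice $\Lambda\subset\mathbb R^d$, $\lambda_i(\Lambda)$ is its $i$-th successive minimum relative to $[-1,1]^d$ (the infimum of $\lambda>0$ such that $\lambda[-1,1]^d\cap\Lambda$ contains $i$ linearly independent vectors), and $\lambda_i(t):=\lambda_i(a_tu_A\mathbb Z^d)$. For $R,Q>0$, $$t_{R,Q}:=\frac{mn}{d}\log\frac QR,\qquad \mathcal N_A(R,Q):=\prod_{i=1}^d\max\left\{\frac{Q^{n/d}R^{m/d}}{\lambda_i(t_{R,Q})},1\right\}.$$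 Finally $$r_{A,\tau}(T):=\#\left\{1\le i\le d:\ \lambda_i\left(\tfrac{mn(1+\tau)}{d}\log T\right)<T^{(n-m\tau)/d}\right\}.$$ *)

(* Defs.v *)
From HB Require Import structures.
From mathcomp Require Import all_boot all_order all_algebra.
From mathcomp Require Import generic_quotient.
From mathcomp Require Import all_classical all_reals all_analysis.
From mathcomp Require Import ring lra.

Set Implicit Arguments.
Unset Strict Implicit.
Unset Printing Implicit Defensive.

Import Order.TTheory GRing.Theory Num.Theory.
Import numFieldNormedType.Exports.

Local Open Scope classical_set_scope.
Local Open Scope ring_scope.
Local Open Scope quotient_scope.

Definition intmx (R : realType) (k l : nat) (M : 'M[int]_(k, l)) : 'M[R]_(k, l) :=
  map_mx intr M.
Arguments intmx {R k l} M.

Section torus.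
Variables (R : realType) (m : nat).
Implicit Types u v w : 'cV[R]_m.

Definition eq_modZ u v : bool := `[< exists p : 'cV[int]_m, u - v = intmx p >].

Lemma eq_modZP u v :
  reflect (exists p : 'cV[int]_m, u - v = intmx p) (eq_modZ u v).
Proof. exact: asboolP. Qed.

Lemma eq_modZ_refl : reflexive eq_modZ.
Proof.
by move=> u; apply/eq_modZP; exists 0; rewrite subrr /intmx raddf0.
Qed.

Lemma eq_modZ_sym : symmetric eq_modZ.
Proof.
have H u v : eq_modZ u v -> eq_modZ v u.
  move=> /eq_modZP[p up]; apply/eq_modZP; exists (- p).
  by rewrite /intmx raddfN /= -!/(intmx _) -up opprB.
by move=> u v; apply/idP/idP; exact: H.
Qed.

Lemma eq_modZ_trans : transitive eq_modZ.
Proof.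
move=> v u w /eq_modZP[p up] /eq_modZP[q vq]; apply/eq_modZP; exists (p + q).
by rewrite /intmx raddfD /= -!/(intmx _) -up -vq addrA subrK.
Qed.

Canonical eq_modZ_equiv :=
  EquivRel eq_modZ eq_modZ_refl eq_modZ_sym eq_modZ_trans.

Definition torus := {eq_quot eq_modZ_equiv}.

HB.instance Definition _ := Choice.on torus.
HB.instance Definition _ := EqQuotient.on torus.

Definition lifts (x : torus) : set 'cV[R]_m := [set u | \pi_torus u = x].

(* `|_| on matrices is the supremum norm, so this is the quotient metric. *)
Definition torus_dist (x y : torus) : R :=
  inf [set `|u - v| | u in lifts x & v in lifts y].

Lemma lifts_repr x : lifts x (repr x).
Proof. exact: reprK. Qed.

Lemma lifts_eq x u v :
  lifts x u -> lifts x v -> exists p : 'cV[int]_m, u - v = intmx p.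
Proof.
move=> xu xv; apply/eq_modZP.
by have /eqmodP : u = v %[mod torus] by rewrite xu xv.
Qed.

Lemma lifts_add x u (p : 'cV[int]_m) : lifts x u -> lifts x (u + intmx p).
Proof.
move=> <-; apply/eqmodP/eq_modZP; exists p.
by rewrite addrC addKr.
Qed.

Lemma torus_dist_has_inf x y :
  has_inf [set `|u - v| | u in lifts x & v in lifts y].
Proof.
split; last by exists 0 => _ [u _ [v _ <-]].
by exists `|repr x - repr y|, (repr x); [exact: lifts_repr|];
  exists (repr y); [exact: lifts_repr|].
Qed.

Lemma torus_dist_le x y u v :
  lifts x u -> lifts y v -> torus_dist x y <= `|u - v|.
Proof.
move=> xu yv; apply: ge_inf; first by case: (torus_dist_has_inf x y).
by exists u => //; exists v.
Qed.

Lemma torus_dist_lt x y (e : R) : torus_dist x y < e ->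
  exists u v, [/\ lifts x u, lifts y v & `|u - v| < e].
Proof.
rewrite -subr_gt0 => e0.
have [_ [u xu [v yv <-]]] := inf_adherent e0 (torus_dist_has_inf x y).
by rewrite -/(torus_dist x y) subrKC => uve; exists u, v.
Qed.

Lemma torus_dist_ge0 x y : 0 <= torus_dist x y.
Proof.
apply: lb_le_inf; first by case: (torus_dist_has_inf x y).
by move=> _ [u _ [v _ <-]].
Qed.

Lemma torus_distxx x : torus_dist x x = 0.
Proof.
apply/eqP; rewrite eq_le torus_dist_ge0 andbT.
by have := torus_dist_le (lifts_repr x) (lifts_repr x); rewrite subrr normr0.
Qed.

Lemma torus_dist_sym x y : torus_dist x y = torus_dist y x.
Proof.
by congr inf; apply/seteqP; split => _ [u xu [v yv <-]];
  exists v => //; exists u => //; rewrite distrC.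
Qed.

Lemma torus_dist_triangle y x z :
  torus_dist x z <= torus_dist x y + torus_dist y z.
Proof.
apply/ler_addgt0Pl => e e0.
have e20 : 0 < e / 2 by rewrite divr_gt0.
have [|u [v [xu yv uv]]] := @torus_dist_lt x y (torus_dist x y + e / 2).
  by rewrite ltrDl.
have [|v' [w [yv' zw vw]]] := @torus_dist_lt y z (torus_dist y z + e / 2).
  by rewrite ltrDl.
have [p vp] := lifts_eq yv yv'.
have := torus_dist_le xu (lifts_add p zw); move/le_trans; apply.
rewrite -vp.
have -> : u - (w + (v - v')) = (u - v) + (v' - w).
  by apply/matrixP => i j; rewrite !mxE; ring.
apply: le_trans (ler_normD _ _) _.
apply: le_trans (ltW (ltrD uv vw)) _.
by rewrite addrACA -splitr addrC.
Qed.

Lemma torus_dist_eq0 x y : torus_dist x y = 0 -> x = y.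
Proof.
move=> xy0; pose r := repr x - repr y.
have near_int e : 0 < e -> exists p : 'cV[int]_m, `|r - intmx p| < e.
  move=> e0; have [|u [v [xu yv uv]]] := @torus_dist_lt x y e.
    by rewrite xy0.
  have [p up] := lifts_eq (lifts_repr x) xu.
  have [q vq] := lifts_eq (lifts_repr y) yv.
  exists (p - q); rewrite /intmx raddfB /= -!/(intmx _) -up -vq.
  suff -> : r - (repr x - u - (repr y - v)) = u - v by [].
  by apply/matrixP => i j; rewrite !mxE; ring.
have half_gt0 : 0 < 2^-1 :> R by rewrite invr_gt0.
have [p pr] := near_int _ half_gt0.
suff r0 : r - intmx p = 0.
  rewrite -(reprK x) -(reprK y); apply/eqmodP/eq_modZP; exists p.
  by apply/eqP; rewrite -subr_eq0 r0.
apply/eqP; rewrite -normr_eq0 eq_le normr_ge0 andbT.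
apply/ler_addgt0Pl => e e0; rewrite addr0.
have [q] : exists q : 'cV[int]_m, `|r - intmx q| < Num.min e 2^-1.
  by apply: near_int; rewrite lt_min e0 half_gt0.
rewrite lt_min => /andP[qe qr].
suff -> : p = q by exact: ltW.
have entry (w : 'cV[R]_m) i j : `|w i j| <= `|w|.
  by rewrite /Num.Def.normr /= mx_normrE; exact: (le_bigmax _ _ (i, j)).
apply/matrixP => i j; apply/eqP; rewrite -subr_eq0 -normr_eq0.
have : `|p i j - q i j|%:~R < 1 :> R.
  rewrite intr_norm rmorphB /=.
  have := le_lt_trans (entry _ i j) pr; have := le_lt_trans (entry _ i j) qr.
  by rewrite !mxE !ltr_norml => /andP[? ?] /andP[? ?]; lra.
by rewrite (ltr_int _ _ 1) eq_le normr_ge0 andbT -ltzD1.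
Qed.

HB.instance Definition _ := isMetric.Build R torus
  torus_distxx torus_dist_eq0 torus_dist_sym torus_dist_triangle.

End torus.

Section hausdorff_dimension.
Variables (R : realType) (X : metricType R).
Local Open Scope ereal_scope.

Definition diam (U : set X) : \bar R :=
  ereal_sup [set (mdist x y)%:E | x in U & y in U].

(* |U|^s, with 0^0 = 1 for nonempty U and |set0|^s = 0 *)
Definition diam_pow (s : R) (U : set X) : \bar R :=
  if U == set0 then 0 else diam U `^ s.

Definition hausdorff_premeasure (s delta : R) (E : set X) : \bar R :=
  ereal_inf [set \sum_(0 <= k <oo) diam_pow s (U k) | U in
    [set U : (set X)^nat |
      E `<=` \bigcup_k U k /\ forall k, diam (U k) <= delta%:E]].

Definition hausdorff_measure (s : R) (E : set X) : \bar R :=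
  ereal_sup [set hausdorff_premeasure s delta E |
    delta in [set delta : R | (0 < delta)%R]].

Definition hausdorff_dim (E : set X) : \bar R :=
  ereal_inf [set s%:E | s in
    [set s : R | (0 <= s)%R /\ hausdorff_measure s E = 0]].

End hausdorff_dimension.

Section inhomogeneous_approximation.
Variables (R : realType) (m n : nat) (A : 'M[R]_(m, n)).

(* The choice of the lift of b is immaterial, since p ranges over Z^m. *)
Definition D_A (psi : R -> R) : set (torus R m) :=
  [set b | \forall T \near +oo, exists (p : 'cV[int]_m) (q : 'cV[int]_n),
    `|A *m intmx q - intmx p - repr b| <= psi T /\ `|intmx q : 'cV[R]_n| <= T].

Definition psi_ (s T : R) : R := T `^ (- s).

(* Adjoining 0 makes the supremum 0 when no s > 0 is admissible. *)
Definition omega_hat (b : torus R m) : \bar R :=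
  ereal_sup ([set s%:E | s in [set s : R | 0 < s /\ D_A (psi_ s) b]]
    `|` [set 0%E]).

End inhomogeneous_approximation.

Definition exceptional_levels (R : realType) (m n : nat) : set R :=
  [set b%:R / a%:R | a in [set a | (1 <= a <= m)%N]
                   & b in [set b | (1 <= b <= n)%N]].

(* lambda [-1,1]^d is the ball `|v| <= lambda of the supremum norm. *)
Definition succ_min (R : realType) (d : nat) (L : set 'cV[R]_d) (i : nat) : R :=
  inf [set l | 0 < l /\ exists V : i.-tuple 'cV[R]_d,
    free V /\ forall v, v \in V -> L v /\ `|v| <= l].

Section lattice_flow.
Variables (R : realType) (m n : nat) (A : 'M[R]_(m, n)).

Local Notation d := ((m + n)%:R : R).

Definition u_A : 'M[R]_(m + n) := block_mx 1%:M A 0 1%:M.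

Definition a_ (t : R) : 'M[R]_(m + n) :=
  block_mx (expR (t / m%:R))%:M 0 0 (expR (- t / n%:R))%:M.

Definition flow_lattice (t : R) : set 'cV[R]_(m + n) :=
  [set a_ t *m u_A *m intmx z | z in [set: 'cV[int]_(m + n)]].

Definition lambda_A (i : nat) (t : R) : R := succ_min (flow_lattice t) i.

Definition t_RQ (r Q : R) : R := m%:R * n%:R / d * ln (Q / r).

(* i : 'I_(m + n) is zero-based, whence lambda_A i.+1 below. *)
Definition N_A (r Q : R) : R :=
  \prod_(i < m + n)
    Num.max (Q `^ (n%:R / d) * r `^ (m%:R / d) / lambda_A i.+1 (t_RQ r Q)) 1.

Definition r_A (tau T : R) : nat :=
  #|[pred i : 'I_(m + n) |
      lambda_A i.+1 (m%:R * n%:R * (1 + tau) / d * ln T)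
        < T `^ ((n%:R - m%:R * tau) / d)]|.

End lattice_flow.

(* Main.v *)
(* For the lattice [u_A Z^d], let [mu i x y] be the logarithm of its successive
   minima relative to the box of sides [e ^ - y] ([m] times) and [e ^ x] ([n]
   times), and let [Gam x y] be the sum of the positive parts of [- mu i x y].
   [Gam] is [ln (N_A (e ^ - y) (e ^ x))] and, up to a bounded error, it is the
   logarithm of the number of lattice points of the box; counting shows that it
   is also supermodular up to a bounded error.

   Let [x_k = (1 + eps) ^ k] and [y_k = tau * x_k].  The points approximable to
   within [e ^ - y_k] at height [e ^ x_{k+1}] for all [k] are covered by about
   [exp (sum_(k < K) (Gam x_{k+2} y_k - Gam x_{k+2} y_{k+1}))] balls of radius
   [e ^ - y_K], and adding up lattice points gives a Cantor set of similar points
   with the matching number of branches.  Slightly changing [tau], these two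
   constructions enclose [D_A (psi_ tau)].

   These sums are compared with the integral of the rank [r] along the ray of
   slope [tau]: on a rectangle where no [mu i] changes sign, [Gam] has slope [r]
   along the antidiagonals, and supermodularity turns this into a two-sided
   estimate of its vertical increments.  The remaining scales are those with
   some [mu i] close to [0].  The sum of such a block of small minima moves along
   the ray at a rate [tau * a - b], which is bounded away from [0] exactly
   because [tau] is not of the form [b / a]; hence those scales are rare.

   The exact level is reached by translating the points of larger exponent by a
   point of the level. *)
Require Import Defs.
From mathcomp Require Import all_boot all_order all_algebra.
From mathcomp Require Import finmap generic_quotient.
From mathcomp Require Import all_classical all_reals all_analysis measurable_realfun.
From mathcomp Require Import ring lra zify.

Set Implicit Arguments.
Unset Strict Implicit.
Unset Printing Implicit Defensive.

Import Order.TTheory GRing.Theory Num.Theory.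
Import numFieldNormedType.Exports.

Local Open Scope classical_set_scope.
Local Open Scope ring_scope.

(** The abscissae grow geometrically, so that reaching [x_K] takes only about log [x_K] steps. Each
    step may therefore lose a bounded amount: the constants due to covering, supermodularity and
    dilation of boxes vanish against [x_K].

    The obstacle is that, away from sign changes, one knows only the sum of the slopes of [Gam] in x
    and in - y, namely the rank, while the branching numbers are increments in y alone.
    Supermodularity makes both slopes monotone on a rectangle up to a constant. A single unknown
    slope w then bounds the vertical increments on one edge and the horizontal ones on an adjacent
    edge; when the vertical ones get a weight close to 1 / tau, w cancels. The remaining differences
    of [Gam] telescope along the ray, which produces both the factor 1 + 1 / tau and the term - ln
    N_A of the formula.

    Minima are handled through ranks: passing from (x, y) to (x + theta, y - theta) dilates the box
    by e ^ theta. No reduced basis is needed. Likewise no measure is put on the Cantor set: a greedy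
    choice of a branch escapes any cover that is too cheap. *)

(** * Counting in finite sets *)

Section finite_sets.
Local Open Scope fset_scope.
Local Open Scope nat_scope.

Lemma leq_card_fibers (T U : choiceType) (S : {fset T}) (C : {fset U})
    (f : T -> U) k :
  (forall z, z \in S -> f z \in C) ->
  (forall c, c \in C -> #|` [fset z in S | f z == c]| <= k) ->
  #|` S| <= #|` C| * k.
Proof.
move=> SC fib.
have -> : #|` S| = \sum_(z <- S) \sum_(c <- C | f z == c) 1.
  rewrite card_fset_sum1; apply: eq_big_seq => z zS.
  rewrite -big_filter; have -> : [seq c <- C | f z == c] = [:: f z]; last first.
    by rewrite big_seq1.
  rewrite -(filter_pred1_uniq (fset_uniq C) (SC _ zS)).
  by apply: eq_filter => c; rewrite /= eq_sym.
rewrite (exchange_big_dep xpredT) //= card_fset_sum1 big_distrl /=.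
rewrite big_seq [X in _ <= X]big_seq; apply: leq_sum => c cC.
by rewrite mul1n (leq_trans _ (fib c cC))// card_fset_sum1 big_fset.
Qed.

Lemma leq_card_inj (T U : choiceType) (S : {fset T}) (C : {fset U})
    (f : T -> U) :
  (forall z, z \in S -> f z \in C) -> {in S &, injective f} ->
  #|` S| <= #|` C|.
Proof.
move=> SC finj; rewrite -(card_in_imfset imfset_key finj); apply: fsubset_leq_card.
by apply/fsubsetP => _ /imfsetP[z /= zS ->]; exact: SC.
Qed.

(** Pairs with equal sums satisfy [a - a' = b' - b], so once one pair is fixed, the fibre of a sum
    injects into the common differences. With [D] containing the intersection of two difference sets
    this gives supermodularity; with [D] reduced to 0 it counts disjoint translates. *)
Lemma leq_card_sums (T : zmodType) (A B C D : {fset T}) :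
  (forall a b, a \in A -> b \in B -> (a + b)%R \in C) ->
  (forall a a' b b', a \in A -> a' \in A -> b \in B -> b' \in B ->
     (a + b = a' + b')%R -> (a - a')%R \in D) ->
  #|` A| * #|` B| <= #|` C| * #|` D|.
Proof.
move=> ABC ABD.
pose S := [fset u in [seq (a, b) | a <- A, b <- B]]%fset.
have memS a b : ((a, b) \in S) = (a \in A) && (b \in B).
  rewrite inE; apply/allpairsP/andP => [[[a' b'] /= [? ? [-> ->]]]//|[aA bB]].
  by exists (a, b).
have -> : #|` A| * #|` B| = #|` S|.
  rewrite card_fseq undup_id ?size_allpairs //.
  by apply: allpairs_uniq => //; move=> [? ?] [? ?] _ _ [-> ->].
apply: (@leq_card_fibers _ _ _ _ (fun u : T * T => (u.1 + u.2)%R)).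
  by move=> [a b]; rewrite memS => /andP[]; exact: ABC.
move=> c cC; set F := [fset z in S | _].
have memF a b : ((a, b) \in F) = ((a \in A) && (b \in B)) && ((a + b)%R == c).
  by rewrite -memS /F in_fset /= inE.
have [->|[[a0 b0]]] := fset_0Vmem F; first by rewrite cardfs0.
rewrite memF => /andP[/andP[a0A b0B] /eqP ab0].
apply: (@leq_card_inj _ _ _ _ (fun u => (u.1 - a0)%R)).
  move=> [a b]; rewrite memF => /andP[/andP[aA bB] /eqP ab].
  by apply: (ABD _ _ b b0) => //; rewrite ab.
move=> [a b] [a' b']; rewrite !memF => /andP[_ /eqP ab] /andP[_ /eqP ab'] /=.
by move=> /addIr aa'; move: ab; rewrite -ab' aa' => /addrI ->.
Qed.

(** Covering comes from maximality. The centres of the covers and the branches of the Cantor set are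
    both selected in this way. *)
Lemma maximal_separated (T : choiceType) (e : rel T) (S : {fset T}) :
  reflexive e -> symmetric e ->
  exists W : {fset T}, [/\ {subset W <= S},
    (forall w w', w \in W -> w' \in W -> e w w' -> w = w') &
    forall s, s \in S -> exists2 w, w \in W & e s w].
Proof.
move=> er es; elim/finSet_rect: S => S IH.
have [->|[s sS]] := fset_0Vmem S; first by exists fset0; split.
have [|W [WS Wsep Wcov]] := IH (S `\ s); first by rewrite fproperD1.
have [/hasP[w wW esw]|/hasPn nW] := boolP (has (e s) W).
  exists W; split => // [z /WS|z zS]; first by rewrite !inE => /andP[].
  have [->|zs] := eqVneq z s; first by exists w.
  by apply: Wcov; rewrite !inE zs.
exists (s |` W); split => [z||z zS].
- by rewrite !inE => /predU1P[->//|/WS]; rewrite !inE => /andP[].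
- move=> w w'; rewrite !inE => /predU1P[->|wW] /predU1P[->|w'W] //.
  + by rewrite (negbTE (nW _ w'W)).
  + by rewrite es (negbTE (nW _ wW)).
  + exact: Wsep.
- have [->|zs] := eqVneq z s; first by exists s; rewrite ?inE ?eqxx.
  have [|w wW ezw] := Wcov z; first by rewrite !inE zs.
  by exists w; rewrite // !inE wW orbT.
Qed.

End finite_sets.

(** After a shift by [B] the values lie in an interval of length 2 B starting at 0, which meets at
    most 2 B + 1 unit cells; the fullest cell is kept. *)
Lemma pigeonhole (R : realType) (T : choiceType) (S : {fset T}) (f : T -> R)
    (B : R) :
  0 <= B -> (forall z, z \in S -> `|f z| < B) ->
  exists S' : {fset T}, [/\ {subset S' <= S},
    (forall z z', z \in S' -> z' \in S' -> `|f z - f z'| < 1) &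
    #|` S|%:R <= (2 * B + 1) * #|` S'|%:R].
Proof.
move=> B0 fB; pose K := Num.truncn (2 * B).
pose c z := Num.truncn (f z + B).
have f0 z : z \in S -> 0 <= f z + B.
  by move=> /fB; rewrite ltr_norml => /andP[? _]; lra.
pose F i := [fset z in S | c z == i]%fset.
have cK z : z \in S -> (c z < K.+1)%N.
  move=> zS; rewrite ltnS /c /K; apply: le_truncn.
  by move: (fB _ zS); rewrite ltr_norml => /andP[_ ?]; lra.
have [i Hi] : exists i : 'I_K.+1, forall j : 'I_K.+1, (#|` F j| <= #|` F i|)%N.
  exists [arg max_(i > ord0 :> 'I_K.+1) #|` F i|].
  by case: arg_maxnP => // i _ Hi j; exact: Hi.
exists (F i); split => [z|z z'|].
- by rewrite !inE => /andP[].
- rewrite !inE => /andP[zS /eqP zi] /andP[z'S /eqP z'i].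
  have := truncn_itv (f0 _ zS). have := truncn_itv (f0 _ z'S).
  rewrite -!/(c _) zi z'i -natr1 => /andP[? ?] /andP[? ?].
  by rewrite ltr_norml; apply/andP; split; lra.
- have KB : (K.+1)%:R <= 2 * B + 1.
    by rewrite -natr1 lerD2r truncn_le; lra.
  apply: le_trans (ler_wpM2r _ KB) => //; rewrite -natrM ler_nat.
  pose C := [fset k in iota 0 K.+1]%fset.
  have CK : #|` C| = K.+1.
    by rewrite card_fseq undup_id ?iota_uniq ?size_iota.
  rewrite -[X in (_ <= X * _)%N]CK; apply: (@leq_card_fibers _ _ _ _ c) => [z zS|j].
    by rewrite in_fset [in_mem _ _]mem_iota add0n cK.
  by rewrite in_fset [in_mem _ _]mem_iota add0n => jK; exact: (Hi (Ordinal jK)).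
Qed.

(** * Lattice points in boxes and successive minima *)

Lemma free_extend (K : fieldType) (V : vectType K) (T : eqType) (X : seq V)
    (Y : seq T) (f : T -> V) :
  free X -> (size X < \dim <<map f Y>>)%N ->
  exists2 y, y \in Y & free (f y :: X).
Proof.
move=> fX; apply: contraPP => /= nY; apply/negP; rewrite -leqNgt.
have -> : size X = \dim <<X>> by apply/esym/eqP; rewrite -/(free X).
apply: dimvS; apply/span_subvP => _ /mapP[y yY ->].
by have /negP := fun h => nY (ex_intro2 _ _ y yY h); rewrite free_cons fX andbT negbK.
Qed.

Section lattice.
Variables (R : realType) (m n : nat) (A : 'M[R]_(m, n)).
Local Notation d := (m + n)%N.
Implicit Types (x y c theta : R) (z : 'cV[int]_d).

Definition lat z : 'cV[R]_d := u_A A *m intmx z.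

Definition side x y (p : 'I_d) : R := if (p < m)%N then expR (- y) else expR x.

Definition box x y : set 'cV[int]_d :=
  [set z | forall p, `|lat z p 0| < side x y p].

Lemma side_gt0 x y p : 0 < side x y p.
Proof. by rewrite /side; case: ifP => _; exact: expR_gt0. Qed.

Lemma le_side x y x' y' p : x <= x' -> y' <= y -> side x y p <= side x' y' p.
Proof. by rewrite /side => ? ?; case: ifP => _; rewrite ler_expR// lerN2. Qed.

(** Dilations of the box are antidiagonal moves of (x, y). The form with [ln c] serves numerical
    factors, the form with [theta] the logarithmic minima. *)
Lemma sideD x y c p : 0 < c -> side (x + ln c) (y - ln c) p = c * side x y p.
Proof.
move=> c0; rewrite /side; case: ifP => _.
  by rewrite opprB expRD lnK.
by rewrite expRD lnK// mulrC.
Qed.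

Lemma latB z z' : lat (z - z') = lat z - lat z'.
Proof. by rewrite /lat /intmx raddfB /= mulmxBr. Qed.

Lemma latD z z' : lat (z + z') = lat z + lat z'.
Proof. by rewrite /lat /intmx raddfD /= mulmxDr. Qed.

Lemma lat0 : lat 0 = 0.
Proof. by rewrite /lat /intmx raddf0 mulmx0. Qed.

Lemma latMn z k : lat (z *+ k) = k%:R *: lat z.
Proof. by rewrite scaler_nat; elim: k => [|k IH]; rewrite ?mulr0n ?lat0// !mulrS latD IH. Qed.

Lemma box0 x y : box x y 0.
Proof. by move=> p; rewrite lat0 mxE normr0 side_gt0. Qed.

Lemma le_box x y x' y' z : x <= x' -> y' <= y -> box x y z -> box x' y' z.
Proof. by move=> xx yy bz p; exact: lt_le_trans (bz p) (le_side _ xx yy). Qed.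

Lemma unitmx_u_A : u_A A \in unitmx.
Proof. by rewrite unitmxE det_ublock !det1 mul1r unitr1. Qed.

Lemma lat_bound : exists2 B, 0 < B & forall z (r : R),
  (forall p, `|lat z p 0| <= r) -> forall p, `|(z p 0)%:~R : R| <= B * r.
Proof.
pose U := invmx (u_A A).
exists (1 + \sum_p \sum_k `|U p k|).
  by rewrite ltr_pwDl// !sumr_ge0// => i _; rewrite sumr_ge0.
move=> z r zr p.
have r0 : 0 <= r by exact: le_trans (normr_ge0 _) (zr p).
have -> : (z p 0)%:~R = (U *m lat z) p 0 by rewrite mulKmx ?unitmx_u_A// mxE.
rewrite mxE; apply: le_trans (ler_norm_sum _ _ _) _.
apply: (@le_trans _ _ ((\sum_k `|U p k|) * r)).
  by rewrite mulr_suml ler_sum// => k _; rewrite normrM ler_wpM2l.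
apply: ler_wpM2r => //; rewrite -[leLHS]add0r lerD//.
by rewrite [leRHS](bigD1 p)//= lerDl sumr_ge0// => i _; rewrite sumr_ge0.
Qed.

Lemma lat_inj : injective lat.
Proof.
move=> z z' /eqP; rewrite -subr_eq0 -latB => /eqP zz.
apply/eqP; rewrite -subr_eq0; apply/eqP/colP => p.
have [B _ /(_ (z - z') 0)] := lat_bound.
move=> /(_ _ p) => /(_ (fun p => _)); rewrite mulr0 normr_le0 intr_eq0 => H.
by apply/eqP; rewrite [X in _ == X]mxE; apply: H => q; rewrite zz mxE normr0.
Qed.

Lemma finite_box x y : finite_set (box x y).
Proof.
have [B B0 HB] := lat_bound.
pose r := expR x + expR (- y).
pose N := (Num.truncn (B * r)).+1.
pose f (g : {ffun 'I_d -> 'I_(N + N).+1}) : 'cV[int]_d :=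
  \col_p ((g p)%:Z - N%:Z).
apply: (@sub_finite_set _ _ (f @` setT)); last first.
  by apply: finite_image; exact: finite_finset.
move=> z bz.
have zN p : `|z p 0| <= N%:Z.
  have : `|(z p 0)%:~R : R| <= B * r.
    apply: HB => q; apply: ltW; apply: lt_le_trans (bz q) _.
    by rewrite /side /r; case: ifP => _; rewrite ?lerDl ?lerDr expR_ge0.
  rewrite -intr_norm -(ler_int R) => /le_trans; apply.
  by rewrite -pmulrn; apply/ltW; rewrite truncnS_gt.
exists [ffun p => inord (absz (z p 0 + N%:Z))] => //.
apply/colP => p; rewrite mxE ffunE inordK.
  by move: (zN p); rewrite ler_norml => /andP[? ?]; lia.
by move: (zN p); rewrite ler_norml => /andP[? ?]; lia.
Qed.

Definition bx x y : {fset 'cV[int]_d} := fset_set (box x y).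

Lemma bxP x y z : reflect (box x y z) (z \in bx x y).
Proof. by rewrite in_fset_set ?inE; [exact: asboolP|exact: finite_box]. Qed.

Definition lspan x y : {vspace 'cV[R]_d} := <<[seq lat z | z <- bx x y]>>%VS.

Definition rk x y := \dim (lspan x y).

Lemma lat_lspan x y z : box x y z -> lat z \in lspan x y.
Proof. by move=> bz; apply: memv_span; apply: map_f; apply/bxP. Qed.

Lemma le_lspan x y x' y' : x <= x' -> y' <= y -> (lspan x y <= lspan x' y')%VS.
Proof.
move=> xx yy; apply/span_subvP => _ /mapP[z /bxP bz ->].
by apply: lat_lspan; exact: le_box bz.
Qed.

Lemma le_rk x y x' y' : x <= x' -> y' <= y -> (rk x y <= rk x' y')%N.
Proof. by move=> xx yy; exact: dimvS (le_lspan _ _). Qed.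

Lemma rk_le_dim x y : (rk x y <= d)%N.
Proof. by rewrite (leq_trans (dimvS (subvf _)))// dimvf /dim /= muln1. Qed.

Lemma rk_free x y (s : seq 'cV[int]_d) :
  (forall z, z \in s -> box x y z) -> free (map lat s) -> (size s <= rk x y)%N.
Proof.
move=> sb fs; have /eqP <- : \dim <<map lat s>> == size s.
  by rewrite -(size_map lat s) -/(free _).
by apply: dimvS; apply/span_subvP => _ /mapP[z /sb bz ->]; exact: lat_lspan.
Qed.

Lemma free_rk x y i : (i <= rk x y)%N ->
  exists s : seq 'cV[int]_d, [/\ size s = i, free (map lat s) &
    forall z, z \in s -> box x y z].
Proof.
elim: i => [_|i IH ir]; first by exists [::]; split; rewrite ?nil_free.
have [s [si fs sb]] := IH (ltnW ir).
have [|z /bxP bz fz] := @free_extend _ _ _ _ (bx x y) lat fs.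
  by rewrite size_map si.
exists (z :: s); split; rewrite /= ?si// => w.
by rewrite inE => /predU1P[->//|/sb].
Qed.

(** A large enough dilated box contains the images of the standard basis. This makes the sets whose
    infima are the successive minima nonempty. *)
Lemma rk_full x y : exists2 c, 0 < c & (d <= rk (x + ln c) (y - ln c))%N.
Proof.
pose e (p : 'I_d) : 'cV[int]_d := delta_mx p 0.
pose c := 1 + \sum_p \sum_q `|lat (e p) q 0| / side x y q.
have c0 : 0 < c.
  by rewrite ltr_pwDl// !sumr_ge0// => i _; rewrite sumr_ge0// => j _; rewrite divr_ge0// ltW// side_gt0.
exists c => //; pose s := [seq e p | p <- enum 'I_d].
have -> : d = size s by rewrite size_map size_enum_ord.
apply: rk_free => [_ /mapP[p _ ->] q|].
  rewrite sideD// -ltr_pdivrMr ?side_gt0//.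
  rewrite -[ltLHS]add0r ltr_leD//.
  rewrite (bigD1 p)//= (bigD1 q)//= -addrA lerDl addr_ge0// !sumr_ge0// => i _.
    by rewrite divr_ge0// ltW// side_gt0.
  by rewrite sumr_ge0// => j _; rewrite divr_ge0// ltW// side_gt0.
have -> : map lat s = [tuple lat (e p) | p < d] by rewrite /= -map_comp.
have eE i j : (intmx (e i) : 'cV[R]_d) j 0 = (j == i)%:R.
  by rewrite !mxE eqxx andbT; case: eqP.
apply/freeP => k k0 p.
have : u_A A *m (\col_p k p) = 0.
  rewrite -k0; apply/colP => q; rewrite mxE summxE; apply: eq_bigr => i _.
  rewrite -tnth_nth tnth_mktuple [LHS]mulrC.
  rewrite [X in X * _ = _]mxE [RHS]mxE; congr (_ * _).
  rewrite [RHS]mxE (bigD1 i)//= eE eqxx mulr1.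
  by rewrite big1 ?addr0// => j ji; rewrite eE (negbTE ji) mulr0.
move/(congr1 (mulmx (invmx (u_A A)))); rewrite mulKmx ?unitmx_u_A// mulmx0.
by move/colP/(_ p); rewrite !mxE.
Qed.

End lattice.

Lemma free_map_inj (K : fieldType) (V W : vectType K) (f : {linear V -> W})
    (X : seq V) : injective f -> free (map f X) = free X.
Proof.
move=> finj; rewrite -[X]/(tval (in_tuple X)).
move: (in_tuple X); move: (size X) => k {}X.
have fsum c : \sum_(i < k) c i *: [tuple of map f X]`_i
    = f (\sum_(i < k) c i *: X`_i).
  rewrite linear_sum; apply: eq_bigr => i _.
  by rewrite linearZ /= (nth_map 0) ?size_tuple.
apply/idP/idP => /freeP H; apply/freeP => c c0.
  by apply: H; rewrite fsum c0 linear0.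
by apply: H; apply: finj; rewrite -fsum c0 linear0.
Qed.

Lemma cV_normP (R : realType) k (v : 'cV[R]_k) (l : R) : 0 < l ->
  reflect (forall p, `|v p 0| < l) (`|v| < l).
Proof.
move=> l0; rewrite /Num.Def.normr /= mx_normrE; apply: (iffP idP) => [vl p|H].
  by apply: le_lt_trans vl; exact: (le_bigmax _ _ (p, 0)).
by apply/bigmax_ltP; split=> // -[i j] _ /=; rewrite (ord1 j); exact: H.
Qed.

Lemma cV_norm_leP (R : realType) k (v : 'cV[R]_k) (l : R) : 0 <= l ->
  reflect (forall p, `|v p 0| <= l) (`|v| <= l).
Proof.
move=> l0; rewrite /Num.Def.normr /= mx_normrE; apply: (iffP idP) => [vl p|H].
  by apply: le_trans vl; exact: (le_bigmax _ _ (p, 0)).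
by apply/bigmax_leP; split=> // -[i j] _ /=; rewrite (ord1 j); exact: H.
Qed.

Section successive_minima.
Variables (R : realType) (m n : nat) (A : 'M[R]_(m, n)).
Hypotheses (m_gt0 : (0 < m)%N) (n_gt0 : (0 < n)%N).
Local Notation d := (m + n)%N.
Local Notation box := (box A).
Local Notation rk := (rk A).
Local Notation lat := (lat A).
Implicit Types (x y c theta : R) (z : 'cV[int]_d).

(** The two equations t / m - y = s and x - t / n = s have the solution t = [time x y], s =
    [scale x y]: at this time the flow turns the box of sides e ^ - y and e ^ x into a cube of side
    e ^ s. *)
Definition time x y : R := m%:R * n%:R / (m + n)%:R * (x + y).

Definition scale x y : R := (n%:R * x - m%:R * y) / (m + n)%:R.

(* [mu i] is the logarithm of the successive minimum of index [i.+1] of the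
   lattice relative to the box of sides [e ^ - y] and [e ^ x]. *)
Definition mu i x y : R := ln (lambda_A A i.+1 (time x y)) - scale x y.

Lemma entry_a (t : R) (v : 'cV[R]_d) (p : 'I_d) :
  (a_ m n t *m v) p 0 =
  (if (p < m)%N then expR (t / m%:R) else expR (- t / n%:R)) * v p 0.
Proof.
rewrite -[v]vsubmxK /a_ mul_block_col !mul0mx addr0 add0r !mul_scalar_mx.
case: (splitP p) => j pj.
  have -> : p = lshift n j by exact/val_inj.
  by rewrite !col_mxEu mxE.
have -> : p = rshift m j by exact/val_inj.
by rewrite !col_mxEd mxE.
Qed.

Lemma norm_flow x y c z : 0 < c ->
  reflect (box (x + ln c) (y - ln c) z)
    (`|a_ m n (time x y) *m u_A A *m intmx z| < c * expR (scale x y)).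
Proof.
move=> c0; have ce : 0 < c * expR (scale x y) by rewrite mulr_gt0 ?expR_gt0.
have m0 : m%:R != 0 :> R by rewrite pnatr_eq0 -lt0n.
have n0 : n%:R != 0 :> R by rewrite pnatr_eq0 -lt0n.
have d0 : m%:R + n%:R != 0 :> R by rewrite -natrD pnatr_eq0 -lt0n addn_gt0 m_gt0.
have step p : (`|(a_ m n (time x y) *m u_A A *m intmx z) p 0| <
    c * expR (scale x y)) = (`|lat z p 0| < side (x + ln c) (y - ln c) p).
  rewrite -mulmxA entry_a normrM sideD// /side; case: ifP => _.
    rewrite ger0_norm ?expR_ge0// -[RHS](ltr_pM2l (expR_gt0 (scale x y + y))).
    congr (_ < _).
      by congr (expR _ * _); rewrite /scale /time natrD; field; rewrite m0 d0.
    by rewrite mulrCA -expRD addrK.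
  rewrite ger0_norm ?expR_ge0// -[RHS](ltr_pM2l (expR_gt0 (scale x y - x))).
  congr (_ < _).
    by congr (expR _ * _); rewrite /scale /time natrD; field; rewrite n0 d0.
  by rewrite mulrCA -expRD subrK.
apply: (iffP (cV_normP _ ce)) => H p; first by rewrite -step.
by rewrite step.
Qed.

Let minset i x y := [set l | 0 < l /\ exists V : i.-tuple 'cV[R]_d,
  free V /\ forall v, v \in V -> flow_lattice A (time x y) v /\ `|v| <= l].

Lemma unitmx_a (t : R) : a_ m n t \in unitmx.
Proof.
by rewrite unitmxE det_ublock !det_scalar unitrM !unitrX// unitfE expR_eq0.
Qed.

Lemma free_flow t (s : seq 'cV[int]_d) :
  free [seq a_ m n t *m u_A A *m intmx z | z <- s] = free (map lat s).
Proof.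
rewrite (@eq_map _ _ _ (mulmx (a_ m n t) \o lat)); last first.
  by move=> z; rewrite /= mulmxA.
rewrite map_comp; apply: free_map_inj => v w /(congr1 (mulmx (invmx (a_ m n t)))).
by rewrite !mulKmx // unitmx_a.
Qed.

Lemma lambda_ltP i x y c : (i < d)%N -> 0 < c ->
  (lambda_A A i.+1 (time x y) < c * expR (scale x y)) =
  (i < rk (x + ln c) (y - ln c))%N.
Proof.
move=> id c0.
have flowP c' (s : seq 'cV[int]_d) : 0 < c' -> (i < rk (x + ln c') (y - ln c'))%N ->
    exists2 l, l < c' * expR (scale x y) & minset i.+1 x y l.
  move=> c'0 /free_rk[{}s [si fs sb]].
  pose v z := a_ m n (time x y) *m u_A A *m intmx z : 'cV[R]_d.
  pose h := \big[Num.max/0]_(z <- s) `|v z|.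
  have hs z : z \in s -> `|v z| <= h.
    by move=> zs; apply: (le_bigmax_seq 0 z xpredT).
  have hlt : h < c' * expR (scale x y).
    rewrite /h big_seq; elim/big_ind : _ => //.
    - by rewrite mulr_gt0 ?expR_gt0.
    - by move=> a b ? ?; rewrite gt_max; apply/andP.
    - by move=> z /sb bz; apply/norm_flow.
  have h0 : 0 <= h by rewrite /h; elim/big_ind: _ => // a b ? ?; rewrite le_max; apply/orP; left.
  (* [succ_min] requires a positive level. The midpoint is positive and still strictly below the
     bound, whatever the value of [h]. *)
  exists ((h + c' * expR (scale x y)) / 2); first by lra.
  split; first by lra.
  have sz : size [seq v z | z <- s] == i.+1 by rewrite size_map si.
  exists (Tuple sz); split; first by rewrite /= free_flow.
  move=> _ /mapP[z zs ->]; split; first by exists z.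
  by rewrite (le_trans (hs z zs))//; lra.
have lb : has_lbound (minset i.+1 x y) by exists 0 => l [/ltW].
apply/idP/idP => [lc|/(flowP c [::] c0)[l lc lS]]; last first.
  by apply: le_lt_trans lc; exact: ge_inf.
(* An infimum can only be approached inside a nonempty set; that of the empty set would be a default
   value. *)
have [c' c'0 dc'] := rk_full A x y.
have [l0 _ l0S] := flowP c' [::] c'0 (leq_trans id dc').
have [l lS llc] : exists2 l, minset i.+1 x y l & l < c * expR (scale x y).
  have e0 : 0 < c * expR (scale x y) - lambda_A A i.+1 (time x y).
    by rewrite subr_gt0.
  have [|l lS ll] := @inf_adherent _ (minset i.+1 x y) _ e0.
    by split=> //; exists l0.
  by exists l => //; rewrite addrC subrK in ll.
case: lS => l_gt0 [V [fV VS]].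
have [s sV] : exists s, tval V = [seq a_ m n (time x y) *m u_A A *m intmx z | z <- s].
  have : forall v, v \in tval V -> flow_lattice A (time x y) v by move=> v /VS[].
  elim: (tval V) => [_|v t IH H]; first by exists [::].
  have [w ws|s ->] := IH; first by apply: H; rewrite inE ws orbT.
  have [z _ <-] := H v (mem_head _ _).
  by exists (z :: s).
have <- : size s = i.+1 by rewrite -(size_tuple V) sV size_map.
apply: rk_free => [z zs|]; last by rewrite -(free_flow (time x y)) -sV.
apply/norm_flow => //; apply: le_lt_trans llc.
have vV : a_ m n (time x y) *m u_A A *m intmx z \in tval V.
  by rewrite sV; apply/mapP; exists z.
by have [] := VS _ vV.
Qed.

(** Integer coordinates of absolute value less than 1 vanish, so a small box holds only 0. Hence the
    minima are positive and their logarithms are not default values. *)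
Lemma rk_small x y : exists2 c, 0 < c & rk (x + ln c) (y - ln c) = 0%N.
Proof.
have [B B0 HB] := lat_bound A.
pose r := expR x + expR (- y).
have r0 : 0 < r by rewrite addr_gt0 ?expR_gt0.
exists (2 * (B * r))^-1; first by rewrite invr_gt0 !mulr_gt0.
have c0 : 0 < (2 * (B * r))^-1 by rewrite invr_gt0 !mulr_gt0.
apply/eqP; rewrite -leqn0 leqNgt; apply/negP => /free_rk[[|z [|? ?]] [//= _ fz zb]].
have z0 : z = 0.
  apply/colP => p; rewrite [RHS]mxE; apply/eqP; rewrite -normr_eq0.
  rewrite eq_le normr_ge0 andbT -ltzD1 add0r -(ltr_int R) intr_norm.
  apply: (@le_lt_trans _ _ 2^-1); last by lra.
  have -> : 2^-1 = B * ((2 * (B * r))^-1 * r).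
    by field; rewrite !gt_eqF.
  apply: HB => q; apply/ltW/(lt_le_trans (zb z (mem_head _ _) q)).
  rewrite sideD// ler_pM2l// /side /r.
  by case: ifP => _; rewrite ?lerDl ?lerDr expR_ge0.
by move: fz; rewrite z0 /= lat0 seq1_free eqxx.
Qed.

Lemma lambda_gt0 i x y : (i < d)%N -> 0 < lambda_A A i.+1 (time x y).
Proof.
move=> id; rewrite ltNge; apply/negP => l0.
have [c c0 rc] := rk_small x y.
have := lambda_ltP x y id c0; rewrite rc ltn0 => /negP; apply.
by rewrite (le_lt_trans l0)// mulr_gt0// expR_gt0.
Qed.

(** The dictionary between minima and ranks: the behaviour of [mu] under dilation, its monotonicity
    in the box and its ordering in [i] are all read off from it. *)
Lemma mu_ltP i x y theta : (i < d)%N ->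
  (mu i x y < theta) = (i < rk (x + theta) (y - theta))%N.
Proof.
move=> id; have := lambda_ltP x y id (expR_gt0 theta); rewrite expRK => <-.
by rewrite /mu ltrBlDr -expRD -[RHS]ltr_ln ?posrE ?lambda_gt0 ?expR_gt0// expRK.
Qed.

Lemma mu_leP i x y theta : (i < d)%N ->
  (theta <= mu i x y) = (rk (x + theta) (y - theta) <= i)%N.
Proof. by move=> id; rewrite leNgt mu_ltP// -leqNgt. Qed.

Lemma mu_diag i x y theta : (i < d)%N ->
  mu i (x + theta) (y - theta) = mu i x y - theta.
Proof.
move=> id; have H t : (mu i (x + theta) (y - theta) < t) = (mu i x y - theta < t).
  by rewrite [RHS]ltrBlDr !mu_ltP// [t + _]addrC addrA opprD addrA.
by apply/eqP; rewrite eq_le !leNgt H ltxx -H ltxx.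
Qed.

Lemma le_mu i x y x' y' : (i < d)%N -> x <= x' -> y' <= y ->
  mu i x' y' <= mu i x y.
Proof.
move=> id xx yy; rewrite leNgt mu_ltP//; apply/negP => ir.
have : mu i x' y' < mu i x' y'.
  rewrite mu_ltP//; apply: leq_trans ir (le_rk _ _ _); by rewrite lerD2r.
by rewrite ltxx.
Qed.

Lemma mu_nondecreasing i j x y : (i <= j)%N -> (j < d)%N ->
  mu i x y <= mu j x y.
Proof.
move=> ij jd; rewrite leNgt mu_ltP//; apply/negP => /(leq_ltn_trans ij).
by rewrite -mu_ltP ?ltxx// (leq_ltn_trans ij).
Qed.

Lemma rk_mu i x y : (i < d)%N -> (i < rk x y)%N = (mu i x y < 0).
Proof. by move=> id; rewrite mu_ltP// addr0 subr0. Qed.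

(* The logarithm of [N_A A (e ^ - y) (e ^ x)], which is within a bounded
   distance of the logarithm of the number of points of [box x y]. *)
Definition Gam x y : R := \sum_(i < d) Num.max (- mu i x y) 0.

Lemma ln_N_A x y : ln (N_A A (expR (- y)) (expR x)) = Gam x y.
Proof.
have tE : t_RQ m n (expR (- y)) (expR x) = time x y.
  by rewrite /t_RQ -expRN opprK -expRD expRK.
rewrite /N_A tE.
rewrite (eq_bigr (fun i : 'I_d => expR (Num.max (- mu i x y) 0))).
  by rewrite -expR_sum expRK.
move=> i _; rewrite /powR !gt_eqF ?expR_gt0// !expRK.
have l0 := lambda_gt0 x y (ltn_ord i).
have -> : expR (n%:R / (m + n)%:R * x) * expR (m%:R / (m + n)%:R * - y) /
    lambda_A A i.+1 (time x y) = expR (- mu i x y).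
  rewrite /mu opprB expRD expRN lnK ?posrE// -expRD; congr (expR _ * _).
  by rewrite /scale mulrBl; ring.
rewrite /Num.max -expR0 ltr_expR; by case: ifP.
Qed.

End successive_minima.

(** * Counting lattice points *)

(* A minor of maximal absolute value is chosen; Cramer's rule does the rest. *)
Lemma dominant_rows (R : realFieldType) d j (M : 'M[R]_(d, j)) : row_full M ->
  exists2 f : {ffun 'I_j -> 'I_d}, injective f &
  forall (c : 'cV[R]_j) p,
    `|(M *m c) p 0| <= \sum_k `|(M *m c) (f k) 0|.
Proof.
move=> fM; pose D (f : {ffun 'I_j -> 'I_d}) := `|\det (rowsub f M)|.
have [f fmax] : exists f, forall g, D g <= D f.
  exists [arg max_(f > fullrankfun fM) D f]%O.
  by case: arg_maxP => // f _ H g; exact: H.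
have Df : rowsub f M \in unitmx.
  rewrite unitmxE unitfE -normr_gt0; apply: lt_le_trans (fmax (fullrankfun fM)).
  by rewrite normr_gt0 -unitfE -unitmxE -row_full_unit fullrowsub_full.
pose F := rowsub f M; pose W := M *m invmx F.
have WF : W *m F = M by rewrite mulmxKV.
have Wf : rowsub f W = 1%:M by rewrite -mul_rowsub_mx mulmxV.
have W1 p k : `|W p k| <= 1.
  pose g := [ffun i => if i == k then p else f i].
  have dg : \det (rowsub g W) = W p k.
    rewrite (expand_det_col _ k) (bigD1 k)//= big1 ?addr0 => [|i ik]; last first.
      rewrite mxE ffunE (negbTE ik).
      by have /matrixP/(_ i k) := Wf; rewrite !mxE (negbTE ik) => ->; rewrite mul0r.
    rewrite !mxE ffunE eqxx /cofactor -signr_odd oddD addbb mul1r.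
    suff -> : row' k (col' k (rowsub g W)) = 1%:M by rewrite det1 mulr1.
    apply/matrixP => i i'; rewrite !mxE ffunE eq_sym (negbTE (neq_lift _ _)).
    by have /matrixP/(_ (lift k i) (lift k i')) := Wf; rewrite !mxE (inj_eq lift_inj).
  have := fmax g; rewrite /D -{1}WF -mul_rowsub_mx det_mulmx dg normrM.
  by rewrite ger_pMl // normr_gt0 -unitfE -unitmxE.
exists f => [k k' fk|c p].
  apply/eqP/negPn/negP => kk'.
  have /matrixP Wf' := Wf; have := Wf' k k'; have := Wf' k' k'.
  by rewrite !mxE -fk (negbTE kk') eqxx => -> /eqP; rewrite oner_eq0.
have vE : M *m c = W *m rowsub f (M *m c) by rewrite -mul_rowsub_mx mulmxA WF.
rewrite {1}vE mxE; apply: le_trans (ler_norm_sum _ _ _) _.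
by apply: ler_sum => k _; rewrite normrM [rowsub _ _ _ _]mxE -[leRHS]mul1r ler_wpM2r.
Qed.

(** The rows of a basis matrix of [V], rescaled by [w], reduce this to [dominant_rows]. When [w]
    lists the sides of a box, smallness in [\dim V] coordinates forces a vector of [V] into the box,
    which spares any computation of volumes in [V]. *)
Lemma dominant_coords (R : realFieldType) d (V : {vspace 'cV[R]_d})
    (w : 'I_d -> R) : (forall p, 0 < w p) ->
  exists2 f : {ffun 'I_(\dim V) -> 'I_d}, injective f &
  forall v p, v \in V -> `|v p 0| / w p <= \sum_k `|v (f k) 0| / w (f k).
Proof.
move=> w0; pose M := \matrix_(p < d, k < \dim V) ((vbasis V)`_k p 0 / w p).
have Mc (c : 'cV[R]_(\dim V)) p :
    (M *m c) p 0 = (\sum_k c k 0 *: (vbasis V)`_k) p 0 / w p.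
  rewrite mxE summxE mulr_suml; apply: eq_bigr => k _.
  by rewrite [M _ _]mxE [in RHS]mxE mulrC mulrA.
have fM : row_full M.
  rewrite /row_full -mxrank_tr; apply: inj_row_free => u uM.
  have /freeP/(_ (u 0)) := basis_free (vbasisP V); move=> fb.
  apply/rowP => k; rewrite [RHS]mxE; apply: fb; apply/colP => p; rewrite [RHS]mxE.
  have /colP/(_ p) : M *m u^T = 0 by rewrite -[M]trmxK -trmx_mul uM trmx0.
  rewrite Mc [RHS]mxE => /eqP; rewrite mulf_eq0 invr_eq0 (gt_eqF (w0 p)) orbF => /eqP <-.
  by congr (fun_of_matrix _ p 0); apply: eq_bigr => i _; rewrite mxE.
have [f finj Hf] := dominant_rows fM; exists f => // v p vV.
pose c := \col_k coord (vbasis V) k v.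
have vE q : (M *m c) q 0 = v q 0 / w q.
  rewrite Mc [in RHS](coord_vbasis vV); congr (fun_of_matrix _ q 0 / _).
  by apply: eq_bigr => i _; rewrite mxE.
have nE q : `|v q 0| / w q = `|(M *m c) q 0|.
  by rewrite vE normrM [ `|_^-1|]ger0_norm// invr_ge0 ltW.
by rewrite nE (eq_bigr _ (fun k _ => nE (f k))).
Qed.

Lemma pigeonhole_seq (R : realType) (T : choiceType) (J : eqType) (I : seq J)
    (S : {fset T}) (f : J -> T -> R) (B : J -> R) :
  (forall k, 0 <= B k) -> (forall k z, z \in S -> `|f k z| < B k) ->
  exists S' : {fset T}, [/\ {subset S' <= S},
    (forall k z z', k \in I -> z \in S' -> z' \in S' -> `|f k z - f k z'| < 1) &
    #|` S|%:R <= (\prod_(k <- I) (2 * B k + 1)) * #|` S'|%:R].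
Proof.
move=> B0; elim: I S => [|k I IH] S fB.
  by exists S; split => //; rewrite big_nil mul1r.
have [S1 [S1S S1k S1c]] := pigeonhole (B0 k) (fB k).
have [|S2 [S2S1 S2I S2c]] := IH S1; first by move=> i z /S1S; exact: fB.
exists S2; split => [z /S2S1/S1S//|i z z'|].
  by rewrite inE => /predU1P[->|iI] zS z'S; [apply: S1k; exact: S2S1|exact: S2I].
rewrite big_cons -mulrA; apply: le_trans S1c _; rewrite ler_wpM2l//.
by rewrite addr_ge0// mulr_ge0.
Qed.

Section box_counting.
Variables (R : realType) (m n : nat) (A : 'M[R]_(m, n)).
Local Notation d := (m + n)%N.
Local Notation box := (box A).
Local Notation lat := (lat A).
Implicit Types (x y c theta : R) (z : 'cV[int]_d).

Definition npt x y : R := ln #|` bx A x y|%:R.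

Lemma card_bx_gt0 x y : (0 < #|` bx A x y|)%N.
Proof. by rewrite cardfs_gt0; apply/fset0Pn; exists 0; apply/bxP; exact: box0. Qed.

Lemma expR_npt x y : expR (npt x y) = #|` bx A x y|%:R.
Proof. by rewrite lnK// posrE ltr0n card_bx_gt0. Qed.

(** The loss in [npt_cover]: at most d coordinates are cut into cells of 1 / (d + 1) of a side, each
    costing a factor 2 (d + 1) + 1 on top of the ratio of the sides. *)
Definition cover_cst : R := d%:R * ln (2 * d.+1%:R + 1).

Lemma cover_cst_ge0 : 0 <= cover_cst.
Proof. by rewrite mulr_ge0// ln_ge0// lerDr mulr_ge0. Qed.

(** Of the dominant coordinates of [V], [a] lie among the first m and the others among the last n.
    Cutting the large box along them into cells of 1 / (d + 1) of a side of the small box puts the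
    difference of two points of a cell into the small box. The type [a] can be fixed before [theta],
    since a dilation multiplies all sides by one factor and preserves dominance. *)
Lemma npt_cover x y (V : {vspace 'cV[R]_d}) :
  exists a, [/\ (a <= m)%N, (a <= \dim V)%N, (\dim V <= a + n)%N &
    forall theta x' y', x + theta <= x' -> y' <= y - theta ->
    (forall z, box x' y' z -> lat z \in V) ->
    npt x' y' <= npt (x + theta) (y - theta) + a%:R * (y - theta - y')
      + (\dim V - a)%:R * (x' - (x + theta)) + cover_cst].
Proof.
have [f finj Hf0] := dominant_coords V (side_gt0 x y).
pose up : {set 'I_(\dim V)} := [set k | (f k < m)%N]%SET.
have dV : (\dim V <= d)%N.
  by rewrite (leq_trans (dimvS (subvf _)))// dimvf /dim /= muln1.
have cup : #|(~: up)%SET| = (\dim V - #|up|)%N by rewrite cardsCs finset.setCK card_ord.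
have upm : (#|up| <= m)%N.
  have : (#|f @: up| <= #|lshift n @: [set: 'I_m]%SET|)%N.
    apply: subset_leq_card; apply/fintype.subsetP => _ /imsetP[k + ->].
    rewrite inE => fkm; apply/imsetP; exists (Ordinal fkm) => //; exact/val_inj.
  rewrite (card_imset _ finj) (card_imset _ (@lshift_inj m n)) cardsT.
  by rewrite card_ord.
have upn : (#|(~: up)%SET| <= n)%N.
  have : (#|f @: (~: up)%SET| <= #|@rshift m n @: [set: 'I_n]%SET|)%N.
    apply: subset_leq_card; apply/fintype.subsetP => _ /imsetP[k + ->].
    rewrite !inE -leqNgt => mfk; apply/imsetP.
    have fkn : (f k - m < n)%N by rewrite ltn_subLR// ltn_ord.
    by exists (Ordinal fkn) => //; apply/val_inj; rewrite /= subnKC.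
  rewrite (card_imset _ finj) (card_imset _ (@rshift_inj m n)) cardsT.
  by rewrite card_ord.
exists #|up|; split => //.
- by rewrite (leq_trans (max_card _))// card_ord.
- by rewrite -leq_subLR -cup.
move=> theta x' y' xx yy bV.
have sE q : side (x + theta) (y - theta) q = expR theta * side x y q.
  by have := sideD x y q (expR_gt0 theta); rewrite expRK.
have Hf v p : v \in V -> `|v p 0| / side (x + theta) (y - theta) p <=
    \sum_k `|v (f k) 0| / side (x + theta) (y - theta) (f k).
  move=> /(Hf0 v p) H; have := ler_wpM2l (expR_ge0 (- theta)) H.
  rewrite mulr_sumr expRN sE invfM mulrCA => /le_trans; apply.
  by apply: ler_sum => k _; rewrite sE invfM [leRHS]mulrCA.
move: Hf xx yy; set X := x + theta; set Y := y - theta => {Hf0 sE} Hf xx yy.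
move: X Y Hf xx yy => {theta y}x y Hf xx yy.
pose D k := side x' y' (f k) / side x y (f k).
pose B k := d.+1%:R * D k.
have D1 k : 1 <= D k by rewrite ler_pdivlMr ?side_gt0// mul1r le_side.
have B0 k : 0 <= B k by rewrite mulr_ge0// (le_trans _ (D1 k)).
pose g k z := d.+1%:R * (lat z (f k) 0 / side x y (f k)).
have gB k z : z \in bx A x' y' -> `|g k z| < B k.
  move=> /bxP/(_ (f k)) bz; rewrite normrM ger0_norm// ltr_pM2l//.
  by rewrite normrM [ `|_^-1|]gtr0_norm ?invr_gt0 ?side_gt0// ltr_pM2r ?invr_gt0 ?side_gt0.
have [S [Ssub Sg Sc]] := pigeonhole_seq (index_enum 'I_(\dim V)) B0 gB.
have [S0|[z0 z0S]] := fset_0Vmem S.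
  by move: Sc; rewrite S0 cardfs0 mulr0 -[0]/(0%:R) ler_nat leqn0 -leqn0 leqNgt card_bx_gt0.
have SN : (#|` S| <= #|` bx A x y|)%N.
  apply: (@leq_card_inj _ _ _ _ (fun z => z - z0)) => [z zS|z z' _ _ /addIr//].
  apply/bxP => p; rewrite -[ltRHS]mul1r -ltr_pdivrMr ?side_gt0//.
  have lV : lat (z - z0) \in V by rewrite latB memvB// bV//; apply/bxP; exact: Ssub.
  apply: le_lt_trans (Hf _ _ lV) _.
  have dp : 0 < d.+1%:R :> R by rewrite ltr0n.
  apply: (@le_lt_trans _ _ (\sum_(k < \dim V) d.+1%:R^-1)); last first.
    rewrite sumr_const card_ord -[_ *+ \dim V]mulr_natl ltr_pdivrMr// mul1r.
    by rewrite ltr_nat ltnS.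
  apply: ler_sum => k _; apply: ltW.
  have := Sg k z z0 (mem_index_enum k) zS z0S.
  rewrite -mulrBr normrM ger0_norm// -mulrBl -[lat z (f k) 0 - _]/_.
  rewrite normrM [ `|_^-1|]gtr0_norm ?invr_gt0 ?side_gt0//.
  rewrite latB !mxE => h; by rewrite -(ltr_pM2l dp) divff ?gt_eqF.
pose K : R := ln (2 * d.+1%:R + 1).
have K0 : 0 < 2 * d.+1%:R + 1 :> R by rewrite ltr_wpDl// mulr_ge0.
pose del k := if (f k < m)%N then y - y' else x' - x.
have DE k : D k = expR (del k).
  by rewrite /D /side /del; case: ifP => _; rewrite -expRN -expRD// opprK addrC.
have PB k : 0 <= 2 * B k + 1 by rewrite addr_ge0// mulr_ge0.
have BD k : 2 * B k + 1 <= expR (K + del k).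
  by rewrite expRD lnK ?posrE// -DE /B; move: (D1 k); lra.
have prodle : \prod_(k < \dim V) (2 * B k + 1) <= expR (\sum_(k < \dim V) (K + del k)).
  by rewrite expR_sum; apply: ler_prod => k _; rewrite PB BD.
apply: (@le_trans _ _ (\sum_(k < \dim V) (K + del k) + npt x y)).
  by rewrite -ler_expR expRD !expR_npt (le_trans Sc)// ler_pM ?prodr_ge0 ?ler_nat.
have sdel : \sum_(k < \dim V) del k =
    #|up|%:R * (y - y') + (\dim V - #|up|)%:R * (x' - x).
  rewrite (bigID (mem up)) /= -cup; congr (_ + _).
    rewrite (eq_bigr (fun=> y - y')); last by move=> k; rewrite inE /del => ->.
    by rewrite sumr_const mulr_natl.
  rewrite (eq_bigr (fun=> x' - x)); last first.
    by move=> k; rewrite inE /del => /negbTE ->.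
  rewrite sumr_const mulr_natl; congr (_ *+ _).
  by apply: eq_card => k; rewrite finset.in_setC.
have KD : (\dim V)%:R * K <= cover_cst.
  by rewrite /cover_cst ler_wpM2r ?ler_nat// ln_ge0// lerDr mulr_ge0.
rewrite big_split /= sumr_const card_ord -[K *+ _]mulr_natl sdel.
by move: KD; lra.
Qed.

End box_counting.

Section counting_minima.
Variables (R : realType) (m n : nat) (A : 'M[R]_(m, n)).
Hypotheses (m_gt0 : (0 < m)%N) (n_gt0 : (0 < n)%N).
Local Notation d := (m + n)%N.
Local Notation box := (box A).
Local Notation rk := (rk A).
Local Notation lat := (lat A).
Local Notation lspan := (lspan A).
Local Notation mu := (mu A).
Local Notation Gam := (Gam A).
Local Notation npt := (npt A).
Local Notation K := (cover_cst R m n).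
Implicit Types (x y c theta : R) (z : 'cV[int]_d).

(** If the rank is i + 1, the box is shrunk by e ^ t with t = [mu i], where the rank has dropped to
    at most i. Growing back inside the span costs (i + 1) (- t) and one [cover_cst], whatever the
    type; together with the shifted terms of the shrunken box this adds up to the sum of the -
    [mu l]. *)
Lemma npt_le_sum i x y : (i <= d)%N -> (rk x y <= i)%N ->
  npt x y <= \sum_(l < i) Num.max (- mu l x y) 0 + i%:R * K.
Proof.
elim: i x y => [|i IH] x y id ri.
  rewrite big_ord0 mul0r addr0 /npt ln_le0// lern1.
  apply: (@leq_trans #|` [fset (0 : 'cV[int]_d)]%fset|); last by rewrite cardfs1.
  apply: fsubset_leq_card.
  apply/fsubsetP => z /bxP bz; rewrite inE; apply/eqP; apply: (@lat_inj _ _ _ A).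
  rewrite lat0; apply/eqP; rewrite -memv0.
  have : (lspan x y <= 0)%VS by rewrite subv0 -dimv_eq0 -leqn0.
  by move/subvP; apply; exact: lat_lspan.
have [ri'|] := leqP (rk x y) i.
  apply: le_trans (IH _ _ (ltnW id) ri') _; rewrite big_ord_recr /=.
  have := cover_cst_ge0 R m n; rewrite -natr1 mulrDl mul1r.
  have : 0 <= Num.max (- mu i x y) 0 by rewrite le_max lexx orbT.
  by lra.
rewrite rk_mu// => mi0; pose t := mu i x y.
have dV : \dim (lspan x y) = i.+1.
  by apply/eqP; rewrite eqn_leq ri /= -/(rk x y) rk_mu.
have [a [_ adV _ Hc]] := npt_cover A x y (lspan x y).
have t1 : x + t <= x by rewrite gerDl ltW.
have t2 : y <= y - t by rewrite lerDl oppr_ge0 ltW.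
have := Hc t x y t1 t2 (fun z => @lat_lspan _ _ _ A x y z).
rewrite dV in adV *.
have rt : (rk (x + t) (y - t) <= i)%N by rewrite -mu_leP.
have := IH _ _ (ltnW id) rt.
rewrite (eq_bigr (fun l : 'I_i => - mu l x y + t)) => [|l _]; last first.
  have ld : (l < d)%N by rewrite (ltn_trans (ltn_ord l)).
  rewrite mu_diag// opprB addrC; apply/max_idPl; rewrite addrC subr_ge0.
  exact: mu_nondecreasing (ltnW (ltn_ord l)) _.
rewrite (eq_bigr (fun l : 'I_i.+1 => - mu l x y)) => [|l _]; last first.
  have ld : (l < d)%N by rewrite (leq_trans (ltn_ord l)).
  apply/max_idPl; rewrite oppr_ge0 (le_trans _ (ltW mi0))//.
  by apply: mu_nondecreasing => //; rewrite -ltnS.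
rewrite big_split /= sumr_const card_ord -[t *+ i]mulr_natl big_ord_recr /= -/t.
by rewrite natrB// -natr1; lra.
Qed.

Lemma npt_le_Gam x y : npt x y <= Gam x y + d%:R * K.
Proof. by rewrite npt_le_sum// rk_le_dim. Qed.

(** Independent vectors nearly attaining the minima are chosen one by one, and multiples of each, as
    many as fit in 1 / (d + 1) of the box, are added. Independence keeps the sums distinct, and k /
    (d + 1) < 1 keeps them inside the box. *)
Lemma combination_fset k x y : (k <= d)%N ->
  exists (s : seq 'cV[int]_d) (S : {fset 'cV[int]_d}),
  [/\ size s = k, free (map lat s),
    forall z, z \in S -> lat z \in <<map lat s>>%VS,
    forall z p, z \in S -> `|lat z p 0| <= k%:R / d.+1%:R * side x y p &
    expR (\sum_(l < k) Num.max (- mu l x y) 0)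
      <= (2 * d.+1%:R) ^+ k * #|` S|%:R].
Proof.
elim: k => [_|k IH kd].
  exists [::], [fset 0]%fset; split; rewrite ?nil_free//.
  - by move=> z; rewrite inE => /eqP ->; rewrite lat0 mem0v.
  - by move=> z p; rewrite inE => /eqP ->; rewrite lat0 mxE normr0 !mul0r.
  - by rewrite big_ord0 expR0 expr0 cardfs1 mulr1.
have [s [S [sk fs Ss Sb Sc]]] := IH (ltnW kd).
have dp : 0 < d.+1%:R :> R by rewrite ltr0n.
(* The rank exceeds k only strictly beyond [mu k]; the factor 2 spent here returns in the
   denominator of [b]. *)
pose t := mu k x y + ln 2.
have rt : (k < rk (x + t) (y - t))%N by rewrite -mu_ltP// ltrDl ln_gt0// ltr1n.
have [|v /bxP bv fv] := @free_extend _ _ _ _ (bx A (x + t) (y - t)) lat fs.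
  by rewrite size_map sk.
have vs : lat v \notin <<map lat s>>%VS by move: fv; rewrite free_cons => /andP[].
have vb p : `|lat v p 0| <= 2 * expR (mu k x y) * side x y p.
  apply/ltW/(lt_le_trans (bv p)).
  have -> : t = ln (2 * expR (mu k x y)).
    by rewrite lnM ?posrE ?expR_gt0// expRK [RHS]addrC.
  by rewrite sideD// mulr_gt0// expR_gt0.
pose b := expR (- mu k x y) / (2 * d.+1%:R).
have b0 : 0 <= b by rewrite divr_ge0 ?expR_ge0// mulr_ge0.
pose N := Num.truncn b.
pose T := [fset u in [seq (z + v *+ i)%R | z <- S, i <- iota 0 N.+1]]%fset.
exists (v :: s), T; split; rewrite /= ?sk//.
- move=> z; rewrite inE => /allpairsP[[z0 c] /= [z0S _ ->]].
  rewrite latD latMn; apply: memvD; last by rewrite memvZ// memv_span// mem_head.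
  have /subvP : (<<map lat s>> <= <<lat v :: map lat s>>)%VS.
    by apply: sub_span => u us; rewrite inE us orbT.
  by move=> H; exact: H _ (Ss _ z0S).
- move=> z p; rewrite inE => /allpairsP[[z0 c] [/= z0S + ->]].
  rewrite -[_ :: _]/(iota 0 N.+1) mem_iota add0n ltnS => /= cN.
  have cb : c%:R <= b by rewrite (le_trans _ (_ : N%:R <= b)) ?ler_nat// truncn_le.
  rewrite latD latMn mxE [X in _ + X]mxE (le_trans (ler_normD _ _))//.
  rewrite -natr1 mulrDl mulrDl lerD ?Sb// normrM normr_nat.
  apply: le_trans (ler_pM _ _ cb (vb p)) _ => //.
  rewrite /b expRN; move: dp; set D : R := d.+1%:R => dp.
  rewrite le_eqVlt; apply/orP; left; apply/eqP.
  by field; rewrite !gt_eqF ?expR_gt0.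
- have -> : #|` T| = (#|` S| * N.+1)%N.
    rewrite card_fseq undup_id ?size_allpairs ?size_iota//.
    apply: allpairs_uniq; rewrite ?iota_uniq ?fset_uniq//.
    move=> u u' /allpairsP[[z i] [zS _ ->]] /allpairsP[[z' i'] [z'S _ ->]].
    move=> /= zz'; have zlat : (i%:R - i'%:R) *: lat v = lat z' - lat z.
      have E : lat z + i%:R *: lat v = lat z' + i'%:R *: lat v.
        by rewrite -!latMn -!latD zz'.
      rewrite scalerBl -[i%:R *: _](addKr (lat z)) E.
      by rewrite -addrA addrK addrC.
    have [ii'|ii'] := eqVneq i i'; first by move: zz'; rewrite ii' => /addIr ->.
    case/negP: vs; have -> : lat v = (i%:R - i'%:R)^-1 *: (lat z' - lat z).
      by rewrite -zlat scalerK// subr_eq0 eqr_nat.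
    by rewrite memvZ// memvB// Ss.
  have eN : expR (Num.max (- mu k x y) 0) <= 2 * d.+1%:R * N.+1%:R.
    have d1 : 1 <= d.+1%:R :> R by rewrite ler1n.
    have N1 : 1 <= N.+1%:R :> R by rewrite ler1n.
    rewrite /Num.max; case: ifP => _; first by rewrite expR0; nra.
    have bN : b <= N.+1%:R by rewrite ltW// truncnS_gt.
    have -> : expR (- mu k x y) = 2 * d.+1%:R * b by rewrite /b mulrC divfK// gt_eqF// mulr_gt0.
    by rewrite ler_pM2l// mulr_gt0.
  rewrite big_ord_recr /= expRD natrM exprSr.
  apply: le_trans (ler_pM _ _ Sc eN) _; rewrite ?expR_ge0//.
  by rewrite le_eqVlt; apply/orP; left; apply/eqP; ring.
Qed.

Lemma Gam_le_npt x y : Gam x y <= npt x y + d%:R * ln (2 * d.+1%:R).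
Proof.
have [s [S [_ _ _ Sb Sc]]] := combination_fset x y (leqnn d).
have dp : 0 < 2 * d.+1%:R :> R by rewrite mulr_gt0.
rewrite -ler_expR expRD expR_npt expRM_natl lnK ?posrE//.
apply: le_trans Sc _; rewrite mulrC ler_pM2r ?exprn_gt0// ler_nat.
apply: fsubset_leq_card; apply/fsubsetP => z zS; apply/bxP => p.
apply: le_lt_trans (Sb _ p zS) _; rewrite gtr_pMl ?side_gt0//.
by rewrite ltr_pdivrMr// mul1r ltr_nat.
Qed.

(** Sums of points of the two boxes fit, up to a factor 2, in the box with the larger sides, which
    is that of (x', y). Differences common to both fit in the box with the smaller sides, that of
    (x, y'). Then [leq_card_sums] applies. *)
Lemma npt_supermodular x y x' y' : x <= x' -> y <= y' ->
  npt x' y' + npt x y <= npt (x' + ln 2) (y - ln 2) + npt (x + ln 2) (y' - ln 2).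
Proof.
move=> xx yy; rewrite -ler_expR !expRD !expR_npt -!natrM ler_nat.
apply: leq_card_sums => [a b /bxP aA /bxP bB|a a' b b' /bxP aA /bxP a'A /bxP bB /bxP b'B ab].
  apply/bxP => p; rewrite sideD// latD mxE (le_lt_trans (ler_normD _ _))//.
  have h3 : side x' y' p <= side x' y p by rewrite le_side.
  have h4 : side x y p <= side x' y p by rewrite le_side.
  by have := aA p; have := bB p; lra.
apply/bxP => p; rewrite sideD//.
have ab' : a - a' = b' - b.
  by apply/eqP; rewrite subr_eq addrAC eq_sym subr_eq ab addrC.
have h1 : `|lat (a - a') p 0| < 2 * side x' y' p.
  rewrite latB mxE [X in `|_ + X|]mxE (le_lt_trans (ler_normB _ _))//.
  by have := aA p; have := a'A p; lra.
have h2 : `|lat (a - a') p 0| < 2 * side x y p.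
  rewrite ab' latB mxE [X in `|_ + X|]mxE (le_lt_trans (ler_normB _ _))//.
  by have := bB p; have := b'B p; lra.
by move: h1 h2; rewrite /side; case: ifP.
Qed.

End counting_minima.

(** * Growth of sums of logarithmic minima *)

Section minima_growth.
Variables (R : realType) (m n : nat) (A : 'M[R]_(m, n)).
Hypotheses (m_gt0 : (0 < m)%N) (n_gt0 : (0 < n)%N).
Local Notation d := (m + n)%N.
Local Notation box := (box A).
Local Notation rk := (rk A).
Local Notation lat := (lat A).
Local Notation lspan := (lspan A).
Local Notation mu := (mu A).
Local Notation Gam := (Gam A).
Local Notation npt := (npt A).
Implicit Types (x y c theta : R) (z : 'cV[int]_d).

Lemma le_Gam x y x' y' : x <= x' -> y' <= y -> Gam x y <= Gam x' y'.
Proof.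
move=> xx yy; apply: ler_sum => i _; rewrite ge_max !le_max lexx orbT andbT.
by rewrite lerN2 le_mu.
Qed.

Lemma mu_lip i x y x' y' : (i < d)%N -> x <= x' -> y' <= y ->
  mu i x y - (x' - x) - (y - y') <= mu i x' y'.
Proof.
move=> id xx yy; pose t := (x' - x) + (y - y').
have -> : mu i x y - (x' - x) - (y - y') = mu i x y - t by rewrite /t; lra.
by rewrite -mu_diag//; apply: le_mu => //; rewrite /t; lra.
Qed.

Lemma Gam_lip x y x' y' : x <= x' -> y' <= y ->
  Gam x' y' <= Gam x y + d%:R * ((x' - x) + (y - y')).
Proof.
move=> xx yy; rewrite /Gam mulr_natl -[d in _ *+ d]card_ord -sumr_const -big_split /=.
apply: ler_sum => i _; have := mu_lip (ltn_ord i) xx yy.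
rewrite ge_max => h; apply/andP; split.
  have : - mu i x y <= Num.max (- mu i x y) 0 by rewrite le_max lexx.
  by lra.
have : 0 <= Num.max (- mu i x y) 0 by rewrite le_max lexx orbT.
by lra.
Qed.

Lemma Gam_shift x y c : 0 <= c -> Gam (x + c) (y - c) <= Gam x y + 2 * (d%:R * c).
Proof.
move=> c0; have := @Gam_lip x y (x + c) (y - c).
rewrite lerDl gerBl c0 => /(_ isT isT) /le_trans; apply; rewrite lerD2l.
by rewrite [x + c]addrC addrK subKr; rewrite le_eqVlt; apply/orP; left; apply/eqP; ring.
Qed.

Definition count_cst : R :=
  d%:R * (cover_cst R m n + ln (2 * d.+1%:R)).

Lemma ln2d_ge0 : 0 <= ln (2 * d.+1%:R) :> R.
Proof. by rewrite ln_ge0// -natrM ler1n. Qed.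

Lemma count_cst_ge0 : 0 <= count_cst.
Proof. by rewrite mulr_ge0// addr_ge0// ?cover_cst_ge0 ?ln2d_ge0. Qed.

Lemma Gam_npt x y : Gam x y <= npt x y + count_cst /\ npt x y <= Gam x y + count_cst.
Proof.
have := npt_le_Gam A m_gt0 n_gt0 x y; have := Gam_le_npt A m_gt0 n_gt0 x y.
have : 0 <= d%:R * cover_cst R m n by rewrite mulr_ge0 ?cover_cst_ge0.
have : 0 <= d%:R * ln (2 * d.+1%:R) :> R by rewrite mulr_ge0 ?ln2d_ge0.
by rewrite /count_cst mulrDr; split; lra.
Qed.

(** The constant pays for four passages between [Gam] and [npt] and for two dilations by 2. *)
Lemma Gam_supermodular : exists2 C, 0 <= C & forall x y x' y',
  x <= x' -> y <= y' -> Gam x' y' + Gam x y <= Gam x' y + Gam x y' + C.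
Proof.
have l2 : 0 <= ln 2 :> R by rewrite ln_ge0// ler1n.
have cc := count_cst_ge0.
have dl : 0 <= d%:R * ln 2 :> R by rewrite mulr_ge0.
exists (4 * count_cst + 4 * (d%:R * ln 2)); first by lra.
move=> x y x' y' xx yy; have := npt_supermodular A xx yy.
have := Gam_npt x y; have := Gam_npt x' y'.
have := Gam_npt (x' + ln 2) (y - ln 2); have := Gam_npt (x + ln 2) (y' - ln 2).
have := Gam_shift x y' l2; have := Gam_shift x' y l2.
move: (npt _ _) (npt _ _) (npt _ _) (npt _ _) => n1 n2 n3 n4.
move: (Gam _ _) (Gam _ _) (Gam _ _) (Gam _ _) => g1 g2 g3 g4.
move: (Gam _ _) (Gam _ _) (d%:R * ln 2) count_cst => g5 g6 c C.
by move=> ? ? [? ?] [? ?] [? ?] [? ?] ?; lra.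
Qed.

Definition mu_sum j x y : R := \sum_(l < j) mu l x y.

(** When [theta] lies in the gap after the first j minima, exactly these contribute to [Gam], so
    point counts give access to their sum. *)
Lemma Gam_gap j x y theta : rk (x + theta) (y - theta) = j ->
  Gam (x + theta) (y - theta) = j%:R * theta - mu_sum j x y.
Proof.
move=> rj; have jd : (j <= d)%N by rewrite -rj rk_le_dim.
rewrite /Gam /mu_sum.
rewrite (eq_bigr (fun l : 'I_d => if (l < j)%N then theta - mu l x y else 0)).
  rewrite -big_mkcond /= -(big_ord_widen _ (fun l => theta - mu l x y) jd).
  by rewrite sumrB sumr_const card_ord mulr_natl.
move=> l _; rewrite mu_diag// opprB; case: ifP => lj.
  by apply/max_idPl; rewrite subr_ge0 ltW// mu_ltP// rj.
by apply/max_idPr; rewrite subr_le0 mu_leP// rj leqNgt lj.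
Qed.

(** The span of the short vectors when the rank is j, evaluated at [mu j], the largest dilation of
    rank at most j. It thus does not depend on the [theta] at which rank j is observed, and neither
    does the type attached to it. For j = d there is no such minimum and the span is everything. *)
Let flag j x y : {vspace 'cV[R]_d} :=
  if (j < d)%N then lspan (x + mu j x y) (y - mu j x y) else fullv.

Let flagE j x y theta : rk (x + theta) (y - theta) = j ->
  lspan (x + theta) (y - theta) = flag j x y.
Proof.
move=> rj; have jd : (j <= d)%N by rewrite -rj rk_le_dim.
apply/eqP; rewrite eqEdim /flag; case: ltnP => dj.
  have tm : theta <= mu j x y by rewrite mu_leP// rj.
  have -> : (lspan (x + theta) (y - theta) <= lspan (x + mu j x y) (y - mu j x y))%VS.
    by apply: le_lspan; [rewrite lerD2l|rewrite lerD2l lerN2].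
  by rewrite /= -!/(rk _ _) rj -mu_leP.
by rewrite subvf /= -/(rk _ _) rj dimvf /dim /= muln1.
Qed.

(* Within a range where the span of the short vectors is a fixed subspace of
   dimension [j], the sum of the first [j] logarithmic minima moves linearly,
   at one of finitely many rates, as long as the type [a j] does not change. *)
Lemma mu_sum_growth : exists2 a : nat -> R -> R -> nat,
  forall j x y theta, rk (x + theta) (y - theta) = j ->
    [/\ (a j x y <= m)%N, (a j x y <= j)%N & (j <= a j x y + n)%N] &
  exists2 C, 0 <= C & forall j x y x' y' theta, x <= x' -> y <= y' ->
  rk (x + theta) (y - theta) = j ->
  (rk (x' + (theta + (y' - y))) (y' - (theta + (y' - y))) = j ->
    mu_sum j x y + (a j x y)%:R * (y' - y) - (j - a j x y)%:R * (x' - x) - C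
      <= mu_sum j x' y') /\
  (rk (x' + (theta - (x' - x))) (y' - (theta - (x' - x))) = j ->
    mu_sum j x' y' <= mu_sum j x y + (a j x' y')%:R * (y' - y)
      - (j - a j x' y')%:R * (x' - x) + C).
Proof.
have [a aP] : exists a : nat -> R -> R -> nat, forall j x y,
    let V := flag j x y in
    [/\ (a j x y <= m)%N, (a j x y <= \dim V)%N, (\dim V <= a j x y + n)%N &
    forall theta x' y', x + theta <= x' -> y' <= y - theta ->
    (forall z, box x' y' z -> lat z \in V) ->
    npt x' y' <= npt (x + theta) (y - theta) + (a j x y)%:R * (y - theta - y')
      + (\dim V - a j x y)%:R * (x' - (x + theta)) + cover_cst R m n].
  exists (fun j x y => projT1 (cid (npt_cover A x y (flag j x y)))) => j x y.
  exact: projT2 (cid (npt_cover A x y (flag j x y))).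
exists a => [j x y theta rj|].
  have dj : \dim (flag j x y) = j by rewrite -(flagE rj).
  by have [h1 h2 h3 _] := aP j x y; rewrite dj in h2 h3.
exists (2 * count_cst + cover_cst R m n).
  by have := count_cst_ge0; have := cover_cst_ge0 R m n; lra.
move=> j x y x' y' t xx yy rj; split=> rj'.
  (* The dilation is increased by y' - y so that the first m sides of both boxes agree; only the j -
     a dominant coordinates among the last n are charged. *)
  have [_ aj _] := aP j x y; 
  move=> /(_ t (x' + (t + (y' - y))) (y' - (t + (y' - y)))).
  have dj : \dim (flag j x y) = j by rewrite -(flagE rj).
  rewrite dj in aj *.
  have xt : x + t <= x' + (t + (y' - y)) by lra.
  have yt : y' - (t + (y' - y)) <= y - t by lra.
  have sp : lspan (x + t) (y - t) = lspan (x' + (t + (y' - y))) (y' - (t + (y' - y))).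
    by apply/eqP; rewrite eqEdim le_lspan//= -!/(rk _ _) rj rj'.
  have sb z : box (x' + (t + (y' - y))) (y' - (t + (y' - y))) z ->
      lat z \in flag j x y.
    by move=> /lat_lspan; rewrite -sp (flagE rj).
  move=> /(_ xt yt sb).
  rewrite (natrB _ aj); have := Gam_gap rj; have := Gam_gap rj'.
  have := Gam_npt (x + t) (y - t).
  have := Gam_npt (x' + (t + (y' - y))) (y' - (t + (y' - y))).
    move: count_cst (cover_cst _ _ _) (npt _ _) (npt _ _) (Gam _ _) (Gam _ _).
  move: (mu_sum _ _ _) (mu_sum _ _ _) (a _ _ _)%:R j%:R.
  move=> W' W e f C1 C2 n1 n2 g1 g2 [? ?] [? ?] ? ? ?.
  lra.
(* Here the dilation is decreased by x' - x so that the last n sides agree, and only the a dominant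
   coordinates among the first m are charged. *)
have [_ aj _] := aP j x' y'; 
move=> /(_ (t - (x' - x)) (x + t) (y - t)).
have dj : \dim (flag j x' y') = j by rewrite -(flagE rj').
rewrite dj in aj *.
have xt : x' + (t - (x' - x)) <= x + t by lra.
have yt : y - t <= y' - (t - (x' - x)) by lra.
have sp : lspan (x' + (t - (x' - x))) (y' - (t - (x' - x))) = lspan (x + t) (y - t).
  by apply/eqP; rewrite eqEdim le_lspan//= -!/(rk _ _) rj rj'.
have sb z : box (x + t) (y - t) z -> lat z \in flag j x' y'.
  by move=> /lat_lspan; rewrite -sp (flagE rj').
move=> /(_ xt yt sb).
rewrite (natrB _ aj); have := Gam_gap rj; have := Gam_gap rj'.
have := Gam_npt (x + t) (y - t).
have := Gam_npt (x' + (t - (x' - x))) (y' - (t - (x' - x))).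
move: count_cst (cover_cst _ _ _) (npt _ _) (npt _ _) (Gam _ _) (Gam _ _).
move: (mu_sum _ _ _) (mu_sum _ _ _) (a _ _ _)%:R j%:R.
move=> W' W e f C1 C2 n1 n2 g1 g2 [? ?] [? ?] ? ? ?.
lra.
Qed.

End minima_growth.

(** * Counting functions along a ray *)

Section corner_estimates.
Variables (R : realType) (G : R -> R -> R) (C D r : R).
Hypothesis C_ge0 : 0 <= C.
Hypothesis D_ge0 : 0 <= D.
Hypothesis leG : forall x y x' y', x <= x' -> y' <= y -> G x y <= G x' y'.
Hypothesis lipG : forall x y x' y', x <= x' -> y' <= y ->
  G x' y' <= G x y + D * ((x' - x) + (y - y')).
Hypothesis smG : forall x y x' y', x <= x' -> y <= y' ->
  G x' y' + G x y <= G x' y + G x y' + C.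

Variables (x0 x1 y0 y1 t : R) (N : nat).
Hypotheses (x01 : x0 < x1) (t_gt0 : 0 < t) (N_gt0 : (0 < N)%N).
Hypothesis y01 : y1 - y0 = t * (x1 - x0).
Let L := x1 - x0.
Let h := L / N%:R.
(** The margins leave room for the neighbours at x - h and y - h, and for one more row below [y0]
    when the number of rows is rounded up. *)
Let reg x y := [/\ x0 - L <= x, x <= x1, y0 - 2 * L <= y & y <= y1].
Hypothesis diagG : forall x y c, 0 <= c -> reg x y -> reg (x + c) (y - c) ->
  G (x + c) (y - c) = G x y + r * c.

Let L_gt0 : 0 < L. Proof. by rewrite subr_gt0. Qed.
Let NR_gt0 : 0 < N%:R :> R. Proof. by rewrite ltr0n. Qed.
Let h_gt0 : 0 < h. Proof. by rewrite divr_gt0. Qed.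
Let hN : h * N%:R = L. Proof. by rewrite divfK// gt_eqF. Qed.
Let hL : h <= L. Proof. by rewrite ler_pdivrMr// ler_peMr ?ler1n// ltW. Qed.

Let LE : L = x1 - x0. Proof. by []. Qed.
Let yy01 : y0 <= y1.
Proof. by rewrite -subr_ge0 y01 mulr_ge0// ltW. Qed.

(* By supermodularity these vertical increments are, up to [C], nondecreasing in
   [x]; where [G] is linear along antidiagonals they also are so in [y]. *)
Let v x y := G x (y - h) - G x y.

Let v_ge0 x y : 0 <= v x y.
Proof. by rewrite subr_ge0 leG// gerBl ltW. Qed.

Let v_le x y : v x y <= D * h.
Proof.
rewrite lerBlDl; have := @lipG x y x (y - h) (lexx _).
by rewrite gerBl ltW// => /(_ isT); rewrite subrr add0r subKr.
Qed.

Let v_incr_x x x' y : x <= x' -> v x y <= v x' y + C.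
Proof.
move=> xx; have := @smG x (y - h) x' y xx; rewrite gerBl ltW// => /(_ isT).
by rewrite /v; lra.
Qed.

Let uv x y : reg x y -> reg (x + h) (y - h) ->
  G (x + h) y - G x y = r * h - v (x + h) y.
Proof. by move=> h1 h2; rewrite /v (diagG (ltW h_gt0) h1 h2); lra. Qed.

Let v_incr_y x y y' : y <= y' -> reg (x - h) y -> reg (x - h) y' ->
  reg x (y - h) -> reg x (y' - h) -> v x y <= v x y' + C.
Proof.
move=> yy r1 r2 r3 r4; have := @uv (x - h) y; have := @uv (x - h) y'.
rewrite !subrK => /(_ r2 r4) e2 /(_ r1 r3) e1.
have := @smG (x - h) y x y' _ yy; rewrite gerBl ltW// => /(_ isT).
by lra.
Qed.

(** The first term is the rounding of t N to an integer number of rows, a small fraction of L when N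
    is large. The second accumulates the supermodularity defect and does not depend on L. *)
Definition corner_error := D * (h / t) + (2 * N%:R + t^-1) * C.

Let sum_v x y k : \sum_(0 <= i < k) v x (y - i%:R * h) = G x (y - k%:R * h) - G x y.
Proof.
have := @telescope_sumr _ 0 k (fun i => G x (y - i%:R * h)) (leq0n _).
rewrite mul0r subr0 => <-; apply: eq_bigr => i _; rewrite /v; congr (G _ _ - _).
by rewrite -natr1; lra.
Qed.

(** With w the increment [v x1 y0] at the corner, the roughly t N increments up the right edge are
    at least w - C, and the N horizontal ones on the bottom edge at least r h - w - C. Dividing the
    former by t cancels w. *)
Lemma right_corner :
  r * L - corner_error <= (G x1 y0 - G x1 y1) / t + (G x1 y0 - G x0 y0).
Proof.
pose w := v x1 y0; pose N' := Num.truncn (t * N%:R).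
have tN0 : 0 <= t * N%:R by rewrite mulr_ge0// ltW.
have [N'l N'u] : N'%:R <= t * N%:R /\ t * N%:R < N'%:R + 1.
  by have /andP[? ?] := truncn_itv tN0; rewrite natr1.
have N'h : N'%:R * h <= y1 - y0.
  by rewrite y01 -/L -hN; have := ler_wpM2r (ltW h_gt0) N'l; lra.
have xN : x0 + N%:R * h = x1 by rewrite mulrC hN /L; lra.
have B : N%:R * (r * h - w - C) <= G x1 y0 - G x0 y0.
  have <- : \sum_(0 <= i < N) (G (x0 + i.+1%:R * h) y0 - G (x0 + i%:R * h) y0)
      = G x1 y0 - G x0 y0.
    rewrite (@telescope_sumr _ 0 N (fun i => G (x0 + i%:R * h) y0))//.
    by rewrite mul0r addr0 xN.
  rewrite big_mkord mulr_natl -[N in _ *+ N]card_ord -sumr_const.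
  apply: ler_sum => i _.
  have := LE; have := h_gt0; have := hL; have := yy01.
  have : i.+1%:R * h <= L by rewrite -hN mulrC ler_pM2l// ler_nat.
  have : 0 <= i%:R * h by rewrite mulr_ge0// ltW.
  rewrite -natr1 => i0 iN y_le h_le h0 lE.
  have -> : x0 + (i%:R + 1) * h = x0 + i%:R * h + h by lra.
  rewrite uv; [|by split; lra|by split; lra].
  by rewrite -addrA lerD2l -opprD lerN2 v_incr_x//; lra.
have A : N'%:R * (w - C) <= G x1 y0 - G x1 y1.
  have yN : G x1 y1 <= G x1 (y0 + N'%:R * h) by rewrite leG//; lra.
  apply: (@le_trans _ _ (G x1 y0 - G x1 (y0 + N'%:R * h))); last by lra.
  have := sum_v x1 (y0 + N'%:R * h) N'; rewrite addrK => <-.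
  rewrite big_mkord mulr_natl -[N' in _ *+ N']card_ord -sumr_const.
  apply: ler_sum => i _; rewrite lerBlDr.
  have := LE; have := h_gt0; have := hL; have := yy01; have := N'h.
  have : i.+1%:R * h <= N'%:R * h by rewrite ler_pM2r// ler_nat.
  have : 0 <= i%:R * h by rewrite mulr_ge0// ltW.
  rewrite -natr1 => i0 iN Nh y_le h_le h0 lE.
  by apply: v_incr_y; [lra|split; lra..].
have w0 : 0 <= w by exact: v_ge0.
have wD : w <= D * h by exact: v_le.
have At : N'%:R / t * (w - C) <= (G x1 y0 - G x1 y1) / t.
  by rewrite mulrAC ler_pM2r ?invr_gt0.
have Nt1 : N'%:R / t <= N%:R by rewrite ler_pdivrMr// mulrC.
have Nt2 : N%:R - t^-1 <= N'%:R / t.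
  rewrite ler_pdivlMr// mulrBl mulVf ?gt_eqF//; lra.
have NC1 : N'%:R / t * C <= N%:R * C by rewrite ler_wpM2r.
have NC2 : (N%:R - t^-1) * w <= N'%:R / t * w by rewrite ler_wpM2r.
have NC3 : t^-1 * w <= D * (h / t).
  by rewrite mulrA mulrC ler_pM2r ?invr_gt0.
have tC : 0 <= t^-1 * C by rewrite mulr_ge0// invr_ge0 ltW.
have rL : r * L = N%:R * (r * h) by rewrite -hN; lra.
by rewrite /corner_error; lra.
Qed.

(** The mirror image at the corner (x0, y1): all inequalities are reversed and the number of rows is
    rounded up. *)
Lemma left_corner :
  (G x0 y0 - G x0 y1) / t + (G x1 y1 - G x0 y1) <= r * L + corner_error.
Proof.
pose w := v x0 y1; pose N' := (Num.truncn (t * N%:R)).+1.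
have tN0 : 0 <= t * N%:R by rewrite mulr_ge0// ltW.
have [N'l N'u] : N'%:R <= t * N%:R + 1 /\ t * N%:R <= N'%:R.
  have /andP[h1 h2] := truncn_itv tN0; split; last exact: ltW.
  by rewrite -natr1 lerD2r.
have N'h : y1 - y0 <= N'%:R * h /\ N'%:R * h <= y1 - y0 + h.
  rewrite y01 -/L -hN; have := ler_wpM2r (ltW h_gt0) N'l.
  by have := ler_wpM2r (ltW h_gt0) N'u; split; lra.
have xN : x0 + N%:R * h = x1 by rewrite mulrC hN /L; lra.
have B : G x1 y1 - G x0 y1 <= N%:R * (r * h - w + C).
  have <- : \sum_(0 <= i < N) (G (x0 + i.+1%:R * h) y1 - G (x0 + i%:R * h) y1)
      = G x1 y1 - G x0 y1.
    rewrite (@telescope_sumr _ 0 N (fun i => G (x0 + i%:R * h) y1))//.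
    by rewrite mul0r addr0 xN.
  rewrite big_mkord mulr_natl -[N in _ *+ N]card_ord -sumr_const.
  apply: ler_sum => i _.
  have := LE; have := h_gt0; have := hL; have := yy01.
  have : i.+1%:R * h <= L by rewrite -hN mulrC ler_pM2l// ler_nat.
  have : 0 <= i%:R * h by rewrite mulr_ge0// ltW.
  rewrite -natr1 => i0 iN y_le h_le h0 lE.
  have -> : x0 + (i%:R + 1) * h = x0 + i%:R * h + h by lra.
  rewrite uv; [|by split; lra|by split; lra].
  have : w <= v (x0 + i%:R * h + h) y1 + C by apply: v_incr_x; lra.
  by lra.
have A : G x0 y0 - G x0 y1 <= N'%:R * (w + C).
  have yN : G x0 y0 <= G x0 (y1 - N'%:R * h) by rewrite leG//; lra.
  apply: (@le_trans _ _ (G x0 (y1 - N'%:R * h) - G x0 y1)); first by lra.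
  rewrite -sum_v big_mkord mulr_natl -[N' in _ *+ N']card_ord -sumr_const.
  apply: ler_sum => i _.
  have := LE; have := h_gt0; have := hL; have := yy01; case: N'h.
  have : i.+1%:R * h <= N'%:R * h by rewrite ler_pM2r// ler_nat.
  have : 0 <= i%:R * h by rewrite mulr_ge0// ltW.
  rewrite -natr1 => i0 iN Nh1 Nh2 y_le h_le h0 lE.
  by apply: v_incr_y; [lra|split; lra..].
have w0 : 0 <= w by exact: v_ge0.
have wD : w <= D * h by exact: v_le.
have At : (G x0 y0 - G x0 y1) / t <= N'%:R / t * (w + C).
  by rewrite [leRHS]mulrAC ler_pM2r ?invr_gt0.
have Nt1 : N'%:R / t <= N%:R + t^-1.
  by rewrite ler_pdivrMr// mulrDl mulVf ?gt_eqF//; lra.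
have NC1 : N'%:R / t * (w + C) <= (N%:R + t^-1) * (w + C).
  by rewrite ler_wpM2r// addr_ge0.
have NC3 : t^-1 * w <= D * (h / t).
  by rewrite mulrA mulrC ler_pM2r ?invr_gt0.
have rL : r * L = N%:R * (r * h) by rewrite -hN; lra.
by rewrite /corner_error; lra.
Qed.

End corner_estimates.

(** * Total length of a set of geometric scales *)

Section clusters.
Variables (R : realType) (e : R).
Hypothesis e_gt0 : 0 < e.

Definition geom (k : nat) : R := (1 + e) ^+ k.

Lemma geomS k : geom k.+1 = (1 + e) * geom k.
Proof. by rewrite /geom exprS. Qed.

Lemma geom_gt0 k : 0 < geom k.
Proof. by rewrite exprn_gt0// addr_gt0. Qed.

Lemma geom_ge1 k : 1 <= geom k.
Proof. by rewrite exprn_ege1// lerDl ltW. Qed.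

Lemma le_geom i j : (i <= j)%N -> geom i <= geom j.
Proof. by move=> ij; rewrite ler_eXn2l// ltrDl. Qed.

Lemma lt_geom i j : (i < j)%N -> geom i < geom j.
Proof. by move=> ij; rewrite ltr_eXn2l// ltrDl. Qed.

Definition mass (P : pred nat) K : R :=
  \sum_(k < K | P k) (geom k.+1 - geom k).

Lemma massS P K :
  mass P K.+1 = mass P K + (if P K then geom K.+1 - geom K else 0).
Proof.
by rewrite /mass big_mkcond big_ord_recr /= -big_mkcond.
Qed.

Lemma mass_le P i j : (i <= j)%N -> mass P j <= mass P i + (geom j - geom i).
Proof.
move=> ij; rewrite -(subnKC ij); elim: (j - i)%N => [|k IH].
  by rewrite addn0 subrr addr0.
rewrite addnS massS; have : geom (i + k) <= geom (i + k).+1 by rewrite le_geom.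
by case: ifP => _; lra.
Qed.

Lemma mass0 P : mass P 0 = 0.
Proof. by rewrite /mass big_ord0. Qed.

Lemma mass_le_geom P k : mass P k <= geom k.
Proof.
by have := @mass_le P 0 k (leq0n _); have := geom_gt0 0; rewrite mass0; lra.
Qed.

(** The scales of [P] form clusters, each of relative length at most beta + e and separated from the
    next by a factor 1 + alpha. Their lengths decrease at least geometrically downwards, whence a
    bound of order (beta + e) / alpha; the factor 8 is generous. *)
Lemma cluster_mass (P : pred nat) (alpha beta : R) k0 :
  alpha <= 1 -> 2 * e <= alpha -> 0 <= beta ->
  (forall k k', (k0 <= k)%N -> (k < k')%N -> P k -> P k' ->
    geom k' <= (1 + alpha) * geom k -> geom k' - geom k <= beta * geom k') ->
  forall K, mass P K <= 8 * (beta + e) / alpha * geom K + geom k0.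
Proof.
move=> a1 ea b0 HP; have e0 := e_gt0; have a0 : 0 < alpha by lra.
set c := 8 * _ / _; have c0 : 0 <= c by rewrite divr_ge0 ?mulr_ge0//; lra.
have cE : c * alpha = 8 * (beta + e) by rewrite divfK// gt_eqF.
elim/ltn_ind => K IH.
have small k : (k <= k0)%N -> mass P k <= geom k0.
  by move=> kk0; exact: le_trans (mass_le_geom P k) (le_geom kk0).
have [Kk0|k0K] := leqP K k0.
  by have := small _ Kk0; have := mulr_ge0 c0 (ltW (geom_gt0 K)); lra.
case: K k0K IH => // K; rewrite ltnS => k0K IH.
have gK : geom K <= geom K.+1 by rewrite le_geom.
rewrite massS; case: ifP => PK; last first.
  have := IH K (ltnSn _); have := ler_wpM2l c0 gK; lra.
have exk : exists k, [&& (k0 <= k)%N, P k & geom K <= (1 + alpha) * geom k].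
  by exists K; rewrite k0K PK; have := geom_gt0 K; nra.
(* [k1] begins the last cluster: scales of [P] between [k0] and [k1] are smaller than the last one
   by a factor 1 + alpha, and the induction hypothesis gains this factor. *)
case: (ex_minnP exk) => k1 /and3P[k01 Pk1 k1K] k1min.
have k1leK : (k1 <= K)%N by apply: k1min; rewrite k0K PK; have := geom_gt0 K; nra.
have near : geom K - geom k1 <= beta * geom K.
  move: k1leK; rewrite leq_eqVlt => /predU1P[->|k1K']; last exact: HP.
  by rewrite subrr mulr_ge0// ltW// geom_gt0.
have low j : (j <= k1)%N ->
    (1 + alpha) * (mass P j - geom k0) <= c * ((1 + e) * geom K).
  elim: j => [_|j IHj jk1].
    rewrite mass0 sub0r.
    have := mulr_ge0 c0 (ltW (geom_gt0 K)); have := geom_gt0 k0.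
    have := mulr_ge0 (mulr_ge0 c0 (ltW (geom_gt0 K))) (ltW e_gt0).
    by nra.
  have [jk0|k0j] := leqP j.+1 k0.
    have := small _ jk0; have := mulr_ge0 c0 (ltW (geom_gt0 K)).
    have := mulr_ge0 (mulr_ge0 c0 (ltW (geom_gt0 K))) (ltW e_gt0).
    by nra.
  have [Pj|nPj] := boolP (P j); last first.
    by rewrite massS (negbTE nPj) addr0 IHj// ltnW.
  have jK : (1 + alpha) * geom j < geom K.
    rewrite ltNge; apply/negP => h.
    by have := k1min j; rewrite -ltnS k0j Pj h => /(_ isT); rewrite leqNgt jk1.
  have := IH j.+1; rewrite ltnS (leq_trans jk1 k1leK) => /(_ isT).
  rewrite geomS => h.
  have h2 : c * (1 + e) * ((1 + alpha) * geom j) <= c * (1 + e) * geom K.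
    by apply: ler_wpM2l (ltW jK); apply: mulr_ge0 => //; lra.
  have h3 : (1 + alpha) * (mass P j.+1 - geom k0) <= (1 + alpha) * (c * ((1 + e) * geom j)).
    by rewrite ler_wpM2l//; lra.
  by lra.
have := low k1 (leqnn _); have := mass_le P k1leK; rewrite geomS => h1 h2.
have gK0 := geom_gt0 K.
have : (1 + alpha) * (mass P K + e * geom K - geom k0) <=
    (1 + alpha) * (c * ((1 + e) * geom K)).
  have h3 : (1 + alpha) * (mass P K - mass P k1) <= (1 + alpha) * (beta * geom K).
    by rewrite ler_wpM2l//; lra.
  have h4 : c * alpha * geom K = 8 * (beta + e) * geom K by rewrite cE.
  have h5 : 0 <= c * geom K * alpha * e.
    have ga := mulr_ge0 (mulr_ge0 c0 (ltW gK0)) (ltW a0).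
    exact: mulr_ge0 ga (ltW e0).
  have h6 : alpha * ((beta + e) * geom K) <= (beta + e) * geom K.
    by rewrite ler_piMl// mulr_ge0 ?ltW//; lra.
  have h7 : 0 <= (beta + e) * geom K by rewrite mulr_ge0 ?ltW//; lra.
  by lra.
by rewrite ler_pM2l; lra.
Qed.

Lemma bernoulli k : 1 + k%:R * e <= geom k.
Proof.
elim: k => [|k IH]; first by rewrite mul0r addr0 /geom expr0.
have e0 := e_gt0; rewrite geomS -natr1.
have : 0 <= k%:R * e * e by rewrite !mulr_ge0// ltW.
by have := ler_wpM2l (ltW e0) IH; nra.
Qed.

Lemma geom_unbounded (B : R) : exists k, B <= geom k.
Proof.
exists (Num.truncn (`|B| / e)).+1; apply: le_trans (bernoulli _).
have : `|B| / e < (Num.truncn (`|B| / e)).+1%:R by rewrite truncnS_gt.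
by rewrite ltr_pdivrMr// => h; have := ler_norm B; lra.
Qed.

End clusters.

(** Absorbs bounded losses per step. Since (1 + e / 3) ^ 2 <= 1 + e, Bernoulli's inequality squared
    gives quadratic growth; completing the square yields the constant. *)
Lemma linear_le_geom (R : realType) (e B eta : R) : 0 < e -> e <= 1 -> 0 < eta ->
  exists C, forall K, K%:R * B <= eta * geom e K + C.
Proof.
move=> e0 e1 eta0; pose e' := e / 3; have e'0 : 0 < e' by rewrite /e'; lra.
pose c := eta * e' ^+ 2; have c0 : 0 < c by rewrite mulr_gt0// exprn_gt0.
exists (B ^+ 2 / (4 * c)) => K.
have sq : (1 + K%:R * e') ^+ 2 <= geom e K.
  apply: (@le_trans _ _ (geom e' K ^+ 2)).
    rewrite ler_pXn2r ?bernoulli// nnegrE ?(ltW (geom_gt0 e'0 _))//.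
    by rewrite addr_ge0// mulr_ge0// ltW.
  have sq1 : 0 <= (1 + e') ^+ 2 by rewrite exprn_ge0//; lra.
  have sq2 : (1 + e') ^+ 2 <= 1 + e.
    have : e * e <= e by rewrite ler_piMr// ltW.
    by rewrite /e' expr2; lra.
  by rewrite /geom -exprM mulnC exprM; apply: lerXn2r; rewrite ?nnegrE//; lra.
have Ke : 0 <= K%:R * e' by rewrite mulr_ge0// ltW.
have h1 : c * K%:R ^+ 2 <= eta * geom e K.
  rewrite /c -mulrA ler_pM2l//; apply: le_trans sq; nra.
have h2 : 0 <= c * (K%:R - B / (2 * c)) ^+ 2.
  by rewrite mulr_ge0 ?sqr_ge0// ltW.
have h3 : c * (K%:R - B / (2 * c)) ^+ 2 = c * K%:R ^+ 2 - K%:R * B + B ^+ 2 / (4 * c).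
  by field; rewrite gt_eqF.
by rewrite h3 in h2; lra.
Qed.

(** * Rarity of scales with a small minimum *)

Section few_small_minima.
Variables (R : realType) (m n : nat).
Local Notation d := (m + n)%N.
Variables (mu : nat -> R -> R -> R) (rk : R -> R -> nat).
Hypothesis rk_le : forall x y, (rk x y <= d)%N.
Hypothesis mu_rk : forall i x y theta, (i < d)%N ->
  (mu i x y < theta) = (i < rk (x + theta) (y - theta))%N.
Variables (a : nat -> R -> R -> nat) (C : R).
Hypothesis C_ge0 : 0 <= C.
Let mu_sum j x y := \sum_(l < j) mu l x y.
Hypothesis a_bound : forall j x y theta, rk (x + theta) (y - theta) = j ->
    [/\ (a j x y <= m)%N, (a j x y <= j)%N & (j <= a j x y + n)%N].
Hypothesis growth : forall j x y x' y' theta, x <= x' -> y <= y' ->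
  rk (x + theta) (y - theta) = j ->
  (rk (x' + (theta + (y' - y))) (y' - (theta + (y' - y))) = j ->
    mu_sum j x y + (a j x y)%:R * (y' - y) - (j - a j x y)%:R * (x' - x) - C
      <= mu_sum j x' y') /\
  (rk (x' + (theta - (x' - x))) (y' - (theta - (x' - x))) = j ->
    mu_sum j x' y' <= mu_sum j x y + (a j x' y')%:R * (y' - y)
      - (j - a j x' y')%:R * (x' - x) + C).
Variable tau : R.
Hypothesis tau_gt0 : 0 < tau.
Hypothesis tau_nE : ~ exceptional_levels m n tau.

Lemma rk_eqP j x y theta : (j <= d)%N ->
  (forall q, (q < d)%N -> (mu q x y < theta) = (q < j)%N) ->
  rk (x + theta) (y - theta) = j.
Proof.
move=> jd H; set r := rk _ _.
have Hr q : (q < d)%N -> (q < r)%N = (q < j)%N by move=> qd; rewrite -mu_rk// H.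
apply/eqP; rewrite eqn_leq; apply/andP; split; rewrite leqNgt; apply/negP => h.
  by have := Hr j (leq_trans h (rk_le _ _)); rewrite h ltnn.
by have := Hr r (leq_trans h jd); rewrite h ltnn.
Qed.

(* The rate at which the sum of the minima of index [i <= q < j] moves along the
   ray, when the flags of rank [i] and [j] have types [p] and [p']. *)
Let rate (i j p p' : nat) : R :=
  tau * (p'%:R - p%:R) - (j%:R - p'%:R - (i%:R - p%:R)).

(** There are finitely many rates, so it suffices that none vanishes. A zero rate with p < p' writes
    [tau] as an exceptional quotient; with p' <= p it equates a nonpositive and a positive
    number. *)
Lemma rate_gap : exists2 c0, 0 < c0 & forall i j p p',
  (i < j)%N -> (j <= d)%N -> (p <= i)%N -> (i <= p + n)%N ->
  (p' <= m)%N -> (p' <= j)%N -> (j <= p' + n)%N -> c0 <= `|rate i j p p'|.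
Proof.
pose T := ('I_d.+1 * 'I_d.+1 * 'I_d.+1 * 'I_d.+1)%type.
pose f (u : T) := `|rate u.1.1.1 u.1.1.2 u.1.2 u.2|.
exists (\big[Num.min/1]_(u : T | f u != 0) f u).
  apply/bigmin_gtP; split => // u; rewrite /f => fu0.
  by rewrite lt_neqAle eq_sym fu0 normr_ge0.
move=> i j p p' ij jd pi ipn p'm p'j jp'n.
pose u : T := (inord i, inord j, inord p, inord p').
have fu : f u = `|rate i j p p'| by rewrite /f /u /= !inordK// ltnS; lia.
rewrite -fu; apply: bigmin_le_cond; rewrite fu normr_eq0; apply/eqP => r0.
apply: tau_nE.
have E : tau * (p'%:R - p%:R) = (j%:R - p'%:R) - (i%:R - p%:R).
  by move: r0; rewrite /rate; lra.
have jp : (j%:R - p'%:R) - (i%:R - p%:R) = (j - p')%:R - (i - p)%:R :> R.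
  by rewrite !natrB.
have ijR : i%:R < j%:R :> R by rewrite ltr_nat.
have [pp'|p'p] := ltnP p p'.
  have qq : (i - p < j - p')%N.
    rewrite -(ltr_nat R) -subr_gt0 -jp -E mulr_gt0// subr_gt0 ltr_nat//.
  exists (p' - p)%N; first by rewrite /=; lia.
  exists ((j - p') - (i - p))%N; first by rewrite /=; lia.
  rewrite natrB ?(ltnW qq)// -jp -E natrB ?(ltnW pp')// mulfK//.
  by rewrite subr_eq0 eqr_nat; lia.
have : tau * (p'%:R - p%:R) <= 0.
  by rewrite pmulr_rle0// subr_le0 ler_nat.
rewrite E; have : p'%:R <= p%:R :> R by rewrite ler_nat.
by lra.
Qed.

Let block i j lo hi x := [/\ (i < j)%N, (j <= d)%N &
  forall q, (q < d)%N -> [/\ (q < i)%N -> mu q x (tau * x) <= - (hi * x),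
    (i <= q < j)%N -> `|mu q x (tau * x)| < lo * x &
    (j <= q)%N -> hi * x <= mu q x (tau * x)]].

Lemma block_mu_sum i j lo hi x : block i j lo hi x ->
  `|mu_sum j x (tau * x) - mu_sum i x (tau * x)| <= d%:R * (lo * x).
Proof.
move=> [ij jd H].
have -> : mu_sum j x (tau * x) - mu_sum i x (tau * x) =
    \sum_(i <= q < j) mu q x (tau * x).
  rewrite /mu_sum -!(big_mkord xpredT (fun l => mu l x (tau * x))).
  by rewrite (big_cat_nat (leq0n i) (ltnW ij))/= addrAC subrr add0r.
have lo0 : 0 <= lo * x.
  have [_ + _] := H i (leq_trans ij jd); rewrite leqnn ij => /(_ isT).
  by move=> /ltW; exact: le_trans.
apply: le_trans (ler_norm_sum _ _ _) _.
apply: (@le_trans _ _ (\sum_(i <= q < j) (lo * x))).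
  rewrite big_nat [leRHS]big_nat; apply: ler_sum => q /andP[iq qj].
  have [_ + _] := H q (leq_trans qj jd).
  by rewrite iq qj => /(_ isT) /ltW.
by rewrite sumr_const_nat -[_ *+ (j - i)]mulr_natl ler_wpM2r// ler_nat leq_subLR (leq_trans jd)// leq_addl.
Qed.

(** The block sum [mu_sum j - mu_sum i] is small at both ends, yet moves at a rate of size at least
    [c0] between them. Equality of the types at both ends lets the lower and the upper growth
    estimates refer to the same rate. *)
Lemma block_step c0 i j lo hi x x' :
  (forall i j p p', (i < j)%N -> (j <= d)%N -> (p <= i)%N -> (i <= p + n)%N ->
    (p' <= m)%N -> (p' <= j)%N -> (j <= p' + n)%N -> c0 <= `|rate i j p p'|) ->
  0 < x -> x <= x' -> 0 < lo -> 8 * lo <= hi ->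
  hi <= 1 -> 4 * (1 + tau) * (x' - x) <= hi * x ->
  block i j lo hi x -> block i j lo hi x' ->
  a i x (tau * x) = a i x' (tau * x') -> a j x (tau * x) = a j x' (tau * x') ->
  c0 * (x' - x) <= 2 * C + 2 * (d%:R * (lo * x')).
Proof.
move=> Hc0 x0 xx lo0 lohi hi1 xx' B B' ai aj.
have yy : tau * x <= tau * x' by rewrite ler_pM2l.
have hx : 8 * (lo * x) <= hi * x by rewrite mulrA ler_pM2r.
have x2 : x' <= 2 * x.
  have : hi * x <= x by rewrite ler_piMl// ltW.
  have : 0 <= tau * (x' - x) by rewrite mulr_ge0 ?subr_ge0// ltW.
  by lra.
have lx : lo * x' <= 2 * (lo * x) by have := ler_wpM2l (ltW lo0) x2; lra.
have hx' : hi * x <= hi * x' by rewrite ler_wpM2l//; lra.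
have t1 : tau * x' - tau * x <= hi * x / 4 by have := subr_ge0 x x'; rewrite xx; lra.
have t2 : x' - x <= hi * x / 4.
  have : 0 <= tau * (x' - x) by rewrite mulr_ge0 ?subr_ge0// ltW.
  by lra.
have lx0 : 0 < lo * x by rewrite mulr_gt0.
have [ij jd H] := B; have [_ _ H'] := B'.
have rj z th : 0 < z -> block i j lo hi z -> lo * z <= th -> th <= hi * z ->
    rk (z + th) (tau * z - th) = j.
  move=> z0 [_ _ Hz] t3 t4; apply: rk_eqP => // q qd.
  have [h1 h2 h3] := Hz q qd.
  have [qj|jq] := ltnP q j; last by apply/negbTE; rewrite -leNgt (le_trans t4)// h3.
  have [qi|iq] := ltnP q i.
    have : 0 < lo * z by rewrite mulr_gt0.
    by have := h1 qi; lra.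
  by apply: lt_le_trans t3; apply: le_lt_trans (ler_norm _) (h2 _); rewrite iq qj.
have ri z th : 0 < z -> block i j lo hi z -> - (hi * z) < th -> th <= - (lo * z) ->
    rk (z + th) (tau * z - th) = i.
  move=> z0 [_ _ Hz] t3 t4; apply: rk_eqP => [|q qd]; first by rewrite ltnW// (leq_trans ij).
  have [h1 h2 h3] := Hz q qd.
  have [qi|iq] := ltnP q i; first by rewrite (le_lt_trans (h1 qi)).
  apply/negbTE; rewrite -leNgt (le_trans t4)//.
  have [qj|jq] := ltnP q j.
    by have : `|mu q z (tau * z)| < lo * z; [by apply: h2; rewrite iq qj|rewrite ltr_norml => /andP[/ltW]].
  have : 0 < lo * z by rewrite mulr_gt0.
  have : 0 < hi * z by rewrite mulr_gt0//; lra.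
  by have := h3 jq; lra.
have x'0 : 0 < x' by lra.
(* The dilation hi x / 2 is in the gap above the block. The shifts required by [growth] are at most
   hi x / 4 and hence stay in the gap, whose lower end lo x' is at most hi x / 4. The gap below the
   block is treated with the opposite dilation. *)
have rj0 : rk (x + hi * x / 2) (tau * x - hi * x / 2) = j.
  by apply: rj => //; lra.
have rj1 : rk (x' + (hi * x / 2 + (tau * x' - tau * x)))
    (tau * x' - (hi * x / 2 + (tau * x' - tau * x))) = j.
  by apply: rj => //; lra.
have rj2 : rk (x' + (hi * x / 2 - (x' - x)))
    (tau * x' - (hi * x / 2 - (x' - x))) = j.
  by apply: rj => //; lra.
have ri0 : rk (x + - (hi * x / 2)) (tau * x - - (hi * x / 2)) = i.
  by apply: ri => //; lra.
have ri1 : rk (x' + (- (hi * x / 2) + (tau * x' - tau * x)))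
    (tau * x' - (- (hi * x / 2) + (tau * x' - tau * x))) = i.
  by apply: ri => //; lra.
have ri2 : rk (x' + (- (hi * x / 2) - (x' - x)))
    (tau * x' - (- (hi * x / 2) - (x' - x))) = i.
  by apply: ri => //; lra.
have [_ aij ain] := a_bound ri0; have [ajm ajj ajn] := a_bound rj0.
have {}Hc0 := Hc0 _ _ _ _ ij jd aij ain ajm ajj ajn.
have [/(_ rj1) gj1 /(_ rj2) gj2] := growth xx yy rj0.
have [/(_ ri1) gi1 /(_ ri2) gi2] := growth xx yy ri0.
have s1 := block_mu_sum B; have s2 := block_mu_sum B'.
rewrite -ai -aj in gi2 gj2.
rewrite !natrB// in gi1 gi2 gj1 gj2.
have dlx : d%:R * (lo * x) <= d%:R * (lo * x').
  by rewrite ler_wpM2l// ler_wpM2l// ltW.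
apply: le_trans (ler_wpM2r _ Hc0) _; first by rewrite subr_ge0.
rewrite -[X in _ * X <= _]ger0_norm ?subr_ge0// -normrM ler_norml /rate.
move: s1 s2; rewrite !ler_norml => /andP[s1 s1'] /andP[s2 s2'].
move: gi1 gi2 gj1 gj2 s1 s1' s2 s2' dlx.
move: (mu_sum _ _ _) (mu_sum _ _ _) (mu_sum _ _ _) (mu_sum _ _ _).
move: (d%:R * (lo * x)) (d%:R * (lo * x')).
move: (a i x (tau * x))%:R (a j x (tau * x))%:R.
move: i%:R j%:R C tau.
clear => i j C tau p q L1 L2 W1 W2 W3 W4 *.
by apply/andP; split; lra.
Qed.

Definition small_minimum e delta : pred nat := fun k =>
  [exists q : 'I_d, `|mu q (geom e k) (tau * geom e k)| < delta * geom e k].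

Lemma mass_cover (T : finType) (e : R) (P : pred nat) (Q : T -> pred nat) K :
  0 < e -> (forall k, P k -> exists u, Q u k) ->
  mass e P K <= \sum_u mass e (Q u) K.
Proof.
move=> e0 PQ; elim: K => [|K IH].
  by rewrite mass0 big1// => u _; rewrite mass0.
under eq_bigr do rewrite massS.
rewrite massS big_split /= lerD//.
have gK : 0 <= geom e K.+1 - geom e K by rewrite subr_ge0 le_geom.
case: ifPn => [/PQ[u Qu]|_].
  by rewrite (bigD1 u)//= Qu lerDl sumr_ge0// => v _; case: ifP.
by rewrite sumr_ge0// => v _; case: ifP.
Qed.

Lemma few_small_minima eta : (0 < d)%N -> 0 < eta ->
  exists delta, [/\ 0 < delta, delta <= 1 &
  forall e, 0 < e -> e <= delta -> exists C', forall K,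
    mass e (small_minimum e delta) K <= eta * geom e K + C'].
Proof.
move=> d0 eta0; have tau0 := tau_gt0; have [c0 c0_gt0 Hc0] := rate_gap.
pose T := ('I_d.+1 * 'I_d.+1 * 'I_d.+1 * 'I_d.+1 * 'I_d.+1)%type.
pose D : R := d%:R; have D_gt0 : 0 < D by rewrite ltr0n.
(* With the [alpha] and [beta] chosen below and e <= lo, the bound of [cluster_mass] is at most
   [kap * z]. *)
pose kap := 32 * (1 + tau) * (4 * D / c0 + 1).
have kap0 : 0 < kap.
  by rewrite !mulr_gt0//; [lra|rewrite addr_gt0// divr_gt0// mulr_gt0].
pose NT : R := #|{: T}|%:R.
have NT0 : 0 < NT by rewrite ltr0n; apply/card_gt0P; exists (ord0, ord0, ord0, ord0, ord0).
(* The ratio of consecutive levels. The first bound ensures 2 e <= alpha and 8 lo <= hi; the second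
   makes the sum over all [NT] classes at most eta. *)
pose z := Num.min (8 * (1 + tau))^-1 (eta / (NT * kap)).
have t8 : 0 < 8 * (1 + tau) by lra.
have z0 : 0 < z by rewrite lt_min invr_gt0 t8 divr_gt0// mulr_gt0.
have z1 : z * (8 * (1 + tau)) <= 1.
  by rewrite -ler_pdivlMr// div1r ge_min lexx.
have z2 : NT * (kap * z) <= eta.
  have : z <= eta / (NT * kap) by rewrite /z ge_min lexx orbT.
  have NK0 : 0 < NT * kap by exact: mulr_gt0.
  by rewrite (ler_pdivlMr _ _ NK0) => h; rewrite mulrA mulrC.
have tz : 0 < tau * z by rewrite mulr_gt0.
have z8 : 8 * z <= 1 by lra.
pose lev l := z ^+ (d.+1 - l).
have levS l : (l <= d)%N -> lev l = z * lev l.+1.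
  by move=> ld; rewrite /lev subSS subSn// exprS.
have lev0 l : 0 < lev l by rewrite exprn_gt0.
have lev1 l : lev l <= 1 by rewrite exprn_ile1// ?(ltW z0)//; lra.
have levle l l' : (l <= l')%N -> lev l <= lev l'.
  move=> ll; rewrite /lev ler_wiXn2l ?(ltW z0)//; first by lra.
  by rewrite leq_sub2l.
exists (lev 0); split => // e e0 ee.
(* From [k0] on the additive constant of [growth] is dominated by the size of the block sums. *)
have [k0 Hk0] := geom_unbounded e0 (C / (D * lev 0)).
pose x k := geom e k.
pose cls (u : T) : pred nat := fun k =>
  let: (l, i, j, p, p') := u in
  [&& (i < j)%N, a i (x k) (tau * x k) == p, a j (x k) (tau * x k) == p' &
   [forall q : 'I_d, [&& (q < i)%N ==> (mu q (x k) (tau * x k) <= - (lev l.+1 * x k)),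
     (i <= q < j)%N ==> (`|mu q (x k) (tau * x k)| < lev l * x k) &
     (j <= q)%N ==> (lev l.+1 * x k <= mu q (x k) (tau * x k))]]].
have clsP l i j p p' k : cls (l, i, j, p, p') k ->
  [/\ block i j (lev l) (lev l.+1) (x k), a i (x k) (tau * x k) = p &
    a j (x k) (tau * x k) = p'].
  move=> /and4P[ij /eqP -> /eqP -> /forallP H]; split=> //; split=> //.
    by rewrite -ltnS.
  by move=> q qd; have /and3P[/implyP h1 /implyP h2 /implyP h3] := H (Ordinal qd).
have small_cls k : small_minimum e (lev 0) k -> exists u, cls u k.
  case/existsP => q0; rewrite -/(x k); set X := x k; set Y := tau * X => q0small.
  have X0 : 0 < X by exact: geom_gt0.
  (* There are more gaps between consecutive levels than minima. *)
  have [l Hl] : exists l : 'I_d.+1, forall q : 'I_d,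
      ~~ (lev l * X <= `|mu q X Y| < lev l.+1 * X).
    have [/existsP[l /forallP H]|] := boolP [exists l : 'I_d.+1,
        [forall q : 'I_d, ~~ (lev l * X <= `|mu q X Y| < lev l.+1 * X)]].
      by exists l.
    rewrite negb_exists => /forallP H.
    have /fin_all_exists[f Hf] : forall l : 'I_d.+1, exists q : 'I_d,
        (lev l * X <= `|mu q X Y| < lev l.+1 * X).
      move=> l; have := H l; rewrite negb_forall => /existsP[q].
      by rewrite negbK; exists q.
    have finj : injective f.
      have half l l' : f l = f l' -> (l' <= l)%N.
        move=> fl; rewrite leqNgt; apply/negP => ll'.
        have /andP[_ h1] := Hf l; have /andP[h2 _] := Hf l'.
        have : lev l.+1 * X <= lev l' * X by rewrite ler_pM2r// levle.
        by rewrite fl in h1; lra.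
      move=> l l' fl; apply/val_inj/eqP; rewrite eqn_leq half//=.
      by rewrite half.
    by have := leq_card f finj; rewrite !card_ord ltnn.
  have ll := ltn_ord l; rewrite ltnS in ll.
  pose i := rk (X + - (lev l * X)) (Y - - (lev l * X)).
  pose j := rk (X + lev l * X) (Y - lev l * X).
  have lo0 : 0 < lev l * X by rewrite mulr_gt0.
  have iP q : (q < d)%N -> (q < i)%N = (mu q X Y < - (lev l * X)).
    by move=> qd; rewrite mu_rk.
  have jP q : (q < d)%N -> (q < j)%N = (mu q X Y < lev l * X).
    by move=> qd; rewrite mu_rk.
  have [aim _ _] := @a_bound i X Y _ erefl.
  have [ajm _ _] := @a_bound j X Y _ erefl.
  exists (l, inord i, inord j, inord (a i X Y), inord (a j X Y)) => /=.
  rewrite -!/(x k) -!/X -!/Y !inordK ?ltnS ?rk_le//; last 2 first.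
  - by rewrite (leq_trans ajm)// leq_addr.
  - by rewrite (leq_trans aim)// leq_addr.
  rewrite !eqxx /=; apply/andP; split.
    have q0l : `|mu q0 X Y| < lev l * X.
      by apply: lt_le_trans q0small _; rewrite ler_pM2r// levle.
    move: q0l; rewrite ltr_norml => /andP[h1 h2].
    have q0j : (q0 < j)%N by rewrite jP.
    apply: leq_ltn_trans q0j; rewrite leqNgt iP//.
    by rewrite -leNgt ltW.
  apply/forallP => q; have := Hl q; rewrite negb_and -ltNge -leNgt => Hq.
  apply/and3P; split; apply/implyP.
  - rewrite iP// => h; move: Hq; rewrite ltr0_norm; last by lra.
    by case/orP; lra.
  - case/andP; rewrite leqNgt iP// -leNgt jP// => h1 h2.
    have h3 : `|mu q X Y| <= lev l * X by rewrite ler_norml h1 ltW.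
    case/orP: Hq => // h4; have : lev l * X < lev l.+1 * X.
      rewrite ltr_pM2r// levS// gtr_pMl//; lra.
    by lra.
  - rewrite leqNgt jP// -leNgt => h; move: Hq; rewrite ger0_norm; last by lra.
    by case/orP; lra.
have cls_mass u K : mass e (cls u) K <= eta / NT * geom e K + geom e k0.
  case: u => [[[[l i] j] p] p'].
  pose lo := lev l; pose hi := lev l.+1.
  have lohi : lo = z * hi by rewrite /lo levS// -ltnS.
  have hi0 : 0 < hi by exact: lev0.
  have elo : e <= lo by apply: le_trans ee _; exact: levle.
  (* The largest relative distance for which [block_step] applies; [beta] is then its conclusion
     divided by [c0]. *)
  pose alpha := hi / (4 * (1 + tau)).
  have aE : alpha * (4 * (1 + tau)) = hi by rewrite divfK// gt_eqF//; lra.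
  have a0 : 0 < alpha by rewrite divr_gt0//; lra.
  pose beta := 4 * D * lo / c0.
  have lo0 : 0 < lo by exact: lev0.
  have b0 : 0 <= beta by rewrite divr_ge0 ?mulr_ge0// ltW.
  have hi1 : hi <= 1 by exact: lev1.
  have hz : hi * (z * (8 * (1 + tau))) <= hi by rewrite ler_piMr// ltW.
  have at0 : 0 < alpha * tau by rewrite mulr_gt0.
  have a1 : alpha <= 1 by lra.
  have a2 : 2 * e <= alpha.
    apply: (@le_trans _ _ (2 * (z * hi))); first by rewrite -lohi; lra.
    by rewrite ler_pdivlMr; lra.
  have step k k' : (k0 <= k)%N -> (k < k')%N -> cls (l, i, j, p, p') k ->
      cls (l, i, j, p, p') k' -> geom e k' <= (1 + alpha) * geom e k ->
      geom e k' - geom e k <= beta * geom e k'.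
    move=> k0k kk' /clsP[B ai aj] /clsP[B' ai' aj'] kk.
    have xx : x k <= x k' by rewrite le_geom// ltnW.
    have xk0 : 0 < x k by exact: geom_gt0.
    have xx' : 4 * (1 + tau) * (x k' - x k) <= hi * x k.
      have h : x k' - x k <= alpha * x k by rewrite /x; lra.
      have t4 : 0 <= 4 * (1 + tau) by lra.
      by have := ler_wpM2l t4 h; rewrite -aE; lra.
    have lohi8 : 8 * lo <= hi by rewrite lohi; nra.
    have := block_step Hc0 xk0 xx lo0 lohi8 hi1 xx' B B' _ _.
    rewrite ai ai' aj aj' => /(_ erefl erefl) h.
    have Dl : 0 < D * lev 0 by rewrite mulr_gt0.
    have CD : C <= D * (lo * x k').
      move: Hk0; rewrite ler_pdivrMr// => /le_trans; apply.
      rewrite mulrC -mulrA ler_pM2l// ler_pM ?(ltW (lev0 _)) ?(ltW (geom_gt0 e0 _))//.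
        exact: levle.
      by apply: le_geom => //; rewrite (leq_trans k0k)// ltnW.
    rewrite /beta mulrAC ler_pdivlMr//; rewrite -/(x _) -/(x _) mulrC.
    by move: h; rewrite -/D -/lo; lra.
  apply: le_trans (cluster_mass e0 a1 a2 b0 step K) _.
  rewrite lerD2r ler_wpM2r ?(ltW (geom_gt0 e0 _))//.
  apply: (@le_trans _ _ (kap * z)); last by rewrite ler_pdivlMr// mulrC.
  rewrite ler_pdivrMr//; have -> : kap * z * alpha = 8 * (beta + lo).
    rewrite lohi -aE /kap /beta lohi -aE; field; rewrite gt_eqF//.
  by lra.
exists (NT * geom e k0) => K.
apply: le_trans (mass_cover K e0 small_cls) _.
apply: le_trans (ler_sum _ (fun u _ => cls_mass u K)) _.
rewrite sumr_const -[X in X <= _]mulr_natl -/NT mulrDr mulrA.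
by rewrite [NT * (eta / NT)]mulrC divfK// gt_eqF.
Qed.

End few_small_minima.

Section tallies.
Variable F : realDomainType.
Variables (z x x0 x1 x2 P0 P1 gK gKK g2 iK i0 i2 KE b c1 c2 : F).
Hypothesis z_gt0 : 0 < 3 * z.

(** The closing account of [staircase], with [z] a third of eta: discretisation, bounded losses per
    step and bad scales take one third each, and values at the first scales go into the constant. *)
Lemma upper_tally : P0 <= P1 ->
  P1 + (gK - g2) <= iK - i2 + z * (x - x0) + KE + b ->
  gKK <= gK -> b <= z * x1 + c1 -> KE <= z * x2 + c2 ->
  x1 <= x -> x2 <= x -> 0 < x0 ->
  P0 <= iK - gKK + 3 * z * x + (c1 + c2 + `|i0| + `|i2| + `|g2|).
Proof.
move=> h1 h2 h3 h4 h5 xx1 xx2 x00; have z0 : 0 <= z by move: z_gt0; lra.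
have := ler_wpM2l z0 xx1; have := ler_wpM2l z0 xx2.
have := mulr_ge0 z0 (ltW x00); have := normr_ge0 i0.
by have := ler_norm (- i2); have := ler_norm g2; rewrite normrN; lra.
Qed.

Lemma lower_tally : P1 <= P0 ->
  iK - i0 - z * (x - x0) - KE - b <= P1 + (gK - g2) ->
  gK <= gKK -> 0 <= g2 -> b <= z * x + c1 -> KE <= z * x + c2 -> 0 < x0 ->
  iK - gKK - 3 * z * x - (c1 + c2 + `|i0| + `|i2| + `|x1|) <= P0.
Proof.
move=> h1 h2 h3 h4 h5 h6 x00; have z0 : 0 <= z by move: z_gt0; lra.
have := mulr_ge0 z0 (ltW x00); have := normr_ge0 i2; have := normr_ge0 x1.
by have := ler_norm i0; lra.
Qed.

End tallies.

(** * Vertical increments against the integral of the rank *)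

Section staircase.
Variables (R : realType) (d : nat).
Hypothesis d_gt0 : (0 < d)%N.
Variables (mu : nat -> R -> R -> R) (rk : R -> R -> nat) (G : R -> R -> R).
Hypothesis rk_le : forall x y, (rk x y <= d)%N.
Hypothesis rk_mu : forall i x y, (i < d)%N -> (i < rk x y)%N = (mu i x y < 0).
Hypothesis mu_diag : forall i x y c, (i < d)%N ->
  mu i (x + c) (y - c) = mu i x y - c.
Hypothesis le_mu : forall i x y x' y', (i < d)%N -> x <= x' -> y' <= y ->
  mu i x' y' <= mu i x y.
Hypothesis GE : forall x y, G x y = \sum_(i < d) Num.max (- mu i x y) 0.
Variable C : R.
Hypothesis C_ge0 : 0 <= C.
Hypothesis leG : forall x y x' y', x <= x' -> y' <= y -> G x y <= G x' y'.
Hypothesis lipG : forall x y x' y', x <= x' -> y' <= y ->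
  G x' y' <= G x y + d%:R * ((x' - x) + (y - y')).
Hypothesis smG : forall x y x' y', x <= x' -> y <= y' ->
  G x' y' + G x y <= G x' y + G x y' + C.
Variables (tau : R) (I : R -> R).
Hypothesis tau_gt0 : 0 < tau.
Hypothesis I_const : forall x x' r, 1 <= x -> x <= x' ->
  (forall s, x <= s <= x' -> rk s (tau * s) = r) -> I x' - I x = r%:R * (x' - x).
Hypothesis I_bound : forall x x', 1 <= x -> x <= x' ->
  0 <= I x' - I x <= d%:R * (x' - x).

Let bad e delta : pred nat := fun k =>
  [exists q : 'I_d, `|mu q (geom e k) (tau * geom e k)| < delta * geom e k].

Hypothesis few_bad : forall eta, 0 < eta ->
  exists delta, [/\ 0 < delta, delta <= 1 &
  forall e, 0 < e -> e <= delta -> exists C', forall K,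
    mass e (bad e delta) K <= eta * geom e K + C'].

Lemma mu_lipschitz i x y x' y' : (i < d)%N ->
  mu i x y <= mu i x' y' + (`|x' - x| + `|y' - y|).
Proof.
move=> id; pose c := `|x' - x| + `|y' - y|.
have h1 := ler_norm (x' - x); have h2 := ler_norm (y' - y).
have h3 : - (x' - x) <= `|x' - x| by rewrite -normrN ler_norm.
have h4 : - (y' - y) <= `|y' - y| by rewrite -normrN ler_norm.
have h5 := normr_ge0 (x' - x); have h6 := normr_ge0 (y' - y).
have -> : mu i x y = mu i (x + c) (y - c) + c by rewrite mu_diag// subrK.
by rewrite lerD2r le_mu// /c; lra.
Qed.

Section good_step.
Variables (e delta : R) (k : nat).
Hypotheses (e_gt0 : 0 < e) (e_small : (12 + 8 * tau) * e <= delta) (delta1 : delta <= 1).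
Hypothesis good : ~~ bad e delta k.
Let X := geom e k.
(** Up to three geometric steps cost (1 + e) ^ 3 - 1 <= 7 e, and 4 e X covers the vertical margin of
    the corner estimates. The total displacement is at most (11 + 7 tau) e X, less than the size of
    every minimum at a good scale, so no sign changes. *)
Let near x y := `|x - X| <= 7 * e * X /\ `|y - tau * X| <= (7 * tau + 4) * e * X.

Let X_gt0 : 0 < X. Proof. exact: geom_gt0. Qed.

Lemma near_mu i x y : (i < d)%N -> near x y ->
  (mu i X (tau * X) < 0 -> mu i x y < 0) /\
  (0 <= mu i X (tau * X) -> 0 <= mu i x y).
Proof.
move=> id [nx ny]; have X0 := X_gt0; have e0 := e_gt0; have t0 := tau_gt0.
have dX : delta * X <= `|mu i X (tau * X)|.
  have := good; rewrite negb_exists => /forallP/(_ (Ordinal id)).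
  by rewrite -leNgt.
have eX : (12 + 8 * tau) * e * X <= delta * X by rewrite ler_pM2r.
have eX0 : 0 < e * X by rewrite mulr_gt0.
have teX0 : 0 < tau * (e * X) by rewrite mulr_gt0.
have h1 := mu_lipschitz x y X (tau * X) id.
have h2 := mu_lipschitz X (tau * X) x y id.
rewrite (distrC X) (distrC (tau * X)) in h1.
split=> [mX|mX]; last by rewrite ger0_norm// in dX; lra.
by rewrite ltr0_norm// in dX; lra.
Qed.

Lemma near_rk x y : near x y -> rk x y = rk X (tau * X).
Proof.
move=> nxy.
have H i : (i < d)%N -> (i < rk x y)%N = (i < rk X (tau * X))%N.
  move=> id; have [h1 h2] := near_mu id nxy; rewrite !rk_mu//.
  apply/idP/idP => // h; rewrite ltNge; apply/negP => /h2.
  by rewrite leNgt h.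
apply/eqP; rewrite eqn_leq; apply/andP; split; rewrite leqNgt; apply/negP => h.
  by have := H _ (leq_trans h (rk_le _ _)); rewrite h ltnn.
by have := H _ (leq_trans h (rk_le _ _)); rewrite h ltnn.
Qed.

Lemma near_G x y c : near x y -> near (x + c) (y - c) ->
  G (x + c) (y - c) = G x y + (rk X (tau * X))%:R * c.
Proof.
move=> n1 n2; set r := rk X (tau * X).
have rd : (r <= d)%N by exact: rk_le.
have -> : r%:R * c = \sum_(i < d) (if (i < r)%N then c else 0).
  rewrite -big_mkcond /= -(big_ord_widen _ (fun=> c) rd) sumr_const card_ord.
  by rewrite mulr_natl.
rewrite !GE -big_split /=; apply: eq_bigr => i _; have id := ltn_ord i.
have [h1 h2] := near_mu id n1; have [h3 h4] := near_mu id n2.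
case: ifPn; rewrite /r rk_mu// -?leNgt => mX.
  rewrite !(max_idPl _) ?oppr_ge0 ?ltW ?h1 ?h3// mu_diag// opprB; lra.
by rewrite !(max_idPr _) ?oppr_le0 ?h2 ?h4// addr0.
Qed.

Lemma near_geom j : (j <= k.+3)%N -> (k <= j.+2)%N ->
  `|geom e j - X| <= 7 * e * X.
Proof.
move=> jk kj; have X0 := X_gt0; have e0 := e_gt0.
have e1 : e <= 1.
  have : 0 < tau * e by rewrite mulr_gt0.
  by have := e_small; have := delta1; lra.
have eX0 : 0 < e * X by rewrite mulr_gt0.
have eeX : e * (e * X) <= e * X by rewrite ler_piMl// ltW.
have eeeX : e * (e * (e * X)) <= e * X.
  exact: le_trans (ler_wpM2l (ltW e0) eeX) eeX.
have [jk0|kj0] := leqP j k.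
  have gj : geom e j <= X by rewrite le_geom.
  rewrite distrC ger0_norm ?subr_ge0//.
  have gj0 : 0 < geom e j by exact: geom_gt0.
  have ge0 : geom e k <= (1 + e) * ((1 + e) * geom e j).
    by rewrite -!geomS le_geom.
  have ej : e * geom e j <= e * X by rewrite ler_pM2l.
  have eej : e * (e * geom e j) <= e * X.
    exact: le_trans (ler_wpM2l (ltW e0) ej) eeX.
  by rewrite -/X in ge0; lra.
have gj : X <= geom e j by rewrite le_geom// ltnW.
rewrite ger0_norm ?subr_ge0//.
have ge0 : geom e j <= (1 + e) * ((1 + e) * ((1 + e) * X)).
  by rewrite -!geomS le_geom.
by lra.
Qed.

Lemma near_itv x y : X - 7 * e * X <= x -> x <= X + 7 * e * X ->
  tau * X - (7 * tau + 4) * e * X <= y -> y <= tau * X + (7 * tau + 4) * e * X ->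
  near x y.
Proof. by move=> ? ? ? ?; split; rewrite ler_norml; lra. Qed.

Lemma ray_const j : (j <= k.+2)%N -> (k <= j.+2)%N ->
  I (geom e j.+1) - I (geom e j)
    = (rk X (tau * X))%:R * (geom e j.+1 - geom e j).
Proof.
move=> jk kj; have X0 := X_gt0; have e0 := e_gt0; have t0 := tau_gt0.
have eX0 : 0 < e * X by rewrite mulr_gt0.
apply: I_const; [exact: geom_ge1|by rewrite le_geom|].
move=> s /andP[s1 s2]; apply: near_rk.
have := @near_geom j (leqW jk) kj; have := @near_geom j.+1 _ (leqW kj).
rewrite ltnS => /(_ jk); rewrite !ler_norml => /andP[_ h1] /andP[h2 _].
have h3 : X - 7 * e * X <= s by lra.
have h4 : s <= X + 7 * e * X by lra.
have := ler_wpM2l (ltW t0) h3; have := ler_wpM2l (ltW t0) h4.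
by move=> ? ?; apply: near_itv; lra.
Qed.

End good_step.

(** [right_corner] on the rectangle from (x_k, y_(k+2)) to (x_(k+1), y_(k+3)), whose aspect ratio is
    [t], regrouped so that the last difference telescopes in k. *)
Lemma right_step e delta k N : 0 < e -> (12 + 8 * tau) * e <= delta ->
  delta <= 1 -> (0 < N)%N -> ~~ bad e delta k ->
  let x j := geom e j in let y j := tau * geom e j in
  let t := tau * (1 + e) ^+ 2 in is_true (
  I (x k.+1) - I (x k) - corner_error C d%:R (x k) (x k.+1) t N <=
  (1 + t^-1) * (G (x k.+1) (y k.+2) - G (x k.+1) (y k.+3))
   + (G (x k.+1) (y k.+3) - G (x k) (y k.+2))).
Proof.
move=> e0 es d1 N0 gk x y t; have t0 := tau_gt0; have X0 := geom_gt0 e0 k.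
have eX0 : 0 < e * geom e k by rewrite mulr_gt0.
have k2' : (k <= k.+2)%N by rewrite leqW.
have k4 : (k <= k.+4)%N by rewrite !leqW.
rewrite (ray_const e0 es d1 gk (j := k) k2' k2').
set r := (rk _ _)%:R.
have tt0 : 0 < t by rewrite mulr_gt0// exprn_gt0//; lra.
have L : x k.+1 - x k = e * geom e k by rewrite /x geomS; lra.
have yt : y k.+3 - y k.+2 = t * (x k.+1 - x k).
  by rewrite L /y /t !geomS; ring.
have := near_geom e0 es d1 (k := k) (j := k.+2) (leqnSn _) k4.
have := near_geom e0 es d1 (k := k) (j := k.+3) (leqnn _) (leqW k4).
rewrite !ler_norml => /andP[_ k3] /andP[k2 _].
have k2'' : geom e k <= geom e k.+2 by rewrite le_geom// ltnW.
have h3 := ler_wpM2l (ltW t0) k3; have h2 := ler_wpM2l (ltW t0) k2''.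
have te0 : 0 < tau * (e * geom e k) by rewrite mulr_gt0.
have xx : x k < x k.+1 by rewrite -subr_gt0 L.
have dg a b c : 0 <= c ->
  [/\ x k - (x k.+1 - x k) <= a, a <= x k.+1, y k.+2 - 2 * (x k.+1 - x k) <= b & b <= y k.+3] ->
  [/\ x k - (x k.+1 - x k) <= a + c, a + c <= x k.+1, y k.+2 - 2 * (x k.+1 - x k) <= b - c & b - c <= y k.+3] ->
  G (a + c) (b - c) = G a b + r * c.
  move=> c0; rewrite L => -[a1 a2 b1 b2] [a3 a4 b3 b4].
  have xk : x k.+1 = geom e k + e * geom e k by rewrite /x geomS; lra.
  rewrite xk in a2 a4; rewrite /x /y in a1 a3 b1 b2 b3 b4.
  by apply: (near_G e0 es gk); apply: near_itv => //; lra.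
have h := right_corner C_ge0 leG lipG smG xx tt0 N0 yt dg.
apply: le_trans h _; rewrite le_eqVlt; apply/orP; left; apply/eqP.
by ring.
Qed.

(** [left_corner] on the rectangle from (x_(k+2), y_k) to (x_(k+3), y_(k+1)). It lies below the ray
    where that of [right_step] lies above, the two sides from which [tau] is perturbed. *)
Lemma left_step e delta k N : 0 < e -> (12 + 8 * tau) * e <= delta ->
  delta <= 1 -> (0 < N)%N -> ~~ bad e delta k.+1 ->
  let x j := geom e j in let y j := tau * geom e j in
  let t := tau / (1 + e) ^+ 2 in is_true (
  (1 + t^-1) * (G (x k.+2) (y k) - G (x k.+2) (y k.+1))
   + (G (x k.+3) (y k.+1) - G (x k.+2) (y k)) <=
  I (x k.+3) - I (x k.+2) + corner_error C d%:R (x k.+2) (x k.+3) t N).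
Proof.
move=> e0 es d1 N0 gk x y t; have t0 := tau_gt0; have X0 := geom_gt0 e0 k.+1.
have eX0 : 0 < e * geom e k.+1 by rewrite mulr_gt0.
have k4 : (k <= k.+4)%N by rewrite !leqW.
have k3' : (k.+1 <= k.+4)%N by rewrite ltnS !leqW.
rewrite (ray_const e0 es d1 gk (j := k.+2) (leqnSn _) k3').
set r := (rk _ _)%:R; set X := geom e k.+1 in X0 eX0 r *.
have e1 : 0 < 1 + e by lra.
have ee1 : e <= 1 by have : 0 < tau * e; [rewrite mulr_gt0|lra].
have tt0 : 0 < t by rewrite divr_gt0// exprn_gt0.
have L : x k.+3 - x k.+2 = e * ((1 + e) * X) by rewrite /x /X !geomS; lra.
have L2 : x k.+3 - x k.+2 <= 2 * e * X.
  have : e * (e * X) <= e * X by rewrite ler_piMl// ltW.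
  by rewrite L; lra.
have yt : y k.+1 - y k = t * (x k.+3 - x k.+2).
  by rewrite L /y /t /X !geomS; field; rewrite gt_eqF.
have := near_geom e0 es d1 (k := k.+1) (j := k) k4 (leqnSn _).
have := near_geom e0 es d1 (k := k.+1) (j := k.+3) (leqnSn _) (k4 : (k.+1 <= k.+3.+2)%N).
rewrite -/X !ler_norml => /andP[_ k3] /andP[k0 _].
have h0 := ler_wpM2l (ltW t0) k0.
have te0 : 0 < tau * (e * X) by rewrite mulr_gt0.
have xX : X <= x k.+2 by rewrite /x le_geom.
have xx : x k.+2 < x k.+3 by rewrite lt_geom.
have dg a b c : 0 <= c ->
  [/\ x k.+2 - (x k.+3 - x k.+2) <= a, a <= x k.+3, y k - 2 * (x k.+3 - x k.+2) <= b & b <= y k.+1] ->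
  [/\ x k.+2 - (x k.+3 - x k.+2) <= a + c, a + c <= x k.+3, y k - 2 * (x k.+3 - x k.+2) <= b - c & b - c <= y k.+1] ->
  G (a + c) (b - c) = G a b + r * c.
  move=> c0 [a1 a2 b1 b2] [a3 a4 b3 b4].
  have kx3 : x k.+3 <= X + 7 * e * X by rewrite /x; lra.
  have yk : tau * X - 7 * tau * e * X <= y k by rewrite /y; lra.
  have yk1 : y k.+1 = tau * X by [].
  rewrite yk1 in b2 b4; clear k3 k0 h0 L.
  by apply: (near_G e0 es gk); apply: near_itv => //; rewrite -/X; lra.
have h := left_corner C_ge0 leG lipG smG xx tt0 N0 yt dg.
apply: le_trans h; rewrite le_eqVlt; apply/orP; left; apply/eqP.
by ring.
Qed.

Lemma staircase eta : 0 < eta -> exists e, [/\ 0 < e, e <= eta, e <= 1 &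
  exists C', forall K, let x j := geom e j in let y j := tau * geom e j in
  (1 + tau^-1) * \sum_(k < K) (G (x k.+2) (y k) - G (x k.+2) (y k.+1))
    <= I (x K.+2) - G (x K.+2) (y K.+2) + eta * x K.+2 + C' /\
  I (x K) - G (x K) (y K) - eta * x K - C' <=
    (1 + tau^-1) * \sum_(k < K) (G (x k.+1) (y k.+2) - G (x k.+1) (y k.+3))].
Proof.
move=> eta0; have t0 := tau_gt0.
have d0 : 0 < d%:R :> R by rewrite ltr0n.
have eta12 : 0 < eta / (12 * d%:R) by rewrite divr_gt0// mulr_gt0.
have [delta [delta0 delta1 Hdelta]] := few_bad eta12.
pose e := Num.min eta (delta / (12 + 8 * tau)).
have e0 : 0 < e by rewrite lt_min eta0 divr_gt0//; lra.
have es : (12 + 8 * tau) * e <= delta.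
  have : e <= delta / (12 + 8 * tau) by rewrite /e ge_min lexx orbT.
  by rewrite ler_pdivlMr; lra.
have te0 : 0 < tau * e by rewrite mulr_gt0.
have e1 : e <= 1 by lra.
have ed : e <= delta by lra.
exists e; split => //; first by rewrite /e ge_min lexx.
have [C1 HC1] := Hdelta e e0 ed.
(* Chosen so that, for t >= tau / 4, the part of [corner_error] proportional to the length is at
   most eta / 3 of it; [E] bounds the rest. *)
pose N := (Num.truncn (12 * d%:R / (tau * eta))).+1.
have N0 : 0 < N%:R :> R by rewrite ltr0n.
have NE : 12 * d%:R <= N%:R * (tau * eta).
  rewrite -ler_pdivrMr ?mulr_gt0//; exact/ltW/truncnS_gt.
pose E := (2 * N%:R + 4 / tau) * C.
have [C2 HC2] := @linear_le_geom _ e E (eta / 3) e0 e1 ltac:(lra).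
have x_gt0 k := geom_gt0 e0 k.
have leS k : geom e k <= geom e k.+1 by rewrite le_geom.
have err t x0 x1 : tau / 4 <= t -> x0 <= x1 ->
    corner_error C d%:R x0 x1 t N <= eta / 3 * (x1 - x0) + E.
  move=> tt xx; have t'0 : 0 < t by lra.
  have ti : t^-1 <= 4 / tau.
    by rewrite -[4 / tau]invrK lef_pV2 ?posrE ?invr_gt0 ?divr_gt0// invf_div.
  rewrite /corner_error lerD//; last by rewrite ler_wpM2r// lerD2l.
  have xx0 : 0 <= x1 - x0 by rewrite subr_ge0.
  have -> : d%:R * ((x1 - x0) / N%:R / t) = (x1 - x0) * (t^-1 * (d%:R / N%:R)).
    by field; rewrite !gt_eqF.
  rewrite [leRHS]mulrC ler_wpM2l//.
  apply: (@le_trans _ _ (4 / tau * (d%:R / N%:R))).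
    by rewrite ler_wpM2r// divr_ge0// ltW.
  rewrite mulf_div ler_pdivrMr ?mulr_gt0//; lra.
pose B := mass e (bad e delta).
have BS k : B k.+1 = B k + (if bad e delta k then geom e k.+1 - geom e k else 0).
  exact: massS.
have BE K : 4 * d%:R * B K <= eta / 3 * geom e K + 4 * d%:R * `|C1|.
  have h : 4 * d%:R * B K <= 4 * d%:R * (eta / (12 * d%:R) * geom e K + `|C1|).
    rewrite ler_wpM2l ?mulr_ge0//; apply: le_trans (HC1 K) _.
    by rewrite lerD2l ler_norm.
  apply: le_trans h _; rewrite le_eqVlt; apply/orP; left; apply/eqP.
  by field; rewrite gt_eqF.
have e2 : (1 + e) ^+ 2 <= 4 by rewrite expr2; have : e * e <= e; [rewrite ler_piMr// ltW|lra].
have e2' : 1 <= (1 + e) ^+ 2 by rewrite exprn_ege1//; lra.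
have A_ge0 k j : 0 <= G (geom e k) (tau * geom e j) - G (geom e k) (tau * geom e j.+1).
  by rewrite subr_ge0 leG// ler_pM2l.
have claimU K : let t := tau / (1 + e) ^+ 2 in
    (1 + t^-1) * \sum_(k < K) (G (geom e k.+2) (tau * geom e k)
        - G (geom e k.+2) (tau * geom e k.+1))
    + (G (geom e K.+2) (tau * geom e K) - G (geom e 2) (tau * geom e 0)) <=
    I (geom e K.+2) - I (geom e 2) + eta / 3 * (geom e K.+2 - geom e 2)
    + K%:R * E + 4 * d%:R * B K.+1 :> R.
  cbv zeta; set t := tau / (1 + e) ^+ 2.
  have tt : tau / 4 <= t by rewrite ler_pM2l// lef_pV2 ?posrE//; lra.
  have t'0 : 0 < t by lra.
  elim: K => [|K IH].
    have B1 : 0 <= 4 * d%:R * B 1.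
      rewrite mulr_ge0 ?mulr_ge0// /B massS mass0 add0r; case: ifP => // _.
      by rewrite subr_ge0.
    by rewrite big_ord0; lra.
  rewrite big_ord_recr /= [B K.+2]BS.
  (* At a bad scale the Lipschitz bound charges d twice over the next step, which is at most twice
     as long as the bad one; this gives the factor 4 d. *)
  have [bK|gK] := boolP (bad e delta K.+1).
    have L0 : 0 <= geom e K.+3 - geom e K.+2 by rewrite subr_ge0.
    have L1 : geom e K.+3 - geom e K.+2 <= 2 * (geom e K.+2 - geom e K.+1).
      rewrite [geom e K.+3]geomS [geom e K.+2]geomS; have xK := x_gt0 K.+1.
      have exK : 0 < e * geom e K.+1 by rewrite mulr_gt0.
      have : e * (e * geom e K.+1) <= e * geom e K.+1 by rewrite ler_piMl// ltW.
      by lra.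
    have yt : tau * geom e K.+1 - tau * geom e K = t * (geom e K.+3 - geom e K.+2).
      rewrite /t !geomS; field; rewrite gt_eqF//; lra.
    have A1 : t^-1 * (G (geom e K.+2) (tau * geom e K)
        - G (geom e K.+2) (tau * geom e K.+1)) <= d%:R * (geom e K.+3 - geom e K.+2).
      rewrite mulrC ler_pdivrMr// -mulrA [_ * t]mulrC -yt lerBlDl.
      have := @lipG (geom e K.+2) (tau * geom e K.+1) (geom e K.+2) (tau * geom e K) (lexx _).
      by rewrite ler_pM2l// leS subrr add0r; apply.
    have A2 : G (geom e K.+3) (tau * geom e K.+1) - G (geom e K.+2) (tau * geom e K.+1)
        <= d%:R * (geom e K.+3 - geom e K.+2).
      rewrite lerBlDl.
      have := @lipG (geom e K.+2) (tau * geom e K.+1) (geom e K.+3) (tau * geom e K.+1).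
      by rewrite leS lexx subrr addr0; apply.
    have /andP[I0 _] := @I_bound (geom e K.+2) (geom e K.+3) (geom_ge1 e0 _) (leS _).
    have L2 : d%:R * (geom e K.+3 - geom e K.+2) <=
        d%:R * (2 * (geom e K.+2 - geom e K.+1)) by rewrite ler_wpM2l.
    have L3 : 0 <= eta / 3 * (geom e K.+3 - geom e K.+2) by rewrite mulr_ge0//; lra.
    have E0 : 0 <= E.
      by apply: mulr_ge0 => //; rewrite addr_ge0 ?mulr_ge0 ?invr_ge0 ?(ltW t0).
    rewrite -[K.+1%:R]natr1; move: IH A1 A2 I0 L2 L3; move: (\sum_(k < K) _).
    move: (G _ _) (G _ _) (G _ _) (G _ _) (I _) (I _) (I _) => g1 g2 g3 g4 i1 i2 i3.
    move: (geom _ _) (geom _ _) (geom _ _) (geom _ _) => ? ? ? ?.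
    move: (B _) (t^-1) E0 => ? ? ? ? ? ? ? ? ? ?; lra.
  have := left_step e0 es delta1 (ltn0Sn _) gK.
  move=> /(_ (Num.truncn (12 * d%:R / (tau * eta)))); rewrite -/N -/t /= => h1.
  have h2 := err t _ _ tt (leS K.+2).
  rewrite -[K.+1%:R]natr1 addr0; move: IH h1 h2; move: (\sum_(k < K) _) (corner_error _ _ _ _ _ _).
  move: (G _ _) (G _ _) (G _ _) (G _ _) (I _) (I _) (I _) => g1 g2 g3 g4 i1 i2 i3.
  move: (geom _ _) (geom _ _) (geom _ _) (B _) (t^-1) => ? ? ? ? ? ? ? ? ? ?; lra.
have claimL K : let t := tau * (1 + e) ^+ 2 in
    I (geom e K) - I (geom e 0) - eta / 3 * (geom e K - geom e 0)
    - K%:R * E - 4 * d%:R * B K <=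
    (1 + t^-1) * \sum_(k < K) (G (geom e k.+1) (tau * geom e k.+2)
        - G (geom e k.+1) (tau * geom e k.+3))
    + (G (geom e K) (tau * geom e K.+2) - G (geom e 0) (tau * geom e 2)) :> R.
  cbv zeta; set t := tau * (1 + e) ^+ 2.
  have tt : tau / 4 <= t.
    by have := ler_wpM2l (ltW t0) e2'; rewrite -/t; lra.
  have t'0 : 0 < t by lra.
  elim: K => [|K IH].
    by rewrite big_ord0 /B mass0; lra.
  rewrite big_ord_recr /= [B K.+1]BS.
  have [bK|gK] := boolP (bad e delta K).
    have A1 : 0 <= t^-1 * (G (geom e K.+1) (tau * geom e K.+2)
        - G (geom e K.+1) (tau * geom e K.+3)).
      by rewrite mulr_ge0 ?invr_ge0 ?(ltW t'0).
    have A2 : G (geom e K) (tau * geom e K.+2) <= G (geom e K.+1) (tau * geom e K.+2).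
      by rewrite leG.
    have /andP[_ I1] := @I_bound (geom e K) (geom e K.+1) (geom_ge1 e0 _) (leS _).
    have L0 : 0 <= geom e K.+1 - geom e K by rewrite subr_ge0.
    have L2 : 0 <= d%:R * (geom e K.+1 - geom e K) by rewrite mulr_ge0.
    have L3 : 0 <= eta / 3 * (geom e K.+1 - geom e K) by rewrite mulr_ge0//; lra.
    have E0 : 0 <= E.
      by apply: mulr_ge0 => //; rewrite addr_ge0 ?mulr_ge0 ?invr_ge0 ?(ltW t0).
    rewrite -[K.+1%:R]natr1; move: IH A1 A2 I1 L2 L3; move: (\sum_(k < K) _).
    move: (G _ _) (G _ _) (G _ _) (G _ _) (I _) (I _) (I _) => g1 g2 g3 g4 i1 i2 i3.
    move: (geom _ _) (geom _ _) (geom _ _) => ? ? ?.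
    move: (B _) (t^-1) E0 => ? ? ? ? ? ? ? ? ? ?; lra.
  have := right_step e0 es delta1 (ltn0Sn _) gK.
  move=> /(_ (Num.truncn (12 * d%:R / (tau * eta)))); rewrite -/N -/t /= => h1.
  have h2 := err t _ _ tt (leS K).
  rewrite -[K.+1%:R]natr1 addr0; move: IH h1 h2; move: (\sum_(k < K) _) (corner_error _ _ _ _ _ _).
  move: (G _ _) (G _ _) (G _ _) (G _ _) (I _) (I _) (I _) => g1 g2 g3 g4 i1 i2 i3.
  move: (geom _ _) (geom _ _) (geom _ _) (B _) (t^-1) => ? ? ? ? ? ? ? ? ? ?; lra.
exists (4 * d%:R * `|C1| + C2 + `|I (geom e 0)| + `|I (geom e 2)|
  + `|G (geom e 2) (tau * geom e 0)|) => K.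
have g0 : 0 <= G (geom e 0) (tau * geom e 2).
  by rewrite GE sumr_ge0// => i _; rewrite le_max lexx orbT.
have z0 : 0 < 3 * (eta / 3) by lra.
have z3 : 3 * (eta / 3) = eta by field.
cbv zeta; split.
  have := claimU K; cbv zeta => HU; rewrite -[X in _ + X * _ + _]z3.
  (* Here [t] is at most [tau], and in the lower claim at least [tau], so replacing [t] by [tau] in
     the factor errs on the right side both times. *)
  apply: (upper_tally _ z0 _ HU _ (BE K.+1) (HC2 K)).
  - rewrite ler_wpM2r ?sumr_ge0// lerD2l invf_div ler_pdivlMr// mulVf ?gt_eqF//.
  - by rewrite leG// ler_pM2l// le_geom// ltnW.
  - exact: leS.
  - by rewrite le_geom// ltnW.
  - exact: x_gt0.
have := claimL K; cbv zeta => HL; rewrite -[X in _ - X * _ - _]z3.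
apply: (lower_tally _ _ z0 _ HL _ g0 (BE K) (HC2 K)).
- rewrite ler_wpM2r ?sumr_ge0// lerD2l lef_pV2 ?posrE ?mulr_gt0 ?exprn_gt0 ?addr_gt0//.
  by rewrite ler_peMr// ltW.
- by rewrite leG// ler_pM2l// le_geom// ltnW.
- exact: x_gt0.
Qed.

End staircase.

(** * Hausdorff dimension *)

Section hausdorff_upper.
Variables (R : realType) (X : metricType R).
Local Open Scope ereal_scope.

Lemma diam_pow_ge0 (s : R) (U : set X) : 0 <= diam_pow s U.
Proof. by rewrite /diam_pow; case: ifP => // _; exact: poweR_ge0. Qed.

Lemma diam_pow0 (s : R) : diam_pow s (set0 : set X) = 0.
Proof. by rewrite /diam_pow eqxx. Qed.

Lemma diam_ge0 (U : set X) : U !=set0 -> 0 <= diam U.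
Proof.
move=> [x Ux]; apply: ereal_sup_ubound; exists x => //; exists x => //.
by rewrite mdistxx.
Qed.

Lemma mdist_le_diam (U : set X) x y : U x -> U y -> (mdist x y)%:E <= diam U.
Proof. by move=> Ux Uy; apply: ereal_sup_ubound; exists x => //; exists y. Qed.

Lemma diam_le (U : set X) (r : R) :
  (forall x y, U x -> U y -> (mdist x y <= r)%R) -> diam U <= r%:E.
Proof.
by move=> H; apply: ge_ereal_sup => _ [x Ux [y Uy <-]]; rewrite lee_fin H.
Qed.

Lemma diam_pow_le (s : R) (U : set X) (r : R) : (0 <= s)%R -> (0 <= r)%R ->
  diam U <= r%:E -> diam_pow s U <= (r `^ s)%:E.
Proof.
move=> s0 r0 Ur; rewrite /diam_pow; case: ifPn => [_|U0].
  by rewrite lee_fin powR_ge0.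
have d0 := diam_ge0 ((set0P U).1 U0).
rewrite -poweR_EFin; apply: gt0_ler_poweR => //.
  by rewrite in_itv/= d0 leey.
by rewrite in_itv/= lee_fin r0 leey.
Qed.

Lemma hausdorff_premeasure_ge0 (s delta : R) (E : set X) :
  0 <= hausdorff_premeasure s delta E.
Proof.
apply: le_ereal_inf_tmp => _ [U _ <-]; apply: nneseries_ge0 => k _ _.
exact: diam_pow_ge0.
Qed.

Lemma nneseries_seq (s : R) (r : seq (set X)) :
  \sum_(0 <= k <oo) diam_pow s (nth set0 r k) = \sum_(U <- r) diam_pow s U.
Proof.
rewrite (@nneseries_split _ _ 0 (size r)) ?add0n; last first.
  by move=> k _; exact: diam_pow_ge0.
rewrite eseries0 ?adde0; first by rewrite [RHS](big_nth set0).
by move=> i ri _; rewrite nth_default// diam_pow0.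
Qed.

(** The cover of [E j] gets the budget e / 2 ^ (j + 1), and all covers are merged along a bijection
    with pairs. Padding a finite cover with empty sets is free, as their [diam_pow] is 0 even for s
    = 0. *)
Lemma hausdorff_measure_eq0 (s : R) (D : set X) (E : nat -> set X) :
  D `<=` \bigcup_j E j ->
  (forall j (delta e : R), (0 < delta)%R -> (0 < e)%R -> exists r : seq (set X),
    [/\ forall x, E j x -> exists2 U, List.In U r & U x,
        forall U, List.In U r -> diam U <= delta%:E &
        \sum_(U <- r) diam_pow s U <= e%:E]) ->
  hausdorff_measure s D = 0.
Proof.
move=> DE cov; apply/eqP; rewrite eq_le; apply/andP; split; last first.
  apply: le_trans (hausdorff_premeasure_ge0 s 1 D) _.
  by apply: ereal_sup_ubound; exists 1%R => //; exact: ltr01.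
apply: ge_ereal_sup => _ [delta delta0 <-].
apply/lee_addgt0Pr => e e0; rewrite add0e.
have /choice[r Hr] : forall j, exists r : seq (set X),
    [/\ forall x, E j x -> exists2 U, List.In U r & U x,
        forall U, List.In U r -> diam U <= delta%:E &
        \sum_(U <- r) diam_pow s U <= (e / (2 ^ j.+1)%:R)%:E].
  by move=> j; apply: cov => //; rewrite divr_gt0// ltr0n expn_gt0.
pose B j k := nth set0 (r j) k.
have Bdelta j k : diam (B j k) <= delta%:E.
  have [kr|rk] := ltnP k (size (r j)).
    have [_ + _] := Hr j; apply; rewrite /B.
    elim: (r j) k kr => // U t IH [|k] /=; first by left.
    by rewrite ltnS => /IH; right.
  rewrite /B nth_default//; apply: diam_le => x y [].
have Bcov j x : E j x -> exists k, B j k x.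
  have [+ _ _] := Hr j => /[apply] -[U Ur Ux]; rewrite /B.
  elim: (r j) Ur => //= V t IH [VU|/IH[k Hk]]; first by exists 0%N; rewrite /= VU.
  by exists k.+1.
have /card_esym/ppcard_eqP[f] := card_nat2.
apply: (@le_trans _ _ (\sum_(0 <= k <oo) diam_pow s (uncurry B (f k)))).
  apply: ereal_inf_lbound; exists (fun k => uncurry B (f k)) => //; split.
    move=> x /DE [j _ /Bcov[k Bx]].
    by exists (f^-1%FUN (j, k)) => //=; rewrite invK ?inE.
  by move=> k; case: (f k) => j i; exact: Bdelta.
have B0 u : 0 <= diam_pow s (uncurry B u) by exact: diam_pow_ge0.
rewrite nneseries_esumT; last by move=> k; exact: B0.
rewrite -(@reindex_esum R _ _ setT setT f (fun u => diam_pow s (uncurry B u)))//.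
have -> : [set: nat * nat] = [set: nat] `*`` (fun=> [set: nat]).
  by apply/seteqP; split.
have -> : \esum_(u in [set: nat] `*`` (fun=> [set: nat])) diam_pow s (uncurry B u) =
    \esum_(j in [set: nat]) \esum_(k in [set: nat]) diam_pow s (B j k).
  rewrite (@esum_esum R _ _ setT (fun=> setT) (fun j k => diam_pow s (B j k))).
    by apply: eq_esum => -[j k] _.
  by move=> j k _ _; exact: diam_pow_ge0.
rewrite -nneseries_esumT; last by move=> j; apply: esum_ge0 => k _; exact: diam_pow_ge0.
apply: le_trans (epsilon_trick0 xpredT (ltW e0)).
apply: lee_nneseries => [j _ _|j _]; first by apply: esum_ge0 => k _; exact: diam_pow_ge0.
rewrite -nneseries_esumT; last by move=> k; exact: diam_pow_ge0.
by rewrite nneseries_seq; have [_ _] := Hr j.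
Qed.

Lemma hausdorff_dim_le (s : R) (D : set X) : (0 <= s)%R ->
  hausdorff_measure s D = 0 -> hausdorff_dim D <= s%:E.
Proof. by move=> s0 HD; apply: ereal_inf_lbound; exists s. Qed.

Lemma hausdorff_dim_ge0 (D : set X) : 0 <= hausdorff_dim D.
Proof. by apply: le_ereal_inf_tmp => _ [s [s0 _] <-]; rewrite lee_fin. Qed.

Lemma hausdorff_measure_ge0 (s : R) (D : set X) : 0 <= hausdorff_measure s D.
Proof.
apply: le_trans (hausdorff_premeasure_ge0 s 1 D) _.
by apply: ereal_sup_ubound; exists 1%R => //; exact: ltr01.
Qed.

Lemma diam_pow_preimage (f : X -> X) (s : R) (U : set X) : (0 <= s)%R ->
  (forall x y, (mdist x y <= mdist (f x) (f y))%R) ->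
  diam_pow s (f @^-1` U) <= diam_pow s U /\ diam (f @^-1` U) <= diam U.
Proof.
move=> s0 fd; have dU : diam (f @^-1` U) <= diam U.
  apply: ge_ereal_sup => _ [x Ux [y Uy <-]].
  by apply: le_trans (@mdist_le_diam U _ _ Ux Uy); rewrite lee_fin.
split=> //; rewrite {1}/diam_pow; case: ifPn => [_|/set0P[x Ux]].
  exact: diam_pow_ge0.
have U0 : U !=set0 by exists (f x).
have fU0 : f @^-1` U !=set0 by exists x.
rewrite /diam_pow ifN; last exact/set0P.
by apply: gt0_ler_poweR => //; rewrite in_itv/= leey diam_ge0.
Qed.

(** Pulling a cover back along an expanding map does not increase diameters. The identity gives
    monotonicity, a translation the exact level. *)
Lemma le_hausdorff_dim_expand (f : X -> X) (D E : set X) :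
  (forall x y, (mdist x y <= mdist (f x) (f y))%R) -> D `<=` f @^-1` E ->
  hausdorff_dim D <= hausdorff_dim E.
Proof.
move=> fd DE; apply: ereal_inf_le_tmp => _ [s [s0 HE] <-]; exists s => //; split=> //.
apply/eqP; rewrite eq_le hausdorff_measure_ge0 andbT -HE.
apply: ge_ereal_sup => _ [delta delta0 <-].
apply: (@le_trans _ _ (hausdorff_premeasure s delta E)); last first.
  by apply: ereal_sup_ubound; exists delta.
apply: le_ereal_inf_tmp => _ [U [EU Ud] <-].
apply: le_trans (_ : \sum_(0 <= k <oo) diam_pow s (f @^-1` U k) <= _); last first.
  apply: lee_nneseries => [k _ _|k _]; first exact: diam_pow_ge0.
  by have [] := diam_pow_preimage (U k) s0 fd.
apply: ereal_inf_lbound; exists (fun k => f @^-1` U k) => //; split => [x /DE/EU[k _ Ux]|k].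
  by exists k.
exact: le_trans (diam_pow_preimage (U k) s0 fd).2 (Ud k).
Qed.

Lemma le_hausdorff_dim (D E : set X) : D `<=` E ->
  hausdorff_dim D <= hausdorff_dim E.
Proof. exact: (@le_hausdorff_dim_expand idfun). Qed.

End hausdorff_upper.

(** * A mass distribution principle without measures *)

Section avoidance.
Variables (R : realType) (nb : nat -> nat).
Hypothesis nb_gt0 : forall j, (0 < nb j)%N.

Definition cyl_mass k : R := \prod_(0 <= j < k) (nb j)%:R^-1.

Section greedy.
Variables (k : nat -> nat) (p : nat -> nat -> nat).

(* The conditional mass, inside the cylinder of prefix [s], of the cylinder of
   prefix [p l] and length [k l]. *)
Let term (s : seq nat) l : R :=
  if all (fun j => nth 0%N s j == p l j) (iota 0 (minn (size s) (k l)))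
  then \prod_(size s <= j < k l) (nb j)%:R^-1 else 0.

Let term_ge0 s l : (0 <= term s l)%R.
Proof. by rewrite /term; case: ifP => // _; apply: prodr_ge0. Qed.

Let Phi s := (\sum_(0 <= l <oo) (term s l)%:E)%E.

Let sum_term s l :
  (\sum_(0 <= a < nb (size s)) term (rcons s a) l <= (nb (size s))%:R * term s l)%R.
Proof.
set i := size s.
have agree a m : (m <= i)%N ->
    all (fun j => nth 0%N (rcons s a) j == p l j) (iota 0 m) =
    all (fun j => nth 0%N s j == p l j) (iota 0 m).
  move=> mi; apply: eq_in_all => j; rewrite mem_iota add0n => /andP[_ jm].
  by rewrite nth_rcons (leq_trans jm mi).
have [kl|lk] := leqP (k l) i.
  have tE a : term (rcons s a) l = term s l.
    rewrite /term size_rcons (minn_idPr _) ?(leqW kl)// (minn_idPr _)// agree//.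
    by rewrite !big_geq// leqW.
  by rewrite (eq_bigr (fun=> term s l))// sumr_const_nat subn0 mulr_natl.
pose P : R := \prod_(i.+1 <= j < k l) (nb j)%:R^-1.
have P0 : (0 <= P)%R by apply: prodr_ge0.
have sE : ((nb i)%:R * term s l)%R =
    if all (fun j => nth 0%N s j == p l j) (iota 0 i) then P else 0%R.
  rewrite /term (minn_idPl _) ?(ltnW lk)//; case: ifP => _; last by rewrite mulr0.
  by rewrite big_ltn// mulrA divff ?mul1r// pnatr_eq0 -lt0n.
have tE a : term (rcons s a) l =
    if all (fun j => nth 0%N s j == p l j) (iota 0 i) && (a == p l i) then P else 0%R.
  rewrite /term size_rcons (minn_idPl _)// -addn1 iotaD all_cat agree// /= add0n.
  by rewrite nth_rcons -/i ltnn eqxx andbT addn1.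
rewrite sE (eq_bigr _ (fun a _ => tE a)); case: ifP => _ /=; last first.
  by rewrite big1.
rewrite big_mkord -big_mkcond /=.
have [pn|np] := ltnP (p l i) (nb i).
  rewrite (bigD1 (Ordinal pn)) /= ?eqxx// big1 ?addr0// => a /andP[/eqP ap].
  by move=> /negP h; case: h; apply/eqP/val_inj.
rewrite big1// => a /eqP ap.
by have := ltn_ord a; rewrite ap ltnNge np.
Qed.

Let step s : (Phi s < 1)%E ->
  exists2 a, (a < nb (size s))%N & (Phi (rcons s a) < 1)%E.
Proof.
move=> s1; set n := nb (size s).
have [//|H] := pselect (exists2 a, (a < n)%N & (Phi (rcons s a) < 1)%E).
exfalso; have H1 a : (a < n)%N -> (1 <= Phi (rcons s a))%E.
  by move=> an; rewrite leNgt; apply/negP => h; apply: H; exists a.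
have n0 : (0 < n%:R :> R)%R by rewrite ltr0n nb_gt0.
have : (n%:R%:E < n%:R%:E :> \bar R)%E; last by rewrite ltxx.
apply: (@le_lt_trans _ _ (\sum_(0 <= a < n) Phi (rcons s a))%E).
  rewrite -[n in n%:R]subn0 -sumr_const_nat -sumEFin big_nat [leRHS]big_nat.
  by apply: lee_sum => a /andP[_ an]; exact: H1.
rewrite /Phi -nneseries_sum_nat; last by move=> a l; rewrite lee_fin term_ge0.
apply: (@le_lt_trans _ _ (\sum_(0 <= l <oo) (n%:R%:E * (term s l)%:E))%E).
  apply: lee_nneseries => [l _ _|l _].
    by apply: sume_ge0 => a _; rewrite lee_fin term_ge0.
  by rewrite sumEFin -EFinM lee_fin sum_term.
rewrite nneseriesZl; last by move=> l _; rewrite lee_fin term_ge0.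
by rewrite -[ltRHS]mule1 lte_pmul2l ?lte_fin.
Qed.

(** The method of conditional expectations: the total conditional mass [Phi] of the cylinders,
    averaged over the next letter, does not increase, so some letter keeps it below 1. *)
Lemma avoid_cylinders : (\sum_(0 <= l <oo) (cyl_mass (k l))%:E < 1)%E ->
  exists2 c : nat -> nat, (forall j, (c j < nb j)%N) &
  forall l, exists2 j, (j < k l)%N & c j <> p l j.
Proof.
move=> H; have H0 : (Phi [::] < 1)%E.
  rewrite /Phi (@eq_eseriesr _ _ (fun l => (cyl_mass (k l))%:E))// => l _.
  by rewrite /term /= min0n.
pose next s := if pselect (Phi s < 1)%E is left h then projT1 (cid2 (step h)) else 0%N.
have nextP s : (Phi s < 1)%E ->
    (next s < nb (size s))%N /\ (Phi (rcons s (next s)) < 1)%E.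
  by move=> h; rewrite /next; case: pselect => // h'; case: cid2.
pose path i := iter i (fun s => rcons s (next s)) [::].
have sizeP i : size (path i) = i by elim: i => //= i IH; rewrite size_rcons IH.
have pathP i : (Phi (path i) < 1)%E.
  by elim: i => // i IH; have [_] := nextP _ IH.
pose c i := next (path i).
have nthP i j : (j < i)%N -> nth 0%N (path i) j = c j.
  elim: i => // i IH; rewrite ltnS leq_eqVlt => /predU1P[->|ji] /=.
    by rewrite nth_rcons sizeP ltnn eqxx.
  by rewrite nth_rcons sizeP ji IH.
exists c => [j|l]; first by have [+ _] := nextP _ (pathP j); rewrite sizeP.
have [//|N] := pselect (exists2 j, (j < k l)%N & c j <> p l j).
(* Inside cylinder l the conditional mass of that cylinder would be 1 after [k l] letters, too much
   for [Phi]. *)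
exfalso; have := pathP (k l); apply/negP; rewrite -leNgt.
have t1 : term (path (k l)) l = 1%R.
  rewrite /term sizeP minnn big_geq// ifT//; apply/allP => j.
  rewrite mem_iota add0n => /andP[_ jk]; rewrite nthP//.
  by apply/eqP; have [//|ne] := pselect (c j = p l j); case: N; exists j.
rewrite -[leLHS]/1%:E -t1 /Phi.
apply: le_trans (nneseries_lim_ge l.+1 _) => [|i _ _]; last by rewrite lee_fin term_ge0.
rewrite big_nat_recr//= leeDr// sume_ge0// => i _; by rewrite lee_fin term_ge0.
Qed.

End greedy.

End avoidance.

Section hausdorff_lower.
Variables (R : realType) (X : metricType R) (nb : nat -> nat).
Hypothesis nb_gt0 : forall j, (0 < nb j)%N.
Variables (pt : (nat -> nat) -> X) (rho : nat -> R) (s C : R).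
Let valid (c : nat -> nat) := forall j, (c j < nb j)%N.
Hypothesis s_gt0 : 0 < s.
Hypothesis rho_gt0 : forall j, 0 < rho j.
Hypothesis rho0_le1 : rho 0 <= 1.
Hypothesis rho_anti : forall i j, (i <= j)%N -> rho j <= rho i.
Hypothesis rho_cvg0 : forall e, 0 < e -> exists j, rho j < e.
Hypothesis sep : forall c c' j, valid c -> valid c' ->
  (forall i, (i < j)%N -> c i = c' i) -> c j <> c' j ->
  rho j < mdist (pt c) (pt c').
Hypothesis C_gt0 : 0 < C.
Hypothesis mass_le : forall j, cyl_mass R nb j.+1 <= C * rho j.+1 `^ s.

Lemma mass_small e : 0 < e -> exists k, cyl_mass R nb k <= e.
Proof.
move=> e0; have eC : 0 < (e / C) `^ s^-1 by rewrite powR_gt0// divr_gt0.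
have [j Hj] := rho_cvg0 eC; exists j.+1; apply: le_trans (mass_le j) _.
rewrite mulrC -ler_pdivlMr//.
have rj : rho j.+1 <= (e / C) `^ s^-1 by rewrite (le_trans (rho_anti (leqnSn j)))// ltW.
have := ge0_ler_powR (ltW s_gt0) (ltW (rho_gt0 _)) (ltW eC) rj.
by rewrite -powRrM mulVf ?gt_eqF// powRr1// divr_ge0// ltW.
Qed.

Lemma agree_near (c c' : nat -> nat) k r : valid c -> valid c' ->
  mdist (pt c) (pt c') <= r -> (forall j, (j < k)%N -> r <= rho j) ->
  forall j, (j < k)%N -> c j = c' j.
Proof.
move=> vc vc' dr rk; elim/ltn_ind => j IH jk.
have [//|ne] := pselect (c j = c' j).
have := sep vc vc' (fun i ij => IH i ij (ltn_trans ij jk)) ne.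
by rewrite ltNge (le_trans dr)// rk.
Qed.

(** By separation, a set of small diameter meets the coded points in a single cylinder, whose mass
    is at most C times the power s of the diameter. A cover with too small a sum would thus give
    cylinders of total mass below 1 containing every code. *)
Lemma hausdorff_dim_ge (E : set X) : (forall c, valid c -> E (pt c)) ->
  (s%:E <= hausdorff_dim E)%E.
Proof.
move=> Ept; apply: le_ereal_inf_tmp => _ [s' [s'0 HE] <-].
rewrite lee_fin leNgt; apply/negP => s's.
have prem : (hausdorff_premeasure s' (rho 0) E <= 0)%E.
  by rewrite -HE; apply: ereal_sup_ubound; exists (rho 0) => //; exact: rho_gt0.
have C2 : 0 < (2 * C)^-1 by rewrite invr_gt0 mulr_gt0.
have [U [[EU Ud] Us]] : exists U : (set X)^nat,
    (E `<=` \bigcup_k U k /\ forall k, (diam (U k) <= (rho 0)%:E)%E) /\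
    (\sum_(0 <= k <oo) diam_pow s' (U k) < ((2 * C)^-1)%:E)%E.
  have p0 : hausdorff_premeasure s' (rho 0) E = 0%E.
    by apply/eqP; rewrite eq_le prem hausdorff_premeasure_ge0.
  have [|_ [U HU <-] HUs] := lb_ereal_inf_adherent C2
      (_ : hausdorff_premeasure s' (rho 0) E \is a fin_num).
    by rewrite p0.
  by exists U; split=> //; move: HUs; rewrite -/(hausdorff_premeasure _ _ _) p0 add0e.
(* Half of the mass is reserved for sets of diameter 0 or missing the coded points: each gets a long
   cylinder of mass at most [eps l]. *)
pose eps l : R := 2^-1 / (2 ^ l.+1)%:R.
have eps0 l : 0 < eps l by rewrite divr_gt0// ltr0n expn_gt0.
have H l : exists kp : nat * (nat -> nat),
    (forall c, valid c -> U l (pt c) -> forall j, (j < kp.1)%N -> c j = kp.2 j) /\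
    ((cyl_mass R nb kp.1)%:E <= C%:E * diam_pow s' (U l) + (eps l)%:E)%E.
  have CD : (0 <= C%:E * diam_pow s' (U l))%E.
    by rewrite mule_ge0 ?lee_fin ?(ltW C_gt0)// diam_pow_ge0.
  have [k0 Hk0] := mass_small (eps0 l).
  have Hk0' : ((cyl_mass R nb k0)%:E <= C%:E * diam_pow s' (U l) + (eps l)%:E)%E.
    by rewrite (@le_trans _ _ (eps l)%:E)// ?lee_fin// leeDr.
  have [[c0 [vc0 Uc0]]|nc] := pselect (exists c, valid c /\ U l (pt c)); last first.
    by exists (k0, fun=> 0%N); split => // c vc Uc; case: nc; exists c.
  have D0 : (0 <= diam (U l))%E by apply: diam_ge0; exists (pt c0).
  have Dfin : diam (U l) \is a fin_num.
    by rewrite ge0_fin_numE// (le_lt_trans (Ud l))// ltry.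
  pose r := fine (diam (U l)).
  have rE : diam (U l) = r%:E by rewrite fineK.
  have r0 : 0 <= r by rewrite fine_ge0.
  have dr c : U l (pt c) -> mdist (pt c) (pt c0) <= r.
    by move=> Uc; rewrite -lee_fin -rE; exact: mdist_le_diam.
  move: r0; rewrite le_eqVlt => /predU1P[r0|r0].
    exists (k0, c0); split => //= c vc Uc j jk.
    by apply: (agree_near vc vc0 (dr c Uc) (k := k0)) => // i _; rewrite -r0 ltW.
  (* The first radius below r: the previous one is at least r, so i letters are determined. The case
     i = 0 is excluded by covering with diameters at most [rho 0]. *)
  have [i Hi imin] := ex_minnP (rho_cvg0 r0).
  case: i Hi imin => [|i] Hi imin.
    by have := Ud l; rewrite rE lee_fin leNgt Hi.
  exists (i.+1, c0); split => /= [c vc Uc j ji|].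
    apply: (agree_near vc vc0 (dr c Uc) (k := i.+1)) => // q; rewrite ltnS => qi.
    apply: le_trans (rho_anti qi); rewrite leNgt; apply/negP => h.
    by have := imin i h; rewrite ltnn.
  apply: (@le_trans _ _ (C%:E * diam_pow s' (U l))%E); last first.
    by rewrite leeDl// lee_fin ltW.
  have Un0 : U l != set0 by apply/set0P; exists (pt c0).
  rewrite /diam_pow (negbTE Un0) rE poweR_EFin -EFinM lee_fin.
  apply: le_trans (mass_le i) _; rewrite ler_pM2l//.
  apply: (@le_trans _ _ (rho i.+1 `^ s')).
    apply: ger_powR; last exact: ltW.
    by rewrite rho_gt0/= (le_trans _ rho0_le1)// rho_anti.
  by apply: ge0_ler_powR; rewrite ?nnegrE// ltW.
have /choice[kp Hkp] := H.
have [|c vc Hc] := @avoid_cylinders R nb nb_gt0 (fun l => (kp l).1) (fun l => (kp l).2).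
  apply: (@le_lt_trans _ _
    (\sum_(0 <= l <oo) (C%:E * diam_pow s' (U l) + (eps l)%:E))%E).
    apply: lee_nneseries => [l _ _|l _]; last by have [] := Hkp l.
    by rewrite lee_fin; apply: prodr_ge0.
  have Cd l : (0 <= C%:E * diam_pow s' (U l))%E.
    by rewrite mule_ge0 ?lee_fin ?(ltW C_gt0)// diam_pow_ge0.
  rewrite (@nneseriesD _ (fun l => C%:E * diam_pow s' (U l))%E (fun l => (eps l)%:E) xpredT 0); last 2 first.
  - by move=> l _ _; exact: Cd.
  - by move=> l _ _; rewrite lee_fin ltW.
  rewrite nneseriesZl; last by move=> l _; exact: diam_pow_ge0.
  apply: (@le_lt_trans _ _ (C%:E * \sum_(0 <= l <oo) diam_pow s' (U l) + (2^-1)%:E)%E).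
    by apply: leeD => //; apply: epsilon_trick0.
  have -> : (1 = C%:E * ((2 * C)^-1)%:E + (2^-1)%:E :> \bar R)%E.
    by rewrite -EFinM -EFinD; congr EFin; field; rewrite gt_eqF.
  by rewrite lteD2rE// lte_pmul2l ?lte_fin.
have [l _ Ul] := EU _ (Ept c vc).
have [+ _] := Hkp l => /(_ c vc Ul) Hl.
by have [j jk] := Hc l; rewrite Hl.
Qed.

End hausdorff_lower.

(** * Uniformly approximable points *)

Lemma intmxB (R : realType) k l (M N : 'M[int]_(k, l)) :
  intmx (M - N) = intmx M - intmx N :> 'M[R]_(k, l).
Proof. exact: raddfB. Qed.

Lemma intmxD (R : realType) k l (M N : 'M[int]_(k, l)) :
  intmx (M + N) = intmx M + intmx N :> 'M[R]_(k, l).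
Proof. exact: raddfD. Qed.

Section upper_bound.
Variables (R : realType) (m n : nat) (A : 'M[R]_(m, n)).
Hypotheses (m_gt0 : (0 < m)%N) (n_gt0 : (0 < n)%N).
Local Notation d := (m + n)%N.
Local Notation box := (box A).
Local Notation lat := (lat A).
Local Notation Gam := (Gam A).
Local Notation npt := (npt A).

Lemma lat_up (p : 'cV[int]_m) (q : 'cV[int]_n) i :
  lat (col_mx p q) (lshift n i) 0 = (A *m intmx q + intmx p) i 0.
Proof.
rewrite /lat /intmx map_col_mx /u_A mul_block_col mul1mx mul0mx add0r.
by rewrite col_mxEu addrC.
Qed.

Lemma lat_down (p : 'cV[int]_m) (q : 'cV[int]_n) i :
  lat (col_mx p q) (rshift m i) 0 = (intmx q : 'cV[R]_n) i 0.
Proof.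
rewrite /lat /intmx map_col_mx /u_A mul_block_col mul1mx mul0mx add0r.
by rewrite col_mxEd mul1mx.
Qed.

Lemma box_normP (p : 'cV[int]_m) (q : 'cV[int]_n) (x y c : R) : 0 < c ->
  box (x + ln c) (y - ln c) (col_mx p q) <->
  `|A *m intmx q + intmx p| < c * expR (- y) /\
  `|intmx q : 'cV[R]_n| < c * expR x.
Proof.
move=> c0; split=> [H|[/cV_normP H1 /cV_normP H2] i].
  split; apply/cV_normP; rewrite ?mulr_gt0 ?expR_gt0// => i.
    by have := H (lshift n i); rewrite lat_up sideD// /side /= ltn_ord.
  by have := H (rshift m i); rewrite lat_down sideD// /side /= ltnNge leq_addr.
rewrite sideD// /side; case: (splitP i) => j ij.
  have -> : i = lshift n j by exact/val_inj.
  by rewrite lat_up H1// mulr_gt0 ?expR_gt0.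
have -> : i = rshift m j by exact/val_inj.
by rewrite lat_down H2// mulr_gt0 ?expR_gt0.
Qed.

Lemma boxN x y z : box x y z -> box x y (- z).
Proof. by move=> bz p; rewrite -[- z]sub0r latB lat0 sub0r mxE normrN. Qed.

(* The centres used at one scale are refined to the next one by a maximal
   separated subset of the admissible differences. *)
Lemma refine_centre (x' y y' : R) (q : 'cV[int]_n) : y <= y' ->
  `|intmx q : 'cV[R]_n| <= expR x' ->
  exists r : seq 'cV[int]_n,
  [/\ (size r)%:R <= expR (npt (x' + ln 6) (y - ln 6) - npt x' y'),
    forall q', q' \in r -> `|intmx q' : 'cV[R]_n| <= expR x' &
    forall (u : 'cV[R]_m) p p'' q'',
      `|A *m intmx q - intmx p - u| <= 3 * expR (- y) ->
      `|A *m intmx q'' - intmx p'' - u| <= expR (- y') ->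
      `|intmx q'' : 'cV[R]_n| <= expR x' ->
      exists2 q', q' \in r & exists p', `|A *m intmx q' - intmx p' - u| <= 3 * expR (- y')].
Proof.
move=> yy qx.
(* The differences to the old centre are below 3 + 1 < 5 times the larger sides. Translates of the
   small box by elements separated at factor 2 are disjoint and fit in the box dilated by 6. A new
   centre has error at most 1 + 2 = 3 times e ^ - y', so the factor 3 reproduces itself. *)
pose T := [fset w in bx A (x' + ln 5) (y - ln 5) |
  `|intmx (q + dsubmx w) : 'cV[R]_n| <= expR x']%fset.
pose e (w w' : 'cV[int]_d) := (w - w') \in bx A (x' + ln 2) (y' - ln 2).
have er : reflexive e.
  by move=> w; rewrite /e subrr; apply/bxP; exact: box0.
have es : symmetric e.
  by move=> w w'; apply/idP/idP => /bxP/boxN; rewrite opprB => /bxP.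
have [W [WT Wsep Wcov]] := maximal_separated T er es.
have WTP w : w \in W -> box (x' + ln 5) (y - ln 5) w /\
    `|intmx (q + dsubmx w) : 'cV[R]_n| <= expR x'.
  by move=> /WT; rewrite !inE => /andP[/bxP].
have yy' : expR (- y') <= expR (- y) by rewrite ler_expR lerN2.
exists [seq q + dsubmx w | w <- W]; split.
- rewrite size_map expRB !expR_npt ler_pdivlMr ?ltr0n ?card_bx_gt0//.
  rewrite -natrM ler_nat.
  apply: leq_trans (leq_card_sums (C := bx A (x' + ln 6) (y - ln 6))
    (D := [fset (0 : 'cV[int]_d)]%fset) _ _) _; last by rewrite cardfs1 muln1.
    move=> w b /WTP[bw _] /bxP bb.
    apply/bxP => i; rewrite sideD// latD mxE (le_lt_trans (ler_normD _ _))//.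
    have := bw i; have := bb i; rewrite sideD//.
    have := le_side i (lexx x') yy; lra.
  move=> w w' b b' wW w'W /bxP bb /bxP bb' E.
  rewrite inE subr_eq0; apply/eqP/Wsep => //; apply/bxP.
  have -> : w - w' = b' - b.
    by apply/eqP; rewrite subr_eq addrAC eq_sym subr_eq E addrC.
  move=> i; rewrite sideD// latB mxE [X in `|_ + X|]mxE (le_lt_trans (ler_normB _ _))//.
  by have := bb i; have := bb' i; lra.
- by move=> _ /mapP[w /WTP[_ +] ->].
move=> u p p'' q'' h1 h2 h3.
pose w := col_mx (p - p'') (q'' - q).
have wup : A *m intmx (q'' - q) + intmx (p - p'') =
    (A *m intmx q'' - intmx p'' - u) - (A *m intmx q - intmx p - u).
  rewrite !intmxB mulmxBr.
  by apply/matrixP => i j; rewrite !mxE; ring.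
have wT : w \in T.
  rewrite !inE; apply/andP; split; last by rewrite /w col_mxKd addrC subrK.
  apply/bxP/box_normP => //; split.
    rewrite wup (le_lt_trans (ler_normB _ _))//.
    by have := expR_gt0 (- y); lra.
  rewrite intmxB (le_lt_trans (ler_normB _ _))//.
  by have := expR_gt0 x'; lra.
have [w' w'W ww'] := Wcov _ wT.
exists (q + dsubmx w'); first by apply/mapP; exists w'.
exists (p - usubmx w').
move: ww' => /bxP; rewrite -[w']vsubmxK /w opp_col_mx add_col_mx.
move=> /box_normP[//|ww' _].
have -> : A *m intmx (q + dsubmx (col_mx (usubmx w') (dsubmx w'))) -
    intmx (p - usubmx (col_mx (usubmx w') (dsubmx w'))) - u =
   (A *m intmx q'' - intmx p'' - u) -
   (A *m intmx (q'' - q - dsubmx w') + intmx (p - p'' - usubmx w')).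
  rewrite !vsubmxK !(intmxB, intmxD) !(mulmxBr, mulmxDr).
  by apply/matrixP => i j; rewrite !mxE; ring.
by rewrite (le_trans (ler_normB _ _))//; lra.
Qed.

Lemma initial_centres (x : R) : exists r : seq 'cV[int]_n,
  forall q, (q \in r) = (`|intmx q : 'cV[R]_n| <= expR x).
Proof.
exists [seq q <- [seq dsubmx z | z <- bx A (x + ln 2) (0 - ln 2)] |
  `|intmx q : 'cV[R]_n| <= expR x] => q.
rewrite mem_filter; apply/andP/idP => [[]//|qx]; split => //.
pose p : 'cV[int]_m := \col_i (- Num.floor ((A *m intmx q) i 0)).
apply/mapP; exists (col_mx p q); last by rewrite col_mxKd.
apply/bxP/box_normP => //; split; last by have := expR_gt0 x; lra.
apply/cV_normP; rewrite ?mulr_gt0 ?expR_gt0// => i.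
rewrite oppr0 expR0 mulr1 !mxE rmorphN /=.
have /andP[] := real_floor_itv (num_real ((A *m intmx q) i 0)).
rewrite intrD !mxE => h1 h2; rewrite ltr_norml; apply/andP; split; lra.
Qed.

Variables (X Y : nat -> R).
Hypothesis leX : forall k, X k <= X k.+1.
Hypothesis leY : forall k, Y k <= Y k.+1.

Definition eventual_set k0 : set (torus R m) := [set b | forall k, (k0 <= k)%N ->
  exists (p : 'cV[int]_m) (q : 'cV[int]_n),
   `|A *m intmx q - intmx p - repr b| <= expR (- Y k) /\
   `|intmx q : 'cV[R]_n| <= expR (X k)].

(** Two passages between [Gam] and [npt], and one dilation by 6. *)
Definition upper_cst : R := 2 * (count_cst R m n + d%:R * ln 6).

Lemma eventual_cover k0 : exists2 N0 : R, 0 < N0 & forall K, (k0 <= K)%N ->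
  exists r : seq 'cV[int]_n,
  [/\ (size r)%:R <= N0 * expR (\sum_(k0 <= k < K)
       (Gam (X k.+1) (Y k) - Gam (X k.+1) (Y k.+1) + upper_cst)),
    forall q, q \in r -> `|intmx q : 'cV[R]_n| <= expR (X K) &
    forall b, eventual_set k0 b -> exists2 q, q \in r &
      exists p, `|A *m intmx q - intmx p - repr b| <= 3 * expR (- Y K)].
Proof.
have [r0 r0P] := initial_centres (X k0).
exists ((size r0)%:R + 1) => [|K]; first by rewrite ltr_pwDr.
move=> /subnKC <-; elim: (K - k0)%N => [|j [r [rs rq rb]]].
  exists r0; rewrite addn0 big_geq// expR0 mulr1 lerDl; split => //.
    by move=> q; rewrite r0P.
  move=> b /(_ k0 (leqnn _))[p [q [h1 h2]]]; exists q; first by rewrite r0P.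
  by exists p; apply: le_trans h1 _; have := expR_gt0 (- Y k0); lra.
rewrite addnS; set K' := (k0 + j)%N in rs rq rb *.
have /choice[f Hf] : forall q : 'cV[int]_n, exists r' : seq 'cV[int]_n,
    q \in r -> [/\ (size r')%:R <= expR (npt (X K'.+1 + ln 6) (Y K' - ln 6) - npt (X K'.+1) (Y K'.+1)),
    forall q', q' \in r' -> `|intmx q' : 'cV[R]_n| <= expR (X K'.+1) &
    forall (u : 'cV[R]_m) p p'' q'',
      `|A *m intmx q - intmx p - u| <= 3 * expR (- Y K') ->
      `|A *m intmx q'' - intmx p'' - u| <= expR (- Y K'.+1) ->
      `|intmx q'' : 'cV[R]_n| <= expR (X K'.+1) ->
      exists2 q', q' \in r' & exists p', `|A *m intmx q' - intmx p' - u| <= 3 * expR (- Y K'.+1)].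
  move=> q; have [qr|] := boolP (q \in r); last by exists [::].
  have qx : `|intmx q : 'cV[R]_n| <= expR (X K'.+1).
    by rewrite (le_trans (rq q qr))// ler_expR.
  by have [r' Hr'] := refine_centre (leY K') qx; exists r'.
exists (flatten [seq f q | q <- r]); split.
- rewrite size_flatten /shape -map_comp sumnE big_map natr_sum.
  rewrite big_nat_recr ?leq_addr//= expRD mulrA.
  apply: (@le_trans _ _ ((size r)%:R * expR (Gam (X K'.+1) (Y K') - Gam (X K'.+1) (Y K'.+1) + upper_cst))).
    set c := expR _.
    have -> : (size r)%:R * c = \sum_(q <- r) c.
      by rewrite big_const_seq count_predT iter_addr_0 mulr_natl.
    rewrite big_seq [leRHS]big_seq; apply: ler_sum => q qr.
    have [+ _ _] := Hf q qr => /le_trans; apply; rewrite ler_expR.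
    have l6 : 0 <= ln 6 :> R by rewrite ln_ge0// ler1n.
    have [h1 _] := Gam_npt A m_gt0 n_gt0 (X K'.+1) (Y K'.+1).
    have [_ h2] := Gam_npt A m_gt0 n_gt0 (X K'.+1 + ln 6) (Y K' - ln 6).
    have h3 := Gam_shift A m_gt0 n_gt0 (X K'.+1) (Y K') l6.
    move: h1 h2 h3; rewrite /upper_cst.
    move: (npt _ _) (npt _ _) (Gam _ _) (Gam _ _) (Gam _ _) (count_cst _ _ _).
    by move: (d%:R * _) => *; lra.
  by rewrite ler_wpM2r// expR_ge0.
- by move=> q' /flattenP[_ /mapP[q qr ->]]; have [_ + _] := Hf q qr; apply.
- move=> b Eb; have [q qr [p hp]] := rb b Eb.
  have [p'' [q'' [h1 h2]]] := Eb K'.+1 (leqW (leq_addr _ _)).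
  have [_ _ H] := Hf q qr; have [q' q'f Hq'] := H _ _ _ _ hp h1 h2.
  by exists q' => //; apply/flattenP; exists (f q) => //; apply/mapP; exists q.
Qed.

Lemma torus_dist_lift_le (a b : torus R m) (p p' : 'cV[int]_m) :
  torus_dist a b <= `|(repr a + intmx p) - (repr b + intmx p')|.
Proof. by apply: torus_dist_le; apply: lifts_add; exact: lifts_repr. Qed.

(** All sets of a cover share one diameter bound, so it is enough that the estimate holds for
    arbitrarily large [K]; this is where a lower limit enters. *)
Lemma hausdorff_dim_eventual_le (s : R) (D : set (torus R m)) : 0 <= s ->
  D `<=` \bigcup_k eventual_set k ->
  (forall B : R, exists k, B <= Y k) ->
  (forall (B : R) k0, exists2 K, (k0 <= K)%N &
    \sum_(0 <= k < K) (Gam (X k.+1) (Y k) - Gam (X k.+1) (Y k.+1) + upper_cst)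
      <= s * Y K - B) ->
  (hausdorff_dim D <= s%:E)%E.
Proof.
move=> s0 DE Yoo sum_le; apply: hausdorff_dim_le => //.
apply: hausdorff_measure_eq0 DE _ => k0 delta e delta0 e0.
have [N0 N00 HN] := eventual_cover k0.
have Ymono i j : (i <= j)%N -> Y i <= Y j.
  by move=> /subnKC <-; elim: (j - i)%N => [|k IH]; rewrite ?addn0// addnS (le_trans IH).
have [k1 Hk1] := Yoo (- ln (delta / 6)).
have [K kK HK] := sum_le (ln N0 + s * ln 6 - ln e) (maxn k0 k1).
have [r [rs rq rb]] := HN K (leq_trans (leq_maxl _ _) kK).
pose U q : set (torus R m) :=
  [set b | exists p, `|A *m intmx q - intmx p - repr b| <= 3 * expR (- Y K)].
have dU q : (diam (U q) <= (6 * expR (- Y K))%:E)%E.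
  apply: diam_le => a b [p hp] [p' hp'].
  apply: le_trans (torus_dist_lift_le a b p p') _.
  have -> : repr a + intmx p - (repr b + intmx p') =
     (A *m intmx q - intmx p' - repr b) - (A *m intmx q - intmx p - repr a).
    by apply/matrixP => i j; rewrite !mxE; ring.
  by rewrite (le_trans (ler_normB _ _))//; lra.
have e6 : 6 * expR (- Y K) <= delta.
  have : expR (- Y K) <= delta / 6.
    rewrite -[leRHS]lnK ?posrE ?divr_gt0// ler_expR lerNl (le_trans Hk1)// Ymono//.
    by rewrite (leq_trans _ kK)// leq_maxr.
  by lra.
exists [seq U q | q <- r]; split.
- move=> b /rb[q qr hb]; exists (U q) => //.
  elim: r {rs rq rb} qr => // q' r IH; rewrite inE => /predU1P[->|/IH]; first by left.
  by right.
- move=> V VU; have [q ->] : exists q, V = U q.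
    elim: r VU {rs rq rb} => //= q' r IH [<-|/IH//]; by exists q'.
  by apply: le_trans (dU q) _; rewrite lee_fin.
rewrite big_map.
apply: (@le_trans _ _ (\sum_(q <- r) ((6 * expR (- Y K)) `^ s)%:E)%E).
  apply: lee_sum => q _; have r0 : 0 <= 6 * expR (- Y K) by rewrite mulr_ge0 ?expR_ge0.
  exact: diam_pow_le s0 r0 (dU q).
rewrite sumEFin lee_fin big_const_seq count_predT iter_addr_0 -[_ *+ size r]mulr_natl.
have -> : (6 * expR (- Y K)) `^ s = expR (s * (ln 6 - Y K)).
  rewrite /powR gt_eqF ?mulr_gt0 ?expR_gt0// lnM ?posrE ?expR_gt0//.
  by rewrite expRK.
apply: le_trans (ler_wpM2r (expR_ge0 _) rs) _.
rewrite -mulrA -expRD -[X in X * _]lnK ?posrE// -expRD -[leRHS]lnK ?posrE//.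
rewrite ler_expR.
have : \sum_(k0 <= k < K) (Gam (X k.+1) (Y k) - Gam (X k.+1) (Y k.+1) + upper_cst)
    <= \sum_(0 <= k < K) (Gam (X k.+1) (Y k) - Gam (X k.+1) (Y k.+1) + upper_cst).
  rewrite (@big_cat_nat _ _ _ k0 0 K)//=; last by rewrite (leq_trans _ kK)// leq_maxl.
  rewrite lerDr sumr_ge0// => k _; rewrite addr_ge0 ?subr_ge0 ?le_Gam//.
  by rewrite mulr_ge0// addr_ge0 ?count_cst_ge0// mulr_ge0// ln_ge0// ler1n.
move: HK; move: (\sum_(_ <= _ < _) _) (\sum_(_ <= _ < _) _) => S1 S2.
move: (ln N0) (ln e) (ln 6) (Y K) => *; lra.
Qed.

End upper_bound.

Section lower_bound.
Variables (R : realType) (m n : nat) (A : 'M[R]_(m, n)).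
Hypotheses (m_gt0 : (0 < m)%N) (n_gt0 : (0 < n)%N).
Local Notation d := (m + n)%N.
Local Notation box := (box A).
Local Notation lat := (lat A).
Local Notation Gam := (Gam A).
Local Notation npt := (npt A).
Variables (X Y : nat -> R).
Hypothesis stepX : forall k, X k + ln 2 <= X k.+1.
Hypothesis stepY : forall k, Y k + ln 2 <= Y k.+1.
Hypothesis Y0_ge : ln 8 <= Y 0.

Let T k := expR (X k).
Let rho k := expR (- Y k).
Let T_gt0 k : 0 < T k. Proof. exact: expR_gt0. Qed.
Let rho_gt0 k : 0 < rho k. Proof. exact: expR_gt0. Qed.

Let T2 k : 2 * T k <= T k.+1.
Proof. by rewrite /T -[X in X * _]lnK ?posrE// -expRD ler_expR addrC. Qed.

Let rho2 k : 2 * rho k.+1 <= rho k.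
Proof.
rewrite /rho -[X in X * _]lnK ?posrE// -expRD ler_expR.
by have := stepY k; lra.
Qed.

Let rho0 : rho 0 <= 8^-1.
Proof. by rewrite /rho expRN lef_pV2 ?posrE ?expR_gt0// -[leLHS]lnK ?posrE// ler_expR. Qed.

Let le_rho i j : (i <= j)%N -> rho j <= rho i.
Proof.
move=> /subnKC <-; elim: (j - i)%N => [|k IH]; rewrite ?addn0// addnS.
by apply: le_trans IH; have := rho2 (i + k); have := rho_gt0 (i + k).+1; lra.
Qed.

Definition lower_cst : R := 2 * (count_cst R m n + d%:R * ln 4 + d%:R * ln 5).

(** Separation concerns only the first m coordinates, those visible on the torus. Points of the
    quarter box attached to one element of [W] differ from it by points of 5 times the box (x', y'),
    which bounds [W] from below. *)
Lemma separated_steps (x' y y' : R) : exists W : {fset 'cV[int]_d},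
  [/\ (0 < #|` W|)%N,
    forall w, w \in W -> box (x' - ln 4) (y + ln 4) w,
    forall w w', w \in W -> w' \in W -> w <> w' -> exists i,
      4 * expR (- y') < `|(lat w - lat w') (lshift n i) 0| &
    Gam x' y - Gam x' y' - lower_cst <= ln #|` W|%:R].
Proof.
pose e (w w' : 'cV[int]_d) :=
  [forall i : 'I_m, `|(lat w - lat w') (lshift n i) 0| <= 4 * expR (- y')].
have er : reflexive e.
  by move=> w; apply/forallP => i; rewrite subrr mxE normr0 mulr_ge0 ?expR_ge0.
have es : symmetric e.
  move=> w w'; apply: eq_forallb => i; congr (_ <= _).
  by rewrite mxE [X in `|_ + X|]mxE distrC [in RHS]mxE [X in _ = `|_ + X|]mxE.
have [W [WT Wsep Wcov]] := maximal_separated (bx A (x' - ln 4) (y + ln 4)) er es.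
have WP w : w \in W -> box (x' - ln 4) (y + ln 4) w by move=> /WT/bxP.
have W0 : (0 < #|` W|)%N.
  have [|w wW _] := Wcov 0; first by apply/bxP; exact: box0.
  by rewrite cardfs_gt0; apply/fset0Pn; exists w.
exists W; split => // [w w' wW w'W ww'|].
  have : ~~ e w w' by apply/negP => /(Wsep _ _ wW w'W).
  by rewrite negb_forall => /existsP[i]; rewrite -ltNge; exists i.
have /choice[f Hf] : forall s, exists w, s \in bx A (x' - ln 4) (y + ln 4) ->
    w \in W /\ e s w.
  move=> s; have [sT|] := boolP (s \in bx A (x' - ln 4) (y + ln 4)); last by exists 0.
  by have [w wW esw] := Wcov _ sT; exists w.
have card_le : (#|` bx A (x' - ln 4) (y + ln 4)| <=
    #|` W| * #|` bx A (x' + ln 5) (y' - ln 5)|)%N.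
  apply: (@leq_card_fibers _ _ _ _ f) => [s /Hf[]//|w wW].
  apply: (@leq_card_inj _ _ _ _ (fun s => s - w)) => [s|s s' _ _ /addIr//].
  rewrite !inE => /andP[sT /eqP fs]; have [_ +] := Hf _ sT; rewrite fs => /forallP esw.
  move: sT => /bxP bs; have bw := WP _ wW.
  have x1 : - ln 4 = ln 4^-1 :> R by rewrite lnV ?posrE.
  have y1 : ln 4 = - ln 4^-1 :> R by rewrite lnV ?posrE// opprK.
  apply/bxP => p; rewrite sideD// latB.
  move: (bs p) (bw p); rewrite [in y + _]y1 x1 sideD ?invr_gt0// => h1 h2.
  have [pm|pm] := ltnP p m.
    have -> : p = lshift n (Ordinal pm) by exact/val_inj.
    rewrite /side /= pm; apply: le_lt_trans (esw _) _.
    by have := expR_gt0 (- y'); lra.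
  rewrite mxE [X in `|_ + X|]mxE (le_lt_trans (ler_normB _ _))//.
  move: h1 h2; rewrite /side ltnNge pm /=.
  by have := expR_gt0 x'; lra.
have {}card_le : npt (x' - ln 4) (y + ln 4) <= ln #|` W|%:R + npt (x' + ln 5) (y' - ln 5).
  rewrite -ler_expR expRD !expR_npt lnK ?posrE ?ltr0n//.
  by rewrite -natrM ler_nat.
have l4 : 0 <= ln 4 :> R by rewrite ln_ge0// ler1n.
have l5 : 0 <= ln 5 :> R by rewrite ln_ge0// ler1n.
have [h1 _] := Gam_npt A m_gt0 n_gt0 (x' - ln 4) (y + ln 4).
have [_ h2] := Gam_npt A m_gt0 n_gt0 (x' + ln 5) (y' - ln 5).
have h3 := Gam_shift A m_gt0 n_gt0 x' y' l5.
have := Gam_shift A m_gt0 n_gt0 (x' - ln 4) (y + ln 4) l4.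
rewrite subrK addrK.
move: card_le h1 h2 h3; rewrite /lower_cst.
move: (npt _ _) (npt _ _) (Gam _ _) (Gam _ _) (Gam _ _) (Gam _ _) (count_cst _ _ _).
by move: (d%:R * ln 4) (d%:R * ln 5) (ln _) => *; lra.
Qed.

Let W k : {fset 'cV[int]_d} :=
  projT1 (cid (separated_steps (X k.+1) (Y k) (Y k.+1))).
Let WP k := projT2 (cid (separated_steps (X k.+1) (Y k) (Y k.+1))).
Let nb k := #|` W k|.
Let w k a : 'cV[int]_d := nth 0 (W k) a.
Let valid (c : nat -> nat) := forall j, (c j < nb j)%N.

Let nb_gt0 k : (0 < nb k)%N. Proof. by have [] := WP k. Qed.

Let w_box k a : (a < nb k)%N -> box (X k.+1 - ln 4) (Y k + ln 4) (w k a).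
Proof. by move=> ak; have [_ H _ _] := WP k; apply: H; exact: mem_nth. Qed.

Let w_up k a i : (a < nb k)%N -> `|lat (w k a) (lshift n i) 0| < rho k / 4.
Proof.
move=> /w_box/(_ (lshift n i)); rewrite /side /= ltn_ord opprD expRD expRN [X in _ * X]expRN.
by rewrite lnK ?posrE// -expRN.
Qed.

Let w_down k a i : (a < nb k)%N -> `|lat (w k a) (rshift m i) 0| < T k.+1 / 4.
Proof.
move=> /w_box/(_ (rshift m i)); rewrite /side /= ltnNge leq_addr /= expRD expRN.
by rewrite lnK ?posrE.
Qed.

(** Steps stay within a quarter of the sides. As [T] at least doubles and [rho] at least halves, the
    partial sums have height at most [T k / 2] and the remaining steps move the centre by at most
    [rho k / 2]. *)
Let z c k : 'cV[int]_d := \sum_(0 <= j < k) w j (c j).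
Let zS c k : z c k.+1 = z c k + w k (c k).
Proof. by rewrite /z big_nat_recr. Qed.

Let z_down c k i : valid c -> `|lat (z c k) (rshift m i) 0| <= T k / 2.
Proof.
move=> vc; elim: k => [|k IH].
  by rewrite /z big_geq// lat0 mxE normr0 divr_ge0// ltW.
rewrite zS latD mxE (le_trans (ler_normD _ _))//.
by have := w_down i (vc k); have := T2 k; lra.
Qed.

Let cen c k i : R := lat (z c k) (lshift n i) 0.

Let cenS c k i : valid c -> `|cen c k.+1 i - cen c k i| <= rho k / 4.
Proof.
move=> vc; rewrite /cen zS latD [X in `|X - _|]mxE. rewrite -[X in X - _]addrC addrK ltW// w_up//.
Qed.

(** The common point of nested intervals, obtained as the supremum of their left ends. *)
Let lim c i : R := sup [set cen c k i - rho k / 2 | k in [set: nat]].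

Let lim_cen c k i : valid c -> `|lim c i - cen c k i| <= rho k / 2.
Proof.
move=> vc; pose a l := cen c l i - rho l / 2; pose b l := cen c l i + rho l / 2.
have aS l : a l <= a l.+1.
  have := cenS l i vc; rewrite ler_norml /a => /andP[? ?].
  by have := rho2 l; lra.
have bS l : b l.+1 <= b l.
  have := cenS l i vc; rewrite ler_norml /b => /andP[? ?].
  by have := rho2 l; lra.
have amono l l' : (l <= l')%N -> a l <= a l'.
  by move=> /subnKC <-; elim: (l' - l)%N => [|j IH]; rewrite ?addn0// addnS (le_trans IH).
have bmono l l' : (l <= l')%N -> b l' <= b l.
  by move=> /subnKC <-; elim: (l' - l)%N => [|j IH]; rewrite ?addn0// addnS (le_trans _ IH).
have ab l l' : a l <= b l'.
  have := amono _ _ (leq_maxl l l'); have := bmono _ _ (leq_maxr l l').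
  by have := rho_gt0 (maxn l l'); rewrite /a /b; lra.
have ubb l : ubound [set cen c k i - rho k / 2 | k in [set: nat]] (b l).
  by move=> _ [l' _ <-]; exact: ab.
have la : a k <= lim c i.
  by apply: ub_le_sup; [exists (b 0%N); exact: ubb|exists k].
have lb : lim c i <= b k by apply: ge_sup; [exists (a 0%N), 0%N|exact: ubb].
by rewrite ler_norml; move: la lb; rewrite /a /b; lra.
Qed.

Let pt c : torus R m := \pi_(torus R m)%qT (\col_i lim c i).

Let pt_lift c : lifts (pt c) (\col_i lim c i). Proof. by []. Qed.

Let pt_eventual c : valid c -> eventual_set A X Y 0 (pt c).
Proof.
move=> vc k _.
have [p hp] := lifts_eq (lifts_repr (pt c)) (pt_lift c).
(* [lat] adds the integer vector that approximations subtract, and [p] corrects for the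
   representative chosen on the torus. *)
exists (- usubmx (z c k) - p), (dsubmx (z c k)).
have zE : z c k = col_mx (usubmx (z c k)) (dsubmx (z c k)) by rewrite vsubmxK.
split; last first.
  apply/cV_norm_leP; first exact: expR_ge0.
  move=> i; rewrite -(lat_down A (usubmx (z c k))) -zE.
  by apply: le_trans (z_down k i vc) _; have := T_gt0 k; rewrite /T; lra.
apply/cV_norm_leP; first exact: expR_ge0.
move=> i.
have -> : (A *m intmx (dsubmx (z c k)) - intmx (- usubmx (z c k) - p) - repr (pt c)) i 0
    = cen c k i - lim c i.
  have -> : repr (pt c) = \col_i lim c i + intmx p by rewrite -hp addrC subrK.
  rewrite /cen [in RHS]zE lat_up !mxE rmorphB rmorphN /=; ring.
rewrite distrC (le_trans (lim_cen k i vc))//.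
by have := rho_gt0 k; rewrite /rho; lra.
Qed.

Let pt_sep c c' j : valid c -> valid c' ->
  (forall i, (i < j)%N -> c i = c' i) -> c j <> c' j ->
  2 * rho j.+1 < mdist (pt c) (pt c').
Proof.
move=> vc vc' cc ne; rewrite ltNge; apply/negP => dle.
have zz : z c j = z c' j.
  by rewrite /z; apply: eq_big_nat => i /andP[_ ij]; rewrite cc.
have ww : w j (c j) <> w j (c' j).
  by move=> /eqP; rewrite nth_uniq ?fset_uniq// => /eqP.
have [_ _ H _] := WP j.
have [i Hi] := H _ _ (mem_nth _ (vc j)) (mem_nth _ (vc' j)) ww.
have far : 3 * rho j.+1 < `|lim c i - lim c' i|.
  have h1 := lim_cen j.+1 i vc; have h2 := lim_cen j.+1 i vc'.
  have h3 : 4 * rho j.+1 < `|cen c j.+1 i - cen c' j.+1 i|.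
    apply: lt_le_trans Hi _; rewrite /cen !zS zz !latD.
    rewrite mxE [X in `|_ + X|]mxE [X in _ <= `|X - _|]mxE [X in _ <= `|_ - X|]mxE.
    by rewrite opprD addrACA subrr add0r.
  have := ler_normD (cen c j.+1 i - lim c i) (lim c i - cen c' j.+1 i).
  have := ler_normD (lim c i - lim c' i) (lim c' i - cen c' j.+1 i).
  rewrite !subrKA (distrC (cen c _ _) (lim c _)); lra.
have [|u [v [Lu Lv uv]]] := @torus_dist_lt _ _ (pt c) (pt c') (3 * rho j.+1).
  by apply: le_lt_trans dle _; have := rho_gt0 j.+1; lra.
have [p hp] := lifts_eq Lu (pt_lift c); have [p' hp'] := lifts_eq Lv (pt_lift c').
have uvi : `|(lim c i - lim c' i) + (p i 0 - p' i 0)%:~R| < 3 * rho j.+1.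
  apply: le_lt_trans uv.
  have -> : u - v = (\col_i lim c i - \col_i lim c' i) + (intmx p - intmx p').
    by rewrite -hp -hp'; apply/matrixP => a b; rewrite !mxE; ring.
  have /cV_norm_leP := lexx `|(\col_i lim c i - \col_i lim c' i) + (intmx p - intmx p') : 'cV[R]_m|.
  move=> /(_ (normr_ge0 _) i); rewrite !mxE rmorphB /=; exact.
(* All limits lie within [rho 0 <= 1 / 8] of each other, so nontrivial integer translates are too
   far apart to shorten the distance. This is the purpose of [ln 8 <= Y 0]. *)
have near : `|lim c i - lim c' i| <= 8^-1.
  have h1 := lim_cen 0 i vc; have h2 := lim_cen 0 i vc'.
  have e0 : cen c 0 i = cen c' 0 i by rewrite /cen /z !big_geq.
  have := ler_normD (lim c i - cen c 0 i) (cen c' 0 i - lim c' i).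
  rewrite e0 subrKA [ `|cen c' _ _ - _|]distrC -e0.
  by have := rho0; rewrite e0 in h1 *; lra.
have rj : rho j.+1 <= 16^-1.
  have : rho j.+1 <= rho 1 by exact: le_rho.
  by have := rho2 0; have := rho0; lra.
have pp : p i 0 - p' i 0 = 0.
  apply/eqP; rewrite -normr_eq0 eq_le normr_ge0 andbT -ltzD1 add0r -(ltr_int R) intr_norm.
  have := ler_normB ((lim c i - lim c' i) + (p i 0 - p' i 0)%:~R) (lim c i - lim c' i).
  by rewrite [X in `|X| <= _]addrAC subrr add0r; lra.
by move: uvi; rewrite pp addr0; lra.
Qed.

Lemma hausdorff_dim_eventual_ge (s B : R) : 0 < s ->
  (forall J, s * Y J.+1 - B <=
    \sum_(0 <= k < J) (Gam (X k.+1) (Y k) - Gam (X k.+1) (Y k.+1) - lower_cst)) ->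
  (s%:E <= hausdorff_dim (eventual_set A X Y 0))%E.
Proof.
move=> s0 HB.
(* Branches splitting at step j are separated at the next radius, hence the shift of index: the mass
   of j + 1 letters is compared with [rho j.+2]. *)
apply: (@hausdorff_dim_ge _ _ nb nb_gt0 pt (fun j => 2 * rho j.+1) s (expR B)) => //.
- by move=> j; rewrite mulr_gt0.
- by have := rho2 0; have := rho0; lra.
- by move=> i j ij; rewrite ler_pM2l// le_rho.
- move=> e e0.
  have Yk k : Y 0 + k%:R * ln 2 <= Y k.
    elim: k => [|k IH]; first by rewrite mul0r addr0.
    by have := stepY k; rewrite -natr1; lra.
  have l2 : 0 < ln 2 :> R by rewrite ln_gt0// ltr1n.
  pose k := (Num.truncn (`|Y 0 + ln (e / 2)| / ln 2)).+1.
  exists k; have kl : `|Y 0 + ln (e / 2)| < k%:R * ln 2.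
    by rewrite -ltr_pdivrMr// truncnS_gt.
  have e20 : 0 < e / 2 by lra.
  have : rho k.+1 < e / 2.
    rewrite /rho -[ltRHS]lnK ?posrE// ltr_expR ltrNl.
    apply: lt_le_trans (Yk k.+1); rewrite -natr1.
    by have := ler_norm (- (Y 0 + ln (e / 2))); rewrite normrN; lra.
  by lra.
- exact: expR_gt0.
- move=> j; have nb0 k : 0 < (nb k)%:R :> R by rewrite ltr0n.
  have -> : cyl_mass R nb j.+1 = expR (- \sum_(0 <= k < j.+1) ln (nb k)%:R).
    rewrite -sumrN expR_sum; apply: eq_bigr => k _.
    by rewrite expRN lnK ?posrE.
  have -> : 2 * rho j.+2 = expR (ln 2 - Y j.+2).
    by rewrite expRD lnK ?posrE.
  rewrite /powR gt_eqF ?expR_gt0// expRK -expRD ler_expR.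
  have := HB j.+1.
  have : \sum_(0 <= k < j.+1) (Gam (X k.+1) (Y k) - Gam (X k.+1) (Y k.+1) - lower_cst)
      <= \sum_(0 <= k < j.+1) ln (nb k)%:R.
    by apply: ler_sum => k _; have [] := WP k.
  have : 0 <= s * ln 2 by rewrite mulr_ge0 ?ln_ge0 ?ler1n// ltW.
  by move: (\sum_(_ <= _ < _) _) (\sum_(_ <= _ < _) _) => *; lra.
Qed.

End lower_bound.

(** * The dimension formula *)

Section log_integral.
Variables (R : realType) (d : nat) (r : R -> nat).
Hypothesis r_le : forall x, (r x <= d)%N.
Hypothesis r_meas : measurable_fun [set: R] (fun x => (r x)%:R : R).
Local Notation leb := (@lebesgue_measure R).
Let f (T : R) : R := (r (ln T))%:R / T.

Definition log_integral (x : R) : R := \int[leb]_(T in `[1, expR x]) f T.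

Let f_ge0 (T : R) : 1 <= T -> 0 <= f T.
Proof. by move=> T1; rewrite divr_ge0// (le_trans _ T1). Qed.

Lemma integrable_inv (D : set R) : measurable D -> D `<=` [set T | 1 <= T] ->
  (leb D < +oo)%E -> leb.-integrable D (EFin \o (fun T => T^-1)).
Proof.
move=> mD D1 Dfin; apply: measurable_bounded_integrable => //.
  apply: (@eq_measurable_fun _ _ _ _ _ (fun T => expR (- ln T))).
    move=> T /set_mem/D1/= T1; have T0 : 0 < T by apply: lt_le_trans T1.
    by rewrite expRN lnK.
  apply: (@measurable_funS _ _ _ _ setT) => //.
  by apply: measurableT_comp => //; apply: measurableT_comp.
exists 1; split => // M M1 T /D1/= T1.
have T0 : 0 < T by apply: lt_le_trans T1.
by rewrite ger0_norm ?invr_ge0 ?(ltW T0)// (le_trans _ (ltW M1))// invf_le1.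
Qed.

Let itv_ge1 (x x' : R) : 1 <= x -> `]expR x, expR x'] `<=` [set T : R | 1 <= T].
Proof.
move=> x1 T /=; rewrite in_itv/= => /andP[/ltW + _]; apply: le_trans.
by rewrite -expR0 ler_expR (le_trans _ x1).
Qed.

Let itv_fin (x x' : R) : (leb `]expR x, expR x'] < +oo)%E.
Proof. by rewrite /= lebesgue_measure_itv/=; case: ifPn => // _; rewrite -EFinB ltry. Qed.

Let int_inv (x x' : R) : 1 <= x ->
  leb.-integrable `]expR x, expR x'] (EFin \o (fun T => T^-1)).
Proof. by move=> x1; apply: integrable_inv => //; exact: itv_ge1. Qed.

Lemma integrable_log_density (D : set R) : measurable D ->
  D `<=` [set T | 1 <= T] -> (leb D < +oo)%E -> leb.-integrable D (EFin \o f).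
Proof.
move=> mD D1 Dfin; apply: measurable_bounded_integrable => //.
  apply: (@eq_measurable_fun _ _ _ _ _ (fun T => (r (ln T))%:R * expR (- ln T))).
    move=> T /set_mem/D1/= T1; have T0 : 0 < T by apply: lt_le_trans T1.
    by rewrite expRN lnK.
  apply: (@measurable_funS _ _ _ _ setT) => //.
  apply: (@measurable_funM _ _ _ _ (fun T => (r (ln T))%:R)).
    by apply: (measurableT_comp r_meas); exact: measurable_realfun.measurable_ln.
  by apply: measurableT_comp => //; apply: measurableT_comp.
exists d%:R; split => // M M1 T /D1/= T1.
have T0 : 0 < T by apply: lt_le_trans T1.
rewrite ger0_norm ?f_ge0// (le_trans _ (ltW M1))// /f ler_pdivrMr//.
apply: (@le_trans _ _ d%:R); first by rewrite ler_nat.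
by rewrite ler_peMr.
Qed.

Lemma Rintegral_inv (x x' : R) : 1 <= x -> x <= x' ->
  \int[leb]_(T in `]expR x, expR x']) T^-1 = x' - x.
Proof.
move=> x1; rewrite le_eqVlt => /predU1P[->|xx].
  by rewrite subrr set_itv_ge ?Rintegral_set0// bnd_simp ltxx.
have ee : expR x < expR x' by rewrite ltr_expR.
have T0 T : expR x <= T -> 0 < T by apply: lt_le_trans; exact: expR_gt0.
have dln T : expR x <= T -> is_derive T 1 (@ln R) T^-1.
  by move=> /T0/is_derive1_ln.
have cont T : expR x <= T -> {for T, continuous (fun T : R => T^-1)}.
  by move=> /T0 T_gt0; apply: inv_continuous; rewrite gt_eqF.
have E : (\int[leb]_(T in `[expR x, expR x']) (T^-1)%:E =
    (ln (expR x'))%:E - (ln (expR x))%:E)%E.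
  apply: continuous_FTC2 => //.
  - apply: continuous_in_subspaceT => T; rewrite inE/= in_itv/= => /andP[/cont].
    by [].
  - split.
    + by move=> T; rewrite in_itv/= => /andP[/ltW/dln[]].
    + apply/cvg_at_right_filter/differentiable_continuous/derivable1_diffP.
      by have [] := dln _ (lexx _).
    + apply/cvg_at_left_filter/differentiable_continuous/derivable1_diffP.
      by have [] := dln _ (ltW ee).
  - move=> T; rewrite in_itv/= => /andP[/ltW/dln HT _].
    by rewrite derive1E derive_val.
rewrite Rintegral_itv_obnd_cbnd; first by rewrite /Rintegral E !expRK.
exact: int_inv.
Qed.

Let log_integralB (x x' : R) : 1 <= x -> x <= x' ->
  log_integral x' - log_integral x = \int[leb]_(T in `]expR x, expR x']) f T.
Proof.
move=> x1 xx; apply: Rintegral_itvB; rewrite ?bnd_simp ?ler_expR//.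
  apply: integrable_log_density => //; first by move=> T /=; rewrite in_itv/= => /andP[].
  by rewrite /= lebesgue_measure_itv/=; case: ifPn => // _; rewrite -EFinB ltry.
by rewrite -expR0 ler_expR (le_trans _ x1).
Qed.

Lemma log_integral_const (x x' : R) k : 1 <= x -> x <= x' ->
  (forall s, x <= s <= x' -> r s = k) ->
  log_integral x' - log_integral x = k%:R * (x' - x).
Proof.
move=> x1 xx rk; rewrite log_integralB// -Rintegral_inv// -RintegralZl ?int_inv//.
apply: eq_Rintegral => T; rewrite inE/= in_itv/= => /andP[xT Tx].
have T0 : 0 < T by apply: lt_trans xT; exact: expR_gt0.
by rewrite /f rk//; apply/andP; split; rewrite -ler_expR lnK ?posrE// ltW.
Qed.

Lemma log_integral_bound (x x' : R) : 1 <= x -> x <= x' ->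
  0 <= log_integral x' - log_integral x <= d%:R * (x' - x).
Proof.
move=> x1 xx; rewrite log_integralB//; apply/andP; split.
  by apply: Rintegral_ge0 => T /(itv_ge1 x1)/=; exact: f_ge0.
rewrite -Rintegral_inv// -RintegralZl ?int_inv//; apply: le_Rintegral => //.
- by apply: integrable_log_density => //; exact: itv_ge1.
- have -> : EFin \o (fun T : R => d%:R * T^-1) = (fun T => (d%:R)%:E * (T^-1)%:E)%E by [].
  by apply: integrableZl => //; exact: int_inv.
- move=> T /(itv_ge1 x1)/= T1; apply: ler_wpM2r; last by rewrite ler_nat.
  by rewrite invr_ge0 (le_trans _ T1).
Qed.

End log_integral.

Section ray.
Variables (R : realType) (m n : nat) (A : 'M[R]_(m, n)).
Hypotheses (m_gt0 : (0 < m)%N) (n_gt0 : (0 < n)%N).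
Local Notation d := (m + n)%N.
Variable tau : R.
Hypothesis tau_gt0 : 0 < tau.

Lemma r_A_rk (T : R) : 0 < T -> r_A A tau T = rk A (ln T) (tau * ln T).
Proof.
move=> T0; have := rk_le_dim A (ln T) (tau * ln T); set k := rk _ _ _ => kd.
have -> : r_A A tau T = #|[pred i : 'I_d | (i < k)%N]|.
  apply: eq_card => i; rewrite !inE.
  have -> : m%:R * n%:R * (1 + tau) / (m + n)%:R * ln T = time m n (ln T) (tau * ln T).
    by rewrite /time; ring.
  have -> : T `^ ((n%:R - m%:R * tau) / (m + n)%:R) =
      1 * expR (scale m n (ln T) (tau * ln T)).
    rewrite mul1r /powR gt_eqF//; congr expR; rewrite /scale; ring.
  by rewrite lambda_ltP// ln1 addr0 subr0.
rewrite -sum1_card (eq_bigl (fun i : 'I_d => (i < k)%N))//.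
by rewrite -(big_ord_widen _ (fun=> 1%N) kd) sum1_card card_ord.
Qed.

Lemma mu_ray_continuous i : (i < d)%N -> continuous (fun x : R => mu A i x (tau * x)).
Proof.
move=> id x; have t0 : 0 < 1 + tau by have := tau_gt0; lra.
apply/cvgrPdist_lt => e e0; near=> x'.
have lip s s' : mu A i s (tau * s) <= mu A i s' (tau * s') + (1 + tau) * `|x - x'| 
    \/ `|s' - s| != `|x - x'|.
  have [ss|] := eqVneq; last by right.
  left; have := mu_lipschitz (@mu_diag _ _ _ A m_gt0 n_gt0) (@le_mu _ _ _ A m_gt0 n_gt0)
    s (tau * s) s' (tau * s') id.
  by rewrite -mulrBr normrM (gtr0_norm tau_gt0) ss mulrDl mul1r.
have [h1|/eqP[]] := lip x x'; last by rewrite distrC.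
have [h2|/eqP[]//] := lip x' x.
have : (1 + tau) * `|x - x'| < e.
  rewrite mulrC -ltr_pdivlMr//; near: x'.
  exact: (nbhsx_ballx x _ (divr_gt0 e0 t0)).
move: h1 h2; move: (mu _ _ _ _) (mu _ _ _ _) => u v h1 h2 h3.
by rewrite ltr_norml; apply/andP; split; lra.
Unshelve. all: by end_near.
Qed.

(** The rank counts the negative minima, and each of these is continuous along the ray. *)
Lemma measurable_rk_ray :
  measurable_fun [set: R] (fun x => (rk A x (tau * x))%:R : R).
Proof.
have -> : (fun x => (rk A x (tau * x))%:R : R) =
    (fun x => \sum_(i < d) \1_[set x | mu A i x (tau * x) < 0] x).
  apply/funext => x.
  under eq_bigr => i _ do rewrite indicE.
  set k := rk _ _ _.
  have kd : (k <= d)%N by exact: rk_le_dim.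
  rewrite -natr_sum; congr _%:R.
  transitivity (\sum_(i < d) (i < k)%N)%N.
    by rewrite -(big_mkcond (fun i : 'I_d => (i < k)%N)) /= -(big_ord_widen _ (fun=> 1%N) kd) sum1_card card_ord.
  apply: eq_bigr => i _; congr nat_of_bool.
  by rewrite rk_mu//; apply/idP/idP => [h|/set_mem//]; exact/mem_set.
apply: measurable_sum => i; apply: measurable_indic.
have -> : [set x | mu A i x (tau * x) < 0] =
    [set: R] `&` (fun x => mu A i x (tau * x)) @^-1` `]-oo, 0[.
  by apply/seteqP; split => x /=; rewrite in_itv/=; [split|case].
by apply: continuous_measurable_fun (mu_ray_continuous (ltn_ord i)) _ _ _.
Qed.

End ray.

(** * Uniform exponents and differences of points *)

Section uniform_exponent.
Variables (R : realType) (m n : nat) (A : 'M[R]_(m, n)).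
Implicit Types (b : torus R m) (s : R).

Lemma D_A_psiP s b : D_A A (psi_ s) b <-> exists M : R, forall t, M < t ->
  exists (p : 'cV[int]_m) (q : 'cV[int]_n),
    `|A *m intmx q - intmx p - repr b| <= expR (- s * t) /\
    `|intmx q : 'cV[R]_n| <= expR t.
Proof.
split=> [[M [_ HM]]|[M HM]].
  exists (ln (`|M| + 1)) => t Mt.
  have M0 : 0 < `|M| + 1 by rewrite ltr_wpDl.
  have [|p [q]] := HM (expR t).
    apply: (le_lt_trans (ler_norm M)); apply: (@lt_trans _ _ (`|M| + 1)).
      by rewrite ltrDl.
    by rewrite -[ltLHS]lnK ?posrE// ltr_expR.
  by rewrite /psi_ /powR gt_eqF ?expR_gt0// expRK => ?; exists p, q.
exists (expR M); split; first exact: num_real.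
move=> T MT; have T0 : 0 < T by apply: lt_trans MT; exact: expR_gt0.
have [|p [q]] := HM (ln T); first by rewrite -ltr_expR lnK ?posrE.
by rewrite lnK ?posrE// => ?; exists p, q; rewrite /psi_ /powR gt_eqF.
Qed.

Lemma le_D_A s s' : s <= s' -> D_A A (psi_ s') `<=` D_A A (psi_ s).
Proof.
move=> ss b /D_A_psiP[M HM]; apply/D_A_psiP; exists (Num.max M 0) => t.
rewrite gt_max => /andP[Mt t0]; have [p [q [h1 h2]]] := HM t Mt.
exists p, q; split => //; apply: le_trans h1 _.
by rewrite ler_expR ler_wpM2r ?lerN2// ltW.
Qed.

(* Approximations of both points at height [T / 2] are subtracted. *)
Lemma D_A_sub s s' b1 b2 b3 (p0 : 'cV[int]_m) : 0 < s -> s < s' ->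
  repr b3 = repr b1 - repr b2 + intmx p0 ->
  D_A A (psi_ s') b1 -> D_A A (psi_ s') b2 -> D_A A (psi_ s) b3.
Proof.
move=> s0 ss E /D_A_psiP[M1 HM1] /D_A_psiP[M2 HM2]; apply/D_A_psiP.
(* The first entry allows height T / 2 for both points. The second absorbs the factor 2 ^ (1 + s')
   into the gap between T ^ - s' and T ^ - s. *)
exists (Num.max (Num.max M1 M2 + ln 2) ((1 + s') * ln 2 / (s' - s))) => t.
rewrite gt_max => /andP[+ tl].
rewrite -ltrBrDr gt_max => /andP[/HM1[p1 [q1 [h1 k1]]] /HM2[p2 [q2 [h2 k2]]]].
exists (p1 - p2 - p0), (q1 - q2); split.
  have -> : A *m intmx (q1 - q2) - intmx (p1 - p2 - p0) - repr b3 =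
      (A *m intmx q1 - intmx p1 - repr b1) - (A *m intmx q2 - intmx p2 - repr b2).
    rewrite E !intmxB mulmxBr.
    by apply/matrixP => i j; rewrite !mxE; ring.
  apply: le_trans (ler_normB _ _) _; apply: le_trans (lerD h1 h2) _.
  rewrite -mulr2n -[leLHS]mulr_natl -[X in X * expR _]lnK ?posrE// -expRD ler_expR.
  by move: tl; rewrite ltr_pdivrMr ?subr_gt0//; lra.
rewrite intmxB; apply: le_trans (ler_normB _ _) _.
apply: le_trans (lerD k1 k2) _.
by rewrite -mulr2n -[leLHS]mulr_natl -[X in X * expR _]lnK ?posrE// -expRD subrKC.
Qed.

Lemma omega_hat_gt s b : 0 < s -> (s%:E < omega_hat A b)%E ->
  exists2 s', s < s' & D_A A (psi_ s') b.
Proof.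
move=> s0 /ereal_sup_gt[_ [[s' [s'0 Ds'] <-]|->]]; rewrite lte_fin => ss.
  by exists s'.
by move: ss; rewrite ltNge ltW.
Qed.

Lemma le_omega_hat s b : 0 < s -> D_A A (psi_ s) b -> (s%:E <= omega_hat A b)%E.
Proof. by move=> s0 Ds; apply: ereal_sup_ubound; left; exists s. Qed.

(** An ultrametric property: a difference has at least the smaller exponent. If [b3] also exceeded
    [tau], then so would [b2], as the difference of [b1] and [b3]. *)
Lemma omega_hat_sub (tau : R) b1 b2 b3 (p0 : 'cV[int]_m) : 0 < tau ->
  repr b3 = repr b1 - repr b2 + intmx p0 ->
  (tau%:E < omega_hat A b1)%E -> omega_hat A b2 = tau%:E ->
  omega_hat A b3 = tau%:E.
Proof.
move=> tau0 E w1 w2; apply/eqP; rewrite eq_le; apply/andP; split; last first.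
  apply/lee_subgt0Pr => e e0; rewrite -EFinB.
  have [te|te] := lerP (tau - e) 0.
    by apply: (@le_trans _ _ 0%E); [rewrite lee_fin|apply: ereal_sup_ubound; right].
  have te2 : ((tau - e / 2)%:E < omega_hat A b2)%E by rewrite w2 lte_fin; lra.
  have te20 : 0 < tau - e / 2 by lra.
  have [s2 s2e D2] := omega_hat_gt te20 te2; have [s1 s1t D1] := omega_hat_gt tau0 w1.
  apply: le_omega_hat => //; apply: (@D_A_sub _ (tau - e / 2) b1 b2 b3 p0) => //.
  - by lra.
  - by apply: le_D_A D1; lra.
  - by apply: le_D_A D2; lra.
rewrite leNgt; apply/negP => w3.
have [s1 s1t D1] := omega_hat_gt tau0 w1; have [s3 s3t D3] := omega_hat_gt tau0 w3.
pose s := Num.min s1 s3; have ts : tau < s by rewrite lt_min s1t.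
have st : tau < (tau + s) / 2 by lra.
have ss : (tau + s) / 2 < s by lra.
have : D_A A (psi_ ((tau + s) / 2)) b2.
  apply: (@D_A_sub _ s b1 b3 b2 p0); [by lra|by []| |..].
  - rewrite E; apply/matrixP => i j; rewrite !mxE; ring.
  - by apply: le_D_A D1; rewrite ge_min lexx.
  - by apply: le_D_A D3; rewrite ge_min lexx orbT.
move=> /le_omega_hat; rewrite w2 lee_fin => /(_ (lt_trans tau0 st)).
by rewrite leNgt st.
Qed.

End uniform_exponent.

Lemma geom_floor (R : realType) (e x : R) : 0 < e -> 1 <= x ->
  exists K, geom e K <= x < geom e K.+1.
Proof.
move=> e0 x1; have [k0 xk0] := geom_unbounded e0 (x + 1).
have : exists k, x < geom e k by exists k0; apply: lt_le_trans xk0; rewrite ltrDl.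
move=> /ex_minnP[[|K] xK min]; first by move: xK; rewrite /geom expr0 ltNge x1.
by exists K; rewrite xK andbT leNgt; apply/negP => /min; rewrite ltnn.
Qed.

Lemma limf_einf_pinfty_lt (R : realType) (f : R -> R) (s M : R) :
  (limf_einf (fun T => (f T)%:E) +oo%R < s%:E)%E -> exists2 T, M < T & f T < s.
Proof.
rewrite limf_einfE => Ls.
have : (ereal_inf [set (f T)%:E | T in [set T : R | (M < T)%R]] < s%:E)%E.
  apply: le_lt_trans Ls; apply: ereal_sup_ubound; exists [set T | M < T] => //.
  by exists M; split => //; exact: num_real.
by move=> /ereal_inf_lt[_ [T MT <-]]; rewrite lte_fin; exists T.
Qed.

Lemma limf_einf_pinfty_gt (R : realType) (f : R -> R) (s : R) :
  (s%:E < limf_einf (fun T => (f T)%:E) +oo%R)%E -> exists M, forall T, M < T -> s < f T.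
Proof.
rewrite limf_einfE => /ereal_sup_gt[_ [V [M [_ MV]] <-] sV]; exists M => T MT.
rewrite -lte_fin; apply: lt_le_trans sV _; apply: ereal_inf_lbound.
by exists T => //; exact: MV.
Qed.

Section level_sets.
Variables (R : realType) (m n : nat) (A : 'M[R]_(m, n)) (tau : R).
Hypotheses (m_gt0 : (0 < m)%N) (n_gt0 : (0 < n)%N) (tau_gt0 : 0 < tau).
Hypothesis tau_nE : ~ exceptional_levels m n tau.
Local Notation d := (m + n)%N.
Local Notation Gam := (Gam A).
Let I := log_integral (fun x => rk A x (tau * x)).

Definition excess x : R := I x - Gam x (tau * x).

Definition ratio (T : R) : R :=
  (\int[lebesgue_measure]_(S in `[1, T]) ((r_A A tau S)%:R / S)
    - ln (N_A A (T `^ (- tau)) T)) / ((1 + tau) * ln T).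

Lemma ratioE T : 1 < T -> ratio T = excess (ln T) / ((1 + tau) * ln T).
Proof.
move=> T1; have T0 : 0 < T by apply: lt_trans T1.
rewrite /ratio /excess; congr ((_ - _) / _).
  rewrite /I /log_integral lnK ?posrE//; apply: eq_Rintegral => S.
  rewrite inE/= in_itv/= => /andP[S1 _]; rewrite r_A_rk//.
  exact: lt_le_trans S1.
rewrite -(ln_N_A A m_gt0 n_gt0); congr (ln (N_A _ _ _)); last by rewrite lnK ?posrE.
by rewrite /powR gt_eqF// mulNr.
Qed.

Let rk_ray_le x : (rk A x (tau * x) <= d)%N. Proof. exact: rk_le_dim. Qed.

Let I_const x x' k : 1 <= x -> x <= x' ->
  (forall s, x <= s <= x' -> rk A s (tau * s) = k) -> I x' - I x = k%:R * (x' - x).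
Proof.
exact: (log_integral_const rk_ray_le (measurable_rk_ray A m_gt0 n_gt0 tau_gt0)).
Qed.

Let I_bound x x' : 1 <= x -> x <= x' -> 0 <= I x' - I x <= d%:R * (x' - x).
Proof.
exact: (log_integral_bound rk_ray_le (measurable_rk_ray A m_gt0 n_gt0 tau_gt0)).
Qed.

Lemma excess_le x x' : 1 <= x -> x <= x' -> excess x <= excess x' + d%:R * (x' - x).
Proof.
move=> x1 xx; have /andP[h _] := I_bound x1 xx.
have yy : tau * x <= tau * x' by rewrite ler_pM2l.
have := Gam_lip A m_gt0 n_gt0 xx (lexx (tau * x)).
have := le_Gam A m_gt0 n_gt0 (lexx x') yy.
rewrite subrr addr0 /excess; move: h; move: (I _) (I _) (Gam _ _) (Gam _ _) (Gam _ _).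
by move=> *; lra.
Qed.

Lemma ray_staircase (eta : R) : 0 < eta ->
  exists e, [/\ 0 < e, e <= eta, e <= 1 & exists C' : R, forall K,
  let x j := geom e j in let y j := tau * geom e j in
  (1 + tau^-1) * \sum_(k < K) (Gam (x k.+2) (y k) - Gam (x k.+2) (y k.+1))
    <= excess (x K.+2) + eta * x K.+2 + C' /\
  excess (x K) - eta * x K - C' <=
    (1 + tau^-1) * \sum_(k < K) (Gam (x k.+1) (y k.+2) - Gam (x k.+1) (y k.+3))].
Proof.
have d0 : (0 < d)%N by rewrite addn_gt0 m_gt0.
have [a a_bound [C0 C0_ge0 growth]] := mu_sum_growth A m_gt0 n_gt0.
have [C C_ge0 sm] := Gam_supermodular A m_gt0 n_gt0.
have rkle x y : (rk A x y <= d)%N by exact: rk_le_dim.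
apply: (staircase d0 rkle (rk_mu A m_gt0 n_gt0) (mu_diag A m_gt0 n_gt0)
  (le_mu A m_gt0 n_gt0) (fun x y => erefl) C_ge0 (le_Gam A m_gt0 n_gt0)
  (Gam_lip A m_gt0 n_gt0) sm tau_gt0 I_const I_bound) => eta' eta'0.
exact: (few_small_minima rkle (mu_ltP A m_gt0 n_gt0) C0_ge0 a_bound growth tau_gt0
  tau_nE d0 eta'0).
Qed.

End level_sets.

(** As 1 + 1 / tau = (1 + tau) / tau, the normalisation (1 + tau) ln T of the formula becomes the
    exponent tau x of the radius. *)
Lemma slope_cancel (F : realFieldType) (tau s x S Q : F) : 0 < tau -> 0 <= Q ->
  (1 + tau^-1) * S <= s * ((1 + tau) * x) + Q -> S <= s * (tau * x) + Q.
Proof.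
move=> t0 Q0 h; have t1 : 0 < 1 + tau by lra.
rewrite -(ler_pM2l t1); apply: (@le_trans _ _ (tau * (s * ((1 + tau) * x) + Q))).
  have -> : (1 + tau) * S = tau * ((1 + tau^-1) * S) by field; rewrite gt_eqF.
  by rewrite ler_pM2l.
have -> : (1 + tau) * (s * (tau * x) + Q) = tau * (s * ((1 + tau) * x) + Q) + Q by ring.
by rewrite lerDl.
Qed.

Section geometric_growth.
Variables (R : realType) (e : R) (e_gt0 : 0 < e) (e_le1 : e <= 1).

Lemma geom2_le k : geom e k.+2 <= 4 * geom e k.
Proof.
rewrite !geomS mulrA ler_wpM2r ?(ltW (geom_gt0 e_gt0 _))//.
by have := e_gt0; have := e_le1; nra.
Qed.

Lemma geom3_le k : geom e k.+3 <= geom e k + 7 * (e * geom e k).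
Proof.
have -> : geom e k + 7 * (e * geom e k) = (1 + 7 * e) * geom e k by ring.
rewrite !geomS !mulrA ler_wpM2r ?(ltW (geom_gt0 e_gt0 _))//.
have : e * e <= e by rewrite ler_piMr// ltW.
have : e * e * e <= e * e by rewrite ler_piMr// mulr_ge0// ltW.
by lra.
Qed.

End geometric_growth.

Lemma exists_between (R : realType) (x : \bar R) (s : R) : (x < s%:E)%E ->
  exists2 s', (x < s'%:E)%E & s' < s.
Proof.
case: x => [r||]; rewrite ?lte_fin => h //.
  by exists ((r + s) / 2); rewrite ?lte_fin; lra.
by exists (s - 1); rewrite ?ltNyr//; lra.
Qed.

(** * Bounds for the dimension *)

Section dimensions.
Variables (R : realType) (m n : nat) (A : 'M[R]_(m, n)) (tau : R).
Hypotheses (m_gt0 : (0 < m)%N) (n_gt0 : (0 < n)%N) (tau_gt0 : 0 < tau).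
Hypothesis tau_nE : ~ exceptional_levels m n tau.
Local Notation d := (m + n)%N.
Local Notation Gam := (Gam A).
Local Notation excess := (excess A tau).
Local Notation ratio := (ratio A tau).
Local Notation level := (limf_einf (fun T => (ratio T)%:E) +oo%R).

Lemma upper_count (s s' : R) : (level < s'%:E)%E -> s' < s ->
  exists e, 0 < e /\ forall (c B : R) k0, exists2 K, (k0 <= K)%N &
    \sum_(0 <= k < K) (Gam (geom e k.+2) (tau * geom e k)
      - Gam (geom e k.+2) (tau * geom e k.+1) + c) <= s * (tau * geom e K) - B.
Proof.
move=> Ls ss; have t0 := tau_gt0.
pose D : R := d%:R; have D0 : 0 <= D by [].
(* The coefficients of eta x_K in the errors: moving from x to x_K, comparing [excess] at x and at
   x_(K+2), and the error of [ray_staircase]. Of the slack g x_K, a quarter goes to these, a quarter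
   to the steps [c], and the rest to constants. *)
pose W := 7 * (`|s'| * tau) + 4 * D + 4.
have s'0 : 0 <= `|s'| * tau by rewrite mulr_ge0// ltW.
have W0 : 0 < W by rewrite /W; lra.
pose g := (s - s') * tau; have g0 : 0 < g by rewrite mulr_gt0// subr_gt0.
have eta0 : 0 < g / (4 * W) by rewrite divr_gt0// mulr_gt0.
have [e [e0 ee e1 [C' HC']]] := ray_staircase A m_gt0 n_gt0 tau_gt0 tau_nE eta0.
exists e; split => // c B k0.
have [|C3 HC3] := @linear_le_geom _ e c (g / 4) e0 e1; first by rewrite divr_gt0.
(* The first summand forces k0 <= K; the second, through x < x_(K+3) <= 8 x_K, makes the constants
   smaller than g x_K / 2. *)
pose M := geom e (k0 + 3) + 8 * 4 / g * (`|B| + `|C'| + `|C3|).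
have [T MT rT] := limf_einf_pinfty_lt (expR M) Ls.
have gk := geom_ge1 e0 (k0 + 3).
have M1 : geom e (k0 + 3) <= M.
  by rewrite /M lerDl mulr_ge0// ?addr_ge0// divr_ge0// ltW.
have T1 : 1 < T.
  apply: le_lt_trans MT; rewrite -expR0 ler_expR; lra.
have T0 : 0 < T by apply: lt_trans T1.
have MlT : M < ln T by rewrite -ltr_expR lnK ?posrE.
have lT1 : 1 <= ln T by lra.
have [[|[|K]] /andP[K1 K2]] := geom_floor e0 lT1.
- by move: K2; rewrite ltNge (le_trans _ (ltW MlT))// (le_trans _ M1)// le_geom// addnC.
- by move: K2; rewrite ltNge (le_trans _ (ltW MlT))// (le_trans _ M1)// le_geom// addnC.
have k0K : (k0 <= K)%N.
  rewrite leqNgt; apply/negP => Kk; move: K2; rewrite ltNge (le_trans _ (ltW MlT))//.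
  by rewrite (le_trans _ M1)// le_geom// !addnS addn0 !ltnS ltnW.
exists K => //.
set x := ln T in MlT lT1 K1 K2 *.
have [/= h _] := HC' K.
have x2_ge1 : 1 <= geom e K.+2 by exact: geom_ge1.
have h2 := excess_le A m_gt0 n_gt0 tau_gt0 x2_ge1 K1.
have h3 : excess x < s' * ((1 + tau) * x).
  rewrite -ltr_pdivrMr ?mulr_gt0//; [|lra..].
  by rewrite -ratioE.
have h4 := HC3 K.
have h5 := geom2_le e0 e1 K; have h6 := geom3_le e0 e1 K.
have x3E : geom e K.+3 = geom e K.+2 + e * geom e K.+2 by rewrite geomS mulrDl mul1r.
rewrite big_mkord big_split /= sumr_const card_ord -[c *+ K]mulr_natl.
have xK0 := geom_gt0 e0 K.
have MN : 8 * 4 / g * (`|B| + `|C'| + `|C3|) <= M by rewrite /M; lra.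
clear HC' HC3 Ls rT MT T1 T0 gk lT1 M1.
move: h h2 h3 h4 h5 h6 K1 K2 x2_ge1 x3E xK0; rewrite -/D.
set S := \sum_(k < K) _; set P := excess _; set P' := excess _.
set xK := geom e K; set x2 := geom e K.+2; set x3 := geom e K.+3; set eta := g / (4 * W).
move=> h h2 h3 h4 h5 h6 K1 K2 x2_ge1 x3E xK0.
pose Q := D * (e * x2) + eta * x2 + `|C'|.
have x2_ge0 : 0 <= x2 by lra.
have eta_ge0 : 0 <= eta by rewrite ltW.
have e_ge0 : 0 <= e by rewrite ltW.
have Q0 : 0 <= Q.
  apply: addr_ge0 (normr_ge0 _); apply: addr_ge0; last exact: mulr_ge0.
  by apply: mulr_ge0 => //; exact: mulr_ge0.
have S1 : S <= s' * (tau * x) + Q.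
  apply: slope_cancel => //; apply: le_trans h _; rewrite /Q.
  have : D * (x - x2) <= D * (e * x2) by rewrite ler_wpM2l//; lra.
  have := ler_norm C'; lra.
have S2 : s' * (tau * x) <= s' * (tau * xK) + `|s'| * tau * (7 * (eta * xK)).
  have -> : s' * (tau * x) = s' * (tau * xK) + s' * tau * (x - xK) by ring.
  rewrite lerD2l; apply: (@le_trans _ _ (`|s'| * tau * (x - xK))).
    have x20 : xK <= x by apply: le_trans K1; rewrite le_geom// ltnW.
    by rewrite ler_wpM2r ?subr_ge0// ler_wpM2r ?(ltW t0)// ler_norm.
  rewrite ler_wpM2l//; have : e * xK <= eta * xK by rewrite ler_wpM2r ?(ltW xK0).
  by lra.
have S3 : Q <= D * (4 * (eta * xK)) + 4 * (eta * xK) + `|C'|.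
  have ex : eta * x2 <= 4 * (eta * xK) by have := ler_wpM2l eta_ge0 h5; lra.
  rewrite /Q lerD2r lerD// ler_wpM2l//; apply: le_trans ex.
  by rewrite ler_wpM2r.
have W4 : W * (eta * xK) = g / 4 * xK by rewrite /eta; field; rewrite gt_eqF.
have big : g / 2 * xK >= `|B| + `|C'| + `|C3|.
  have : M <= 8 * xK.
    have : e * xK <= xK by rewrite ler_piMl// ltW.
    by lra.
  move=> M8; have := le_trans MN M8.
  have E N : 8 * 4 / g * N * g = 32 * N by field; rewrite gt_eqF.
  by rewrite -(ler_pM2r g0) E; have := mulr_ge0 (ltW g0) (ltW xK0); lra.
have sg : s * (tau * xK) = s' * (tau * xK) + g * xK by rewrite /g; ring.
have := ler_norm B; have := ler_norm C3.
move: S1 S2 S3 W4 big sg h4; rewrite /W.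
lra.
Qed.

Lemma lower_count (s s' : R) : 0 <= s -> s < s' -> (s'%:E < level)%E ->
  exists e, 0 < e /\ forall c z : R, exists j0 B, z <= geom e j0 /\ forall J,
    s * (tau * geom e (J + j0).+3) - B <= \sum_(0 <= k < J)
      (Gam (geom e (k + j0).+1) (tau * geom e (k + j0).+2)
       - Gam (geom e (k + j0).+1) (tau * geom e (k + j0).+3) - c).
Proof.
move=> s0 ss sL; have t0 := tau_gt0.
have st0 : 0 <= s * tau by rewrite mulr_ge0// ltW.
pose W := 1 + 7 * (s * tau); have W0 : 0 < W by rewrite /W; lra.
pose g := (s' - s) * tau; have g0 : 0 < g by rewrite mulr_gt0// subr_gt0.
have eta0 : 0 < g / (4 * W) by rewrite divr_gt0// mulr_gt0.
have [e [e0 ee e1 [C' HC']]] := ray_staircase A m_gt0 n_gt0 tau_gt0 tau_nE eta0.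
exists e; split => // c z.
have [|C3 HC3] := @linear_le_geom _ e c (g / 4) e0 e1; first by rewrite divr_gt0.
have [M HM] := limf_einf_pinfty_gt sL.
have [j0 hj0] := geom_unbounded e0 (Num.max z (`|M| + 1)).
pose F k := Gam (geom e k.+1) (tau * geom e k.+2) - Gam (geom e k.+1) (tau * geom e k.+3).
(* The estimate from the lower limit holds only beyond [j0]; the [j0] omitted terms of the sum go
   into the constant. *)
exists j0, (`|C'| + `|C3| + \sum_(k < j0) F k + j0%:R * `|c|).
move: hj0; rewrite ge_max => /andP[zj Mj]; split => // J.
have -> : \sum_(0 <= k < J) (Gam (geom e (k + j0).+1) (tau * geom e (k + j0).+2)
       - Gam (geom e (k + j0).+1) (tau * geom e (k + j0).+3) - c) =
    \sum_(k < J + j0) F k - \sum_(k < j0) F k - J%:R * c.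
  rewrite big_mkord sumrB sumr_const card_ord -[c *+ J]mulr_natl; congr (_ - _).
  rewrite -!(big_mkord xpredT) (@big_cat_nat _ _ _ j0 0 (J + j0))//= ?leq_addl//.
  have -> : \sum_(j0 <= i < J + j0) F i = \sum_(0 <= i < J) F (i + j0)%N.
    by rewrite -{1}[j0]add0n big_addn addnK.
  by rewrite [RHS]addrAC subrr add0r big_mkord.
have [_ h] := HC' (J + j0)%N; have h3 := HC3 J.
have h6 := geom3_le e0 e1 (J + j0).
have jJ : geom e j0 <= geom e (J + j0) by rewrite le_geom// leq_addl.
have jJ' : geom e J <= geom e (J + j0) by rewrite le_geom// leq_addr.
have xK1 : `|M| + 1 <= geom e (J + j0) by apply: le_trans jJ.
have h2 : s' * ((1 + tau) * geom e (J + j0)) < excess (geom e (J + j0)).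
  rewrite -ltr_pdivlMr ?mulr_gt0 ?geom_gt0//; last lra.
  have := HM (expR (geom e (J + j0))); rewrite ratioE ?expRK//; last first.
    by rewrite -expR0 ltr_expR geom_gt0.
  apply; apply: lt_le_trans (expR_ge1Dx _); have := ler_norm M; lra.
have c0 : 0 <= j0%:R * `|c| by rewrite mulr_ge0.
have xK0 := geom_gt0 e0 (J + j0).
clear HC' HC3 sL HM zj Mj jJ xK1.
move: h h2 h3 h6 jJ' c0 xK0.
set S := \sum_(k < J + j0) F k; set S0 := \sum_(k < j0) F k.
rewrite -/S; set P := excess _.
set xK := geom e (J + j0); set xJ := geom e J; set x3 := geom e (J + j0).+3.
set eta := g / (4 * W); set Jc := J%:R * c; set jc := j0%:R * `|c| => h h2 h3 h6 jJ' c0 xK0.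
pose Q := eta * xK + `|C'|.
have Q0 : 0 <= Q by rewrite addr_ge0// mulr_ge0// ltW.
have S1 : - S <= - s' * (tau * xK) + Q.
  apply: slope_cancel => //; rewrite /Q; have := ler_norm C'; lra.
have S2 : s * (tau * x3) <= s * (tau * xK) + 7 * (s * tau) * (eta * xK).
  have : s * tau * x3 <= s * tau * (xK + 7 * (e * xK)) by rewrite ler_wpM2l.
  have : s * tau * (e * xK) <= s * tau * (eta * xK).
    by rewrite ler_wpM2l// ler_wpM2r// ltW.
  lra.
have W4 : W * (eta * xK) = g / 4 * xK by rewrite /eta; field; rewrite gt_eqF.
have gJ : g / 4 * xJ <= g / 4 * xK by rewrite ler_wpM2l// divr_ge0// ltW.
have sg : s' * (tau * xK) = s * (tau * xK) + g * xK by rewrite /g; ring.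
have gx : 0 < g * xK by rewrite mulr_gt0.
have := ler_norm C3; move: S1 S2 W4 gJ sg gx h3 c0; rewrite /W /Q.
lra.
Qed.

(** Discretising with ratio 1 + e costs one step in the ordinate, so the cover works already for tau
    / (1 + e). This strict gain includes the points with [omega_hat] equal to [tau]. *)
Lemma hausdorff_dim_D_A_le (s : R) : (level < s%:E)%E ->
  exists sigma, [/\ 0 < sigma, sigma < tau &
    (hausdorff_dim (D_A A (psi_ sigma)) <= s%:E)%E].
Proof.
move=> /exists_between[s' Ls' ss]; have t0 := tau_gt0.
have [e [e0 H]] := upper_count Ls' ss.
have leS k : geom e k <= geom e k.+1 by rewrite le_geom.
(* The sums are nonnegative, so a bound with B = 1 forces s > 0. *)
have s_gt0 : 0 < s.
  have [K _] := H 0 1 0%N; rewrite big_mkord => h.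
  have : 0 <= s * (tau * geom e K) - 1.
    apply: le_trans h; apply: sumr_ge0 => k _; rewrite addr0 subr_ge0.
    by rewrite le_Gam// ler_pM2l.
  move=> h1; have : 0 < s * (tau * geom e K) by lra.
  by rewrite pmulr_lgt0// mulr_gt0// geom_gt0.
exists (tau / (1 + e)); split.
- by rewrite divr_gt0//; lra.
- by rewrite ltr_pdivrMr; [nra|lra].
apply: (@hausdorff_dim_eventual_le _ _ _ A m_gt0 n_gt0 (fun k => geom e k.+1)
  (fun k => tau * geom e k)) => //.
- by move=> k; rewrite ler_pM2l.
- exact: ltW.
- move=> b /D_A_psiP[M HM]; have [k0 hk0] := geom_unbounded e0 (M + 1).
  exists k0 => // k kk0.
  have [|p [q [h1 h2]]] := HM (geom e k.+1).
    have : geom e k0 <= geom e k.+1 by rewrite le_geom// leqW.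
    lra.
  exists p, q; split => //; apply: le_trans h1 _.
  rewrite ler_expR geomS le_eqVlt; apply/orP; left; apply/eqP.
  by field; rewrite gt_eqF//; lra.
- move=> B; have [k hk] := geom_unbounded e0 (B / tau); exists k.
  by rewrite mulrC -ler_pdivrMr.
Qed.

(** The ordinates run two steps ahead of the abscissae. One step is spent on heights between
    consecutive scales, the other leaves sigma = tau (1 + e). *)
Lemma hausdorff_dim_D_A_ge (s : R) : 0 < s -> (s%:E < level)%E ->
  exists2 sigma, tau < sigma & (s%:E <= hausdorff_dim (D_A A (psi_ sigma)))%E.
Proof.
move=> s0 sL; have t0 := tau_gt0.
have [s' s'L ss] : exists2 s', (s'%:E < level)%E & s < s'.
  have : (- level < (- s)%:E)%E by rewrite EFinN lteN2.
  move=> /exists_between[s' h1 h2]; exists (- s'); last by lra.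
  by rewrite EFinN lteNl.
have [e [e0 H]] := lower_count (ltW s0) ss s'L.
have te0 : 0 < tau * e by rewrite mulr_gt0.
(* Beyond the sum of these three thresholds, every step adds at least ln 2 to both [X] and [Y], and
   [Y 0] is at least ln 8. *)
have [j0 [B [zj HB]]] := H (lower_cst R m n)
  (ln 2 / e + ln 2 / (tau * e) + ln 8 / tau).
have l2 : 0 <= ln 2 :> R by rewrite ln_ge0// ler1n.
have l8 : 0 <= ln 8 :> R by rewrite ln_ge0// ler1n.
have z1 : 0 <= ln 2 / e by rewrite divr_ge0// ltW.
have z2 : 0 <= ln 2 / (tau * e) by rewrite divr_ge0// ltW.
have z3 : 0 <= ln 8 / tau by rewrite divr_ge0// ltW.
have xj k : ln 2 / e + ln 2 / (tau * e) + ln 8 / tau <= geom e (k + j0).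
  by apply: le_trans zj _; rewrite le_geom// leq_addl.
have geomD k : geom e k.+1 = geom e k + e * geom e k by rewrite geomS mulrDl mul1r.
exists (tau * (1 + e)); first by rewrite mulrDr mulr1 ltrDl.
pose X k := geom e (k + j0); pose Y k := tau * geom e (k + j0).+2.
apply: (@le_trans _ _ (hausdorff_dim (eventual_set A X Y 0))).
  apply: (@hausdorff_dim_eventual_ge _ _ _ A m_gt0 n_gt0 X Y _ _ _ s B) => //.
  - move=> k; rewrite /X addSn geomD lerD2l mulrC -ler_pdivrMr//.
    by apply: le_trans (xj k); lra.
  - move=> k; rewrite /Y addSn [geom e (k + j0).+3]geomD mulrDr lerD2l mulrA mulrC.
    rewrite -ler_pdivrMr//; apply: le_trans (xj k.+2).
    lra.
  - rewrite /Y mulrC -ler_pdivrMr//; apply: le_trans (xj 2%N); lra.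
apply: le_hausdorff_dim => b Hb; apply/D_A_psiP; exists (geom e j0) => t jt.
have t1 : 1 <= t by apply: ltW; apply: le_lt_trans jt; exact: geom_ge1.
have [K /andP[K1 K2]] := geom_floor e0 t1.
have jK : (j0 <= K)%N.
  rewrite leqNgt; apply/negP => Kj; move: K2; rewrite ltNge => /negP; apply.
  by apply: ltW; apply: le_lt_trans jt; rewrite le_geom.
have [p [q [h1 h2]]] := Hb (K - j0)%N (leq0n _).
exists p, q; rewrite /X /Y !subnK// in h1 h2; split; last first.
  by apply: le_trans h2 _; rewrite ler_expR.
apply: le_trans h1 _; rewrite ler_expR mulNr lerN2 geomS -!mulrA ler_pM2l//.
by rewrite ler_pM2l ?addr_gt0// ltW.
Qed.

End dimensions.

(** * Translations of the torus and the exact level *)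

Section translation.
Variables (R : realType) (m : nat) (b0 : torus R m).

Definition translate (b : torus R m) : torus R m :=
  \pi_(torus R m)%qT (repr b - repr b0).

Lemma lifts_translate b u : lifts (translate b) u -> lifts b (u + repr b0).
Proof.
have tb : lifts (translate b) (repr b - repr b0) by [].
move=> bu; have [p up] := lifts_eq bu tb.
have -> : u + repr b0 = repr b + intmx p.
  by rewrite -up; apply/matrixP => i j; rewrite !mxE; ring.
by apply: lifts_add; exact: lifts_repr.
Qed.

Lemma mdist_translate b b' : mdist b b' <= mdist (translate b) (translate b').
Proof.
apply: lb_le_inf; first by case: (torus_dist_has_inf (translate b) (translate b')).
move=> _ [u bu [v bv <-]].
have -> : u - v = (u + repr b0) - (v + repr b0).
  by apply/matrixP => i j; rewrite !mxE; ring.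
by apply: torus_dist_le; exact: lifts_translate.
Qed.

Lemma repr_translate b : exists p : 'cV[int]_m,
  repr (translate b) = repr b - repr b0 + intmx p.
Proof.
have tb : lifts (translate b) (repr b - repr b0) by [].
have [p E] := lifts_eq (lifts_repr (translate b)) tb.
by exists p; rewrite -E addrC subrK.
Qed.

End translation.

Lemma le_ereal_real (R : realType) (x y : \bar R) :
  (forall s : R, (y < s%:E)%E -> (x <= s%:E)%E) -> (x <= y)%E.
Proof.
case: y => [r| |] H; rewrite ?leey//.
  by apply/lee_addgt0Pr => e e0; rewrite -EFinD H// lte_fin ltrDl.
case: x H => [r| |] H //; last by have := H 0; rewrite ltNyr => /(_ isT).
exfalso; have := H (r - 1); rewrite ltNyr lee_fin => /(_ isT); lra.
Qed.

Theorem corollary1p7 (R : realType) (m n : nat) (A : 'M[R]_(m, n)) (tau : R) :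
  (0 < m)%N -> (0 < n)%N -> 0 < tau -> ~ exceptional_levels m n tau ->
  [/\ hausdorff_dim [set b | (tau%:E <= omega_hat A b)%E]
        = hausdorff_dim [set b | (tau%:E < omega_hat A b)%E],
      hausdorff_dim [set b | (tau%:E < omega_hat A b)%E] = hausdorff_dim (D_A A (psi_ tau)),
      [set b | omega_hat A b = tau%:E] !=set0 ->
        hausdorff_dim [set b | omega_hat A b = tau%:E] = hausdorff_dim (D_A A (psi_ tau))
    & hausdorff_dim (D_A A (psi_ tau)) = limf_einf (fun T : R =>
        ((\int[lebesgue_measure]_(S in `[1, T]) ((r_A A tau S)%:R / S)
            - ln (N_A A (T `^ (- tau)) T))
          / ((1 + tau) * ln T))%:E) +oo].
Proof.
move=> m0 n0 t0 tE; set L := limf_einf _ _.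
set Dge := [set b | (tau%:E <= _)%E]; set Dgt := [set b | (tau%:E < _)%E].
have LE : L = limf_einf (fun T => (ratio A tau T)%:E) +oo%R by [].
have ge_L : (hausdorff_dim Dge <= L)%E.
  apply: le_ereal_real => s; rewrite LE => /(hausdorff_dim_D_A_le m0 n0 t0 tE).
  move=> [sigma [s0 st Hs]]; apply: le_trans Hs; apply: le_hausdorff_dim => b tb.
  have [|s' ss' Ds'] := @omega_hat_gt _ _ _ A sigma b s0.
    by apply: lt_le_trans tb; rewrite lte_fin.
  exact: le_D_A (ltW ss') _ Ds'.
have L_gt : (L <= hausdorff_dim Dgt)%E.
  apply: le_ereal_real => s Hs; rewrite leNgt; apply/negP => sL.
  (* The Cantor sets require s > 0, which is automatic for s above a dimension. *)
  have s0 : 0 < s by rewrite -lte_fin (le_lt_trans _ Hs)// hausdorff_dim_ge0.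
  have [sigma st sH] := hausdorff_dim_D_A_ge m0 n0 t0 tE s0 sL.
  have : (s%:E < s%:E)%E.
    apply: le_lt_trans Hs; apply: le_trans sH _; apply: le_hausdorff_dim => b Db.
    rewrite /Dgt /= (lt_le_trans _ (le_omega_hat _ Db))// ?lte_fin//.
    exact: lt_trans st.
  by rewrite ltxx.
have gt_D : (hausdorff_dim Dgt <= hausdorff_dim (D_A A (psi_ tau)))%E.
  apply: le_hausdorff_dim => b /(omega_hat_gt t0)[s ts Ds].
  exact: le_D_A (ltW ts) _ Ds.
have D_ge : (hausdorff_dim (D_A A (psi_ tau)) <= hausdorff_dim Dge)%E.
  by apply: le_hausdorff_dim => b; exact: le_omega_hat.
have D_L : hausdorff_dim (D_A A (psi_ tau)) = L.
  by apply/eqP; rewrite eq_le (le_trans D_ge ge_L) (le_trans L_gt gt_D).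
have gt_E : hausdorff_dim Dgt = L.
  by apply/eqP; rewrite eq_le L_gt -D_L gt_D.
have ge_E : hausdorff_dim Dge = L.
  by apply/eqP; rewrite eq_le ge_L -D_L D_ge.
split; rewrite ?D_L ?gt_E ?ge_E//.
move=> [b0 wb0]; apply/eqP; rewrite eq_le -{1}ge_E -gt_E; apply/andP; split.
  by apply: le_hausdorff_dim => b /= wb; rewrite /Dge /= wb.
(* Subtracting [b0] maps the points of larger exponent into the level set, so the level has at least
   their dimension. *)
apply: (@le_hausdorff_dim_expand _ _ (translate b0)); first exact: mdist_translate.
move=> b wb /=; have [p E] := repr_translate b0 b.
exact: omega_hat_sub t0 E wb wb0.
Qed.
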